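(* Let $m\ge 2$ be an integer and $H$ a real number with $\log H \ge s(m)e^{s(m)}$. Then \[ \omega (m, H) \le \begin{cases} 2+ \frac{4.93}{\log \log H}, &m=2;\\ 3+ \frac{6.49}{\log \log H}, &m=3;\\ 4+ \frac{15.7}{\log \log H}, &m=4;\\ m +\left(1-\frac{2\kappa_m}{(\log m)^2}\right)\left(1-\frac{\kappa_m}{\log m}\right) \cdot \frac{m^2 \log m}{\log \log H}, & 5\leq m\leq 14;\\ m +\left(1-\frac{1+\kappa_m}{(\log m)^2}\right)\left(1-\frac{\kappa_m}{\log m}\right) \cdot \frac{m^2 \log m}{\log \log H}, &m \ge 15. \end{cases} \] Moreover, \[ \lim_{m\to\infty}\kappa_m=\kappa=\sum_{p\ \mathrm{prime}}\frac{\log p}{p(p-1)}=0.75536661083\dots . \]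
   Context: For $m,H\ge 1$, $\omega(m,H)$ denotes the infimum of the real numbers $r>0$ such that $|\lambda_0+\lambda_1e+\lambda_2e^2+\dots+\lambda_me^m|>H^{-r}$ for all $(\lambda_0,\dots,\lambda_m)\in\mathbb{Z}^{m+1}\setminus\{0\}$ with $\max_{1\le i\le m}|\lambda_i|\le H$. Set $s(2)=e$ and $s(m)=m(\log m)^2$ for $m\ge 3$. For real $y\ge 2$ and $x>1$ put $w_y(x)=1-\frac{y}{x}-\frac{y-1}{\log y}\frac{\log x}{x}$. For $m\ge 2$ define \[ \kappa_m=\frac1m\sum_{\substack{p\le \frac{m+1}{2}\\ p \text{ prime}}}\ \min_{0\le j\le m}\left\{\left\lfloor \frac jp\right\rfloor+\left\lfloor\frac{m-j}{p}\right\rfloor\right\}\frac{\log p}{p-1}\,w_p\!\left(s(m)e^{s(m)}\right). \] *)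

(* Defs.v *)
From HB Require Import structures.
From mathcomp Require Import all_boot all_order all_algebra.
From mathcomp Require Import all_classical all_reals all_analysis.
Set Implicit Arguments. Unset Strict Implicit. Unset Printing Implicit Defensive.
Import Order.TTheory GRing.Theory Num.Theory.
Import numFieldNormedType.Exports.
Local Open Scope classical_set_scope.
Local Open Scope ring_scope.

Section Defs.
Variable R : realType.

Definition euler : R := expR 1.

Definition s_ (m : nat) : R :=
  if m == 2%N then euler else m%:R * (ln (m%:R : R)) ^+ 2.

Definition w_ (y x : R) : R := 1 - y / x - (y - 1) / ln y * (ln x / x).

(* min_{0<=j<=m} ( floor(j/p) + floor((m-j)/p) ); the neutral element m %/ p
   is the value at j = 0, so the big min is exactly the minimum. *)
Definition minfloor (m p : nat) : nat :=
  \big[minn/(m %/ p)%N]_(j < m.+1) (j %/ p + (m - j) %/ p)%N.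

(* kappa_m; primes p <= (m+1)/2 are exactly primes p < ((m+1)./2).+1 *)
Definition kappa_ (m : nat) : R :=
  (m%:R)^-1 * \sum_(p < ((m.+1)./2).+1 | prime p)
     (minfloor m p)%:R * (ln (p%:R : R) / (p%:R - 1))
       * w_ p%:R (s_ m * expR (s_ m)).

Definition omega_set (m : nat) (H : R) : set R :=
  [set r : R | 0 < r /\
     forall lam : 'I_m.+1 -> int,
       (exists i, lam i != 0) ->
       (forall i : 'I_m.+1, (0 < i)%N -> (`|lam i|%:~R : R) <= H) ->
       H `^ (- r) < `| \sum_(i < m.+1) (lam i)%:~R * euler ^+ i |].

Definition omega (m : nat) (H : R) : R := inf (omega_set m H).

Definition omega_bound (m : nat) (H : R) : R :=
  let L := ln (ln H) in
  let k := kappa_ m in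
  let lm := ln (m%:R : R) in
  if m == 2%N then 2 + (493%:R / 100%:R) / L
  else if m == 3%N then 3 + (649%:R / 100%:R) / L
  else if m == 4%N then 4 + (157%:R / 10%:R) / L
  else if (m <= 14)%N then
    m%:R + (1 - 2 * k / lm ^+ 2) * (1 - k / lm) * (m%:R ^+ 2 * lm / L)
  else
    m%:R + (1 - (1 + k) / lm ^+ 2) * (1 - k / lm) * (m%:R ^+ 2 * lm / L).

Definition kappa_term (p : nat) : R :=
  if prime p then ln (p%:R : R) / (p%:R * (p%:R - 1)) else 0.

(* the decimal number 0.abcdefghijk given by digit groups a1=ab, a2, a3, a4
   (0.a1 a2 a3 a4 with a1 two digits and a2 a3 a4 three digits each) *)
Definition dec11 (a1 a2 a3 a4 : nat) : R :=
  (((a1%:R * 1000%:R + a2%:R) * 1000%:R + a3%:R) * 1000%:R + a4%:R)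
    / (10%:R ^+ 11).

End Defs.

(* Main.v *)
Require Import Defs.
From HB Require Import structures.
From Stdlib Require Import ZArith.
From mathcomp Require Import all_boot all_order all_algebra.
From mathcomp Require Import all_classical all_reals all_analysis.
From mathcomp Require Import ssrZ zify ring lra.
Import Order.TTheory GRing.Theory Num.Theory.
Import numFieldNormedType.Exports.
Local Open Scope classical_set_scope.
Local Open Scope ring_scope.
Delimit Scope Z_scope with ZZ.

(** Hermite's method with auxiliary polynomials f = (x (x - 1) ... (x - m))^l q, deg q <= m.
    With F the sum of the derivatives of f, Lambda = sum_j lambda_j e^j satisfies
    Lambda F(0) = sum_j lambda_j F(j) + sum_j lambda_j (e^j F(0) - F(j)); the last sum is small
    because f is small on [0, m], and F determines q, so the first sum is nonzero for some q.
    That sum is an integer divisible not only by l! but also by extra powers of the primes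
    p <= (m + 1) / 2, since among any m + 1 factors x + c with consecutive c sufficiently many
    lie in the ideal (p, x); this gain is worth m kappa l in the exponent. Choosing l minimal
    such that the remainder is at most half of the divisor gives a lower bound for |Lambda|,
    and monotonicity in log H reduces the claim to inequalities at log H = s(m) e^s(m); these
    are verified by interval arithmetic for m < 30 and by polynomial estimates in log m beyond.
    For the digits of kappa,
    1/(p (p - 1)) = 1/(p^2 - 1) + 1/(p^3 - 1) + 1/(p (p + 1) (p^3 - 1)): the first two sums over
    primes are the values of - zeta' / zeta at 2 and 3, where Euler-Maclaurin summation applies,
    and the third converges fast. *)

(** $F(0)$ has about the size of $((m+1)l)!$ and the divisor about that of $l!$, so $-\ln|\Lambda|$
    is about $m\,l\ln l$, while the remainder becomes harmless once $l\ln l$ exceeds $\ln H$ by a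
    multiple of $l$. The ratio of factorials gives the main term $m$; everything of order $l$,
    collected in the coefficient [b], gives the second term, since $l$ is about $\ln H/\ln\ln H$.
    The sup norm of $x(x-1)\cdots(x-m)$, of size about $m!$, enters [b] $m$ times and accounts for
    $m^2\ln m$. With $K$ the value of [ksum], the extra prime powers lower [b] by $(m+1)K$: once
    through the divisor itself, and $m$ times because a smaller $l$ suffices. The difficulty is that
    the claim starts at an explicit threshold: comparing $l$ with $\ln H/\ln\ln H$ costs a factor of
    about $(s+\ln s)/(s-a)$ at $\ln\ln H = s+\ln s$, and [b] times this factor must stay below the
    products in the statement. All lower order terms are therefore kept as explicit multiples of
    $l$. *)

Section Monotone.
Variable R : realType.
Implicit Types (f df : R -> R) (a b x y z : R).

Lemma is_derive_le f df a b : a <= b ->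
  (forall x, a <= x <= b -> is_derive x (1 : R) f (df x)) ->
  (forall x, a <= x <= b -> 0 <= df x) -> f a <= f b.
Proof.
move=> ab fd df0.
have fd' x : x \in `]a, b[%R -> is_derive x (1 : R) f (df x).
  by move=> xab; apply: fd; rewrite !ltW ?(itvP xab).
have fc : {within `[a, b], continuous f}.
  apply: derivable_within_continuous => x xab.
  by have [] := fd x _; rewrite ?(itvP xab).
have [c cab] := MVT_segment ab fd' fc; rewrite -subr_ge0 => ->.
by apply: mulr_ge0; [apply: df0; rewrite ?(itvP cab)|rewrite subr_ge0].
Qed.
End Monotone.

(** * Differentiation rules for explicit functions *)

Section DeriveRules.
Variable R : realType.
Implicit Types (f g : R -> R) (x a b : R).

Lemma dcst x (c : R) : is_derive x (1 : R) (fun _ : R => c) (0 : R).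
Proof. exact: is_derive_cst. Qed.

Lemma did x : is_derive x (1 : R) (fun y : R => y) (1 : R).
Proof. exact: is_derive_id. Qed.

Lemma dadd f g x a b : is_derive x (1 : R) f a -> is_derive x (1 : R) g b ->
  is_derive x (1 : R) (fun y => f y + g y) (a + b).
Proof. exact: is_deriveD. Qed.

Lemma dopp f x a : is_derive x (1 : R) f a -> is_derive x (1 : R) (fun y => - f y) (- a).
Proof. exact: is_deriveN. Qed.

Lemma dmul f g x a b : is_derive x (1 : R) f a -> is_derive x (1 : R) g b ->
  is_derive x (1 : R) (fun y => f y * g y) (a * g x + f x * b).
Proof.
by move=> fa gb; apply: is_derive_eq (is_deriveM fa gb) _; rewrite addrC /GRing.scale /= (mulrC (g x)).
Qed.

Lemma dexpn f x a n : is_derive x (1 : R) f a ->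
  is_derive x (1 : R) (fun y => f y ^+ n) (n%:R * f x ^+ n.-1 * a).
Proof.
move=> fa; have -> : (fun y => f y ^+ n) = f ^+ n; last exact: is_deriveX.
by elim: n => [|n IH]; rewrite ?expr0// exprS -IH; apply/funext => y; rewrite exprS.
Qed.

Lemma dexpR f x a : is_derive x (1 : R) f a ->
  is_derive x (1 : R) (fun y => expR (f y)) (expR (f x) * a).
Proof. by move=> fa; apply: is_derive1_comp. Qed.

Lemma dln f x a : 0 < f x -> is_derive x (1 : R) f a ->
  is_derive x (1 : R) (fun y => ln (f y)) ((f x)^-1 * a).
Proof. by move=> f0 fa; apply: is_derive1_comp; exact: is_derive1_ln. Qed.

Lemma dinv f x a : f x != 0 -> is_derive x (1 : R) f a ->
  is_derive x (1 : R) (fun y => (f y)^-1) (- a / f x ^+ 2).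
Proof.
move=> f0 fa; apply: is_derive_eq (is_deriveV f0 fa) _.
by rewrite /GRing.scale /= mulNr mulrC mulNr mulrC.
Qed.

Lemma dconv f x a b : is_derive x (1 : R) f a -> a = b -> is_derive x (1 : R) f b.
Proof. by move=> ? <-. Qed.
End DeriveRules.

(* [apply] would run type class resolution on the premises, and pick instances with [*:] *)
Ltac der_step := first
  [ eassumption | notypeclasses refine (dcst _ _ _) | notypeclasses refine (did _ _)
  | notypeclasses refine (dadd _ _ _ _ _ _ _ _) | notypeclasses refine (dopp _ _ _ _ _)
  | notypeclasses refine (dmul _ _ _ _ _ _ _ _) | notypeclasses refine (dexpn _ _ _ _ _ _)
  | notypeclasses refine (dexpR _ _ _ _ _) | notypeclasses refine (dln _ _ _ _ _ _) | notypeclasses refine (dinv _ _ _ _ _ _) ].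
Ltac der := notypeclasses refine (@dconv _ _ _ _ _ _ _); [repeat der_step|cbv beta].

(** * Two-sided bounds for the logarithm from the series of artanh *)

Section LnSeries.
Variable R : realType.
Implicit Types (z : R) (n : nat).

(** The factor $2$ makes this a partial sum of $2\,\mathrm{artanh}\,z = \ln\frac{1+z}{1-z}$. *)
Definition atanh_sum (n : nat) (z : R) : R :=
  \sum_(k < n) (2 / (2 * k + 1)%:R) * z ^+ (2 * k + 1).

Lemma is_derive_atanh_sum n z :
  is_derive z (1 : R) (atanh_sum n) (2 * \sum_(k < n) (z ^+ 2) ^+ k).
Proof.
have -> : atanh_sum n =
    \sum_(k < n) (fun y : R => (2 / (2 * k + 1)%:R) * y ^+ (2 * k + 1)).
  by apply/funext => y; rewrite fct_sumE.
rewrite mulr_sumr; apply: is_derive_sum => k; der.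
rewrite mul0r add0r mulr1 addn1 /= -exprM.
have h : ((2 * k).+1%:R : R) != 0 by rewrite pnatr_eq0.
by rewrite mulrA divfK.
Qed.

Lemma atanh_geo n z : 0 <= z < 1 ->
  2 * \sum_(k < n) (z ^+ 2) ^+ k = (1 + z)^-1 + (1 - z)^-1 - 2 * (z ^+ 2) ^+ n / (1 - z ^+ 2) :> R.
Proof.
move=> /andP[z0 z1].
have h1 : 1 - z ^+ 2 != 0 by rewrite subr_eq0 eq_sym lt_eqF// expr_lt1.
have := subrX1 (z ^+ 2) n.
have [S ->] : exists S : R, \sum_(i < n) (z ^+ 2) ^+ i = S by eexists.
move=> e; have -> : S = (1 - (z ^+ 2) ^+ n) / (1 - z ^+ 2).
  apply: (mulIf h1); rewrite divfK//.
  have k : S * (1 - z ^+ 2) = - ((z ^+ 2 - 1) * S) :> R by ring.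
  by rewrite k -e opprB.
have h2 : 1 + z != 0 by rewrite gt_eqF// ltr_pwDl.
have h3 : 1 - z != 0 by rewrite gt_eqF// subr_gt0.
by field; rewrite h1 h2 h3.
Qed.

Lemma is_derive_lnratio z : 0 <= z < 1 ->
  is_derive z (1 : R) (fun y : R => ln (1 + y) - ln (1 - y)) ((1 + z)^-1 + (1 - z)^-1).
Proof.
move=> /andP[z0 z1].
have h2 : 0 < 1 + z by rewrite ltr_pwDl.
have h3 : 0 < 1 - z by rewrite subr_gt0.
by der => //; field; rewrite !gt_eqF.
Qed.

Lemma atanh_sum0 n : atanh_sum n 0 = 0 :> R.
Proof. by rewrite /atanh_sum big1// => i _; rewrite addn1 exprS mul0r mulr0. Qed.

Lemma ln_ge_atanh n z : 0 <= z < 1 -> atanh_sum n z <= ln (1 + z) - ln (1 - z).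
Proof.
move=> /andP[z0 z1].
pose f := fun y : R => (ln (1 + y) - ln (1 - y)) - atanh_sum n y.
suff: f 0 <= f z.
  have -> : f 0 = 0 by rewrite /f atanh_sum0 !addr0 !subr0 ln1 ?subr0.
  by rewrite subr_ge0.
have h y : 0 <= y <= z -> 0 <= y < 1 by move=> /andP[-> /le_lt_trans]; apply.
apply: (@is_derive_le R f (fun y => ((1 + y)^-1 + (1 - y)^-1) - 2 * \sum_(k < n) (y ^+ 2) ^+ k)) => // y yz.
  have := is_derive_lnratio y (h _ yz); have := is_derive_atanh_sum n y.
  by move=> ? ?; apply: is_deriveB.
rewrite (atanh_geo _ _ (h _ yz)) subKr; have /andP[y0 y1] := h _ yz.
by rewrite divr_ge0 ?mulr_ge0 ?exprn_ge0// subr_ge0 expr_le1// ltW.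
Qed.

Lemma ln_le_atanh n z : 0 <= z < 1 ->
  ln (1 + z) - ln (1 - z) <= atanh_sum n z + 2 / (2 * n + 1)%:R * z ^+ (2 * n + 1) / (1 - z ^+ 2).
Proof.
move=> /andP[z0 z1].
(* Freezing $1/(1-y^2)$ at its largest value, at the endpoint $z$, keeps the error term a monomial
   with an easy derivative. *)
pose c := (1 - z ^+ 2)^-1.
have c0 : 0 <= c by rewrite invr_ge0 subr_ge0 expr_le1// ltW.
pose f := fun y : R => atanh_sum n y + (2 / (2 * n + 1)%:R * y ^+ (2 * n + 1)) * c - (ln (1 + y) - ln (1 - y)).
suff: f 0 <= f z.
  have -> : f 0 = 0.
    by rewrite /f atanh_sum0 !addr0 !subr0 ln1 addn1 exprS; ring.
  by rewrite subr_ge0.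
have h y : 0 <= y <= z -> 0 <= y < 1 by move=> /andP[-> /le_lt_trans]; apply.
apply: (@is_derive_le R f (fun y => 2 * \sum_(k < n) (y ^+ 2) ^+ k + 2 * (y ^+ 2) ^+ n * c - ((1 + y)^-1 + (1 - y)^-1))) => // y yz.
  have := is_derive_lnratio y (h _ yz); have := is_derive_atanh_sum n y.
  move=> ? ?; apply: is_deriveB; apply: is_deriveD.
  der; have h' : ((2 * n).+1%:R : R) != 0 by rewrite pnatr_eq0.
  by rewrite mul0r add0r mulr0 addr0 mulr1 addn1 /= -exprM mulrA divfK.
rewrite (atanh_geo _ _ (h _ yz)); have /andP[y0 y1] := h _ yz.
have -> (a b d : R) : a - b + d - a = d - b by ring.
rewrite subr_ge0 ler_wpM2l ?mulr_ge0 ?exprn_ge0// /c lef_pV2 ?posrE ?subr_gt0 ?expr_lt1//.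
by rewrite lerD2l lerN2 lerXn2r// ?nnegrE//; case/andP: yz.
Qed.

End LnSeries.

(** * Euler-Maclaurin summation: one step *)

Section EulerMaclaurin.
Variable R : realType.
Implicit Types (x y t : R) (c : R * R) (k s n N : nat).

Lemma dshift (f : R -> R) x t d : is_derive (x + t) (1 : R) f d ->
  is_derive t (1 : R) (fun y => f (x + y)) d.
Proof.
move=> fd; have h : is_derive t (1 : R) (fun y : R => x + y) 1 by der; rewrite ?add0r.
by have := @is_derive1_comp R f (fun y => x + y) t _ _ fd h; rewrite mulr1.
Qed.

(* Taylor's formula at [t = 1] for the remainder [G] of the corrected trapezoidal rule on
   [[x, x + t]], whose third derivative is [t ^+ 2 / 12 * f4 (x + t)]; and
   [t ^+ 2 * (1 - t) ^+ 2 / 24 <= 1 / 384]. *)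
Lemma euler_maclaurin_step (F f f1 f2 f3 f4 : R -> R) x : 0 < x ->
  (forall y, 0 < y -> is_derive y (1 : R) F (f y)) ->
  (forall y, 0 < y -> is_derive y (1 : R) f (f1 y)) ->
  (forall y, 0 < y -> is_derive y (1 : R) f1 (f2 y)) ->
  (forall y, 0 < y -> is_derive y (1 : R) f2 (f3 y)) ->
  (forall y, 0 < y -> is_derive y (1 : R) f3 (f4 y)) ->
  (forall y, x <= y -> 0 <= f4 y) ->
  0 <= F (x + 1) - F x - (f x + f (x + 1)) / 2 + (f1 (x + 1) - f1 x) / 12
    <= (f3 (x + 1) - f3 x) / 384.
Proof.
move=> x0 dF df df1 df2 df3 f40.
pose G t := F (x + t) - F x - (f x + f (x + t)) * (t / 2) + (f1 (x + t) - f1 x) * (t ^+ 2 / 12).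
pose G1 t := (f (x + t) - f x) / 2 - f1 (x + t) * (t / 3) - f1 x * (t / 6) + f2 (x + t) * (t ^+ 2 / 12).
pose G2 t := (f1 (x + t) - f1 x) / 6 - f2 (x + t) * (t / 6) + f3 (x + t) * (t ^+ 2 / 12).
(* The Taylor polynomial of [G] at $t$, evaluated at $1$: its derivative telescopes to the single
   term [D'], whose sign is that of [f4]. *)
pose D t := G t + (1 - t) * G1 t + (1 - t) ^+ 2 / 2 * G2 t.
pose D' t := (1 - t) ^+ 2 * t ^+ 2 / 24 * f4 (x + t).
have dD t : 0 <= t -> is_derive t (1 : R) D (D' t).
  move=> t0; have xt : 0 < x + t by rewrite ltr_wpDr.
  have hF := dshift _ _ _ _ (dF _ xt); have hf := dshift _ _ _ _ (df _ xt).
  have hf1 := dshift _ _ _ _ (df1 _ xt); have hf2 := dshift _ _ _ _ (df2 _ xt).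
  have hf3 := dshift _ _ _ _ (df3 _ xt).
  by rewrite /D /G /G1 /G2; der; rewrite /D' /GRing.scale /=; field.
have D0 : D 0 = 0 by rewrite /D /G /G1 /G2 addr0; ring.
have D1 : D 1 = F (x + 1) - F x - (f x + f (x + 1)) / 2 + (f1 (x + 1) - f1 x) / 12.
  by rewrite /D /G /G1 /G2; field.
have p0 (u : R) : 0 <= u <= 1 -> 0 <= (1 - u) ^+ 2 * u ^+ 2 / 24 <= 1 / 384.
  move=> /andP[u0 u1]; rewrite -exprMn divr_ge0 ?sqr_ge0//=.
  have h0 : 0 <= (1 - u) * u by rewrite mulr_ge0// subr_ge0.
  have h1 : (1 - u) * u <= 1 / 4 by have := sqr_ge0 (u - 1 / 2); clear; lra.
  have : ((1 - u) * u) ^+ 2 <= (1 / 4) ^+ 2 by rewrite lerXn2r ?nnegrE.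
  by clear; lra.
rewrite -D1; apply/andP; split.
  rewrite -D0; apply: (@is_derive_le R D D') => // t /andP[t0 t1]; first exact: dD.
  have /andP[q _] := p0 t (introT andP (conj t0 t1)).
  by rewrite /D' mulr_ge0// f40// lerDl.
rewrite -subr_ge0.
have -> : 0 = (f3 (x + 0) - f3 x) / 384 - D 0 by rewrite D0 addr0; ring.
apply: (@is_derive_le R (fun t => (f3 (x + t) - f3 x) / 384 - D t) (fun t => f4 (x + t) / 384 - D' t)).
- exact: ler01.
- move=> t /andP[t0 _]; have xt : 0 < x + t by rewrite ltr_wpDr.
  have hf3 := dshift _ _ _ _ (df3 _ xt); have hD := dD _ t0.
  by der; rewrite /GRing.scale /=; field.
- move=> t t01; have /andP[t0 t1] := t01; rewrite subr_ge0 /D'.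
have /andP[_ h] := p0 t t01; have := ler_wpM2r (f40 (x + t) _) h; rewrite lerDl => /(_ t0).
by clear; lra.
Qed.

(** A family stable under differentiation and, for exponents at least $2$, under integration, so
    that derivatives are pairs of coefficients. The pairs $(1,0)$ and $(0,1)$ give $\ln x/x^k$ and
    $1/x^k$. *)
Definition lnpow c k x : R := (c.1 * ln x + c.2) * x^-1 ^+ k.

Definition lnpow_deriv k c : R * R := (- (k%:R * c.1), c.1 - k%:R * c.2).

Definition lnpow_prim k c : R * R := (- (c.1 / k%:R), - (c.1 / k%:R + c.2) / k%:R).

Lemma is_derive_lnpow c k x : 0 < x ->
  is_derive x (1 : R) (lnpow c k) (lnpow (lnpow_deriv k c) k.+1 x).
Proof.
move=> x0; have xn : x != 0 by rewrite gt_eqF.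
rewrite /lnpow /lnpow_deriv /=; case: k => [|k].
  by der=> //; rewrite /GRing.scale /=; field.
by der=> //; rewrite /GRing.scale /= !exprS -natr1; field.
Qed.

Lemma lnpow_primK k c : (0 < k)%N -> lnpow_deriv k (lnpow_prim k c) = c.
Proof.
move=> k0; have k1 : (k%:R : R) != 0 by rewrite pnatr_eq0 -lt0n.
by rewrite /lnpow_deriv /lnpow_prim /=; case: c => a b /=; congr pair; field.
Qed.

End EulerMaclaurin.

(** * Euler-Maclaurin summation of $\ln n/n^k$ and $1/n^k$ *)

Section LnpowSeries.
Variable R : realType.
Implicit Types (x y t : R) (c : R * R) (k s n N : nat).
Local Notation lnpow := (@lnpow R).
Local Notation lnpow_deriv := (@lnpow_deriv R).
Local Notation lnpow_prim := (@lnpow_prim R).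

Definition lnpow_sum c k N : R := \sum_(1 <= i < N.+1) lnpow c k i%:R.

Lemma lnpow_sumS c k N : lnpow_sum c k N.+1 = lnpow_sum c k N + lnpow c k N.+1%:R.
Proof. by rewrite /lnpow_sum big_nat_recr. Qed.

(* The Euler-Maclaurin corrector of [lnpow_sum c k.+1], up to the third derivative. *)
Definition lnpow_em c k x : R :=
  lnpow (lnpow_prim k c) k x + lnpow c k.+1 x / 2 + lnpow (lnpow_deriv k.+1 c) k.+2 x / 12.

Definition lnpow_deriv3 c k : R * R := lnpow_deriv k.+3 (lnpow_deriv k.+2 (lnpow_deriv k.+1 c)).

(** The one-step estimates telescope. The two sign conditions make the fourth derivative nonnegative
    on $[n,\infty)$, since its numerator is affine and nondecreasing in $\ln x$. *)
Lemma lnpow_sum_em c k n N : (0 < k)%N -> (0 < n)%N -> (n <= N)%N ->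
  let c4 := lnpow_deriv k.+4 (lnpow_deriv3 c k) in
  0 <= c4.1 -> 0 <= c4.1 * ln n%:R + c4.2 ->
  0 <= lnpow_em c k N%:R - lnpow_em c k n%:R - (lnpow_sum c k.+1 N - lnpow_sum c k.+1 n)
    <= (lnpow (lnpow_deriv3 c k) k.+4 N%:R - lnpow (lnpow_deriv3 c k) k.+4 n%:R) / 384.
Proof.
move=> k0 n0 nN c4 c40 c4n; elim: N nN => [|N IH] nN.
  by move: nN n0; rewrite leqn0 => /eqP ->.
have [nN'|Nn] := leqP n N; last first.
  have -> : n = N.+1 by apply/eqP; rewrite eqn_leq nN Nn.
  by rewrite !subrr mul0r lexx.
have N0 : 0 < (N%:R : R) by rewrite ltr0n (leq_trans n0).
have dl c' k' y : 0 < y -> is_derive y (1 : R) (lnpow c' k') (lnpow (lnpow_deriv k' c') k'.+1 y).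
  exact: is_derive_lnpow.
have d0 y : 0 < y -> is_derive y (1 : R) (lnpow (lnpow_prim k c) k) (lnpow c k.+1 y).
  by move=> y0; have := dl (lnpow_prim k c) k y y0; rewrite lnpow_primK.
have f40 y : N%:R <= y -> 0 <= lnpow c4 k.+4.+1 y.
  move=> Ny; have y0 : 0 < y by apply: lt_le_trans Ny.
  rewrite /lnpow mulr_ge0 ?exprn_ge0 ?invr_ge0 ?(ltW y0)//; apply: (le_trans c4n).
  rewrite lerD2r ler_wpM2l// ler_ln ?posrE ?ltr0n//; apply: le_trans Ny; by rewrite ler_nat.
have := @euler_maclaurin_step R _ _ _ _ _ _ N%:R N0 d0 (dl c k.+1) (dl _ k.+2) (dl _ k.+3) (dl _ k.+4) f40.
have := IH nN'; rewrite lnpow_sumS /lnpow_em natr1 -/(lnpow_deriv3 c k).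
by move=> /andP[a1 a2] /andP[b1 b2]; apply/andP; split; move: a1 a2 b1 b2; clear; lra.
Qed.

Lemma ln_le_sqrt x : 0 < x -> ln x <= 2 * Num.sqrt x.
Proof.
move=> x0; have s0 : 0 < Num.sqrt x by rewrite sqrtr_gt0.
have -> : ln x = 2 * ln (Num.sqrt x).
  by rewrite -{1}(sqr_sqrtr (ltW x0)) lnXn// mulr_natl.
rewrite ler_pM2l//; apply: ltW; exact: ln_sublinear.
Qed.

Lemma lnpow_cvg0 c k : (fun n => lnpow c k.+1 n%:R) @ \oo --> (0 : R).
Proof.
apply/cvgrPdist_le => e e0.
pose C := 2 * `|c.1| + `|c.2|; have C0 : 0 <= C by rewrite addr_ge0 ?mulr_ge0.
near=> n; rewrite sub0r normrN.
have n1 : 1 <= (n%:R : R) by near: n; exact: nbhs_infty_ger.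
have n0 : 0 < (n%:R : R) by apply: lt_le_trans n1.
have nC : (C / e) ^+ 2 <= n%:R by near: n; exact: nbhs_infty_ger.
set r := Num.sqrt (n%:R : R).
have r0 : 0 < r by rewrite sqrtr_gt0.
have r2 : r ^+ 2 = n%:R by rewrite sqr_sqrtr// ltW.
have r1 : 1 <= r by rewrite -sqrtr1 ler_sqrt.
have Cr : C <= e * r.
  rewrite mulrC -ler_pdivrMr//.
  by rewrite -(@ler_pXn2r _ 2)// ?nnegrE ?divr_ge0 ?(ltW e0) ?(ltW r0)// r2.
have num : `|c.1 * ln n%:R + c.2| <= C * r.
  apply: (le_trans (ler_normD _ _)); rewrite mulrDl normrM.
  have l0 : 0 <= ln (n%:R : R) by exact: ln_ge0.
  have l1 := ln_le_sqrt _ n0; rewrite -/r in l1.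
  apply: lerD; last by rewrite ler_peMr.
  by rewrite (ger0_norm l0) mulrAC mulrC; have := ler_wpM2r (normr_ge0 c.1) l1; rewrite mulrAC.
rewrite /lnpow normrM normrX normfV (ger0_norm (ltW n0)).
have pk : (n%:R : R)^-1 ^+ k.+1 <= n%:R^-1.
  by rewrite exprS ler_piMr ?invr_ge0 ?(ltW n0)// exprn_ile1 ?invr_ge0 ?(ltW n0)// invf_le1.
apply: (@le_trans _ _ (C * r * n%:R^-1)).
  by apply: ler_pM => //; rewrite exprn_ge0// invr_ge0 ltW.
rewrite ler_pdivrMr// -r2 expr2 mulrA; exact: ler_wpM2r (ltW r0) _ _ Cr.
Unshelve. all: by end_near. Qed.

Lemma lnpow_em_cvg0 c k : (0 < k)%N -> (fun n => lnpow_em c k n%:R) @ \oo --> (0 : R).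
Proof.
case: k => // k _; rewrite /lnpow_em.
rewrite [X in _ --> X](_ : 0 = 0 + 0 / 2 + 0 / 12 :> R); last by rewrite !mul0r !addr0.
apply: cvgD; first apply: cvgD; first exact: lnpow_cvg0.
  by apply: cvgMl; exact: lnpow_cvg0.
by apply: cvgMl; exact: lnpow_cvg0.
Qed.

Lemma lnpow_ge0 c k n : 0 <= c.1 -> 0 <= c.2 -> 0 <= lnpow c k n%:R.
Proof.
move=> a0 b0; rewrite /lnpow mulr_ge0 ?exprn_ge0 ?invr_ge0// addr_ge0// mulr_ge0//.
by case: n => [|n]; [rewrite ln0|rewrite ln_ge0// ler1n].
Qed.

(** Letting $N$ grow in [lnpow_sum_em], all terms at $N$ other than the sum vanish, which bounds the
    increasing partial sums and leaves an enclosure by data at $n$ alone. *)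
Lemma lnpow_series c k n : (0 < k)%N -> (0 < n)%N -> 0 <= c.1 -> 0 <= c.2 ->
  let c4 := lnpow_deriv k.+4 (lnpow_deriv3 c k) in
  0 <= c4.1 -> 0 <= c4.1 * ln n%:R + c4.2 ->
  exists l, [/\ lnpow_sum c k.+1 @ \oo --> l, (forall N, lnpow_sum c k.+1 N <= l),
    l <= lnpow_sum c k.+1 n - lnpow_em c k n%:R &
    lnpow_sum c k.+1 n - lnpow_em c k n%:R + lnpow (lnpow_deriv3 c k) k.+4 n%:R / 384 <= l].
Proof.
move=> k0 n0 a0 b0 c4 h1 h2; pose S := lnpow_sum c k.+1.
have em N : (n <= N)%N -> _ := fun nN => lnpow_sum_em c k n N k0 n0 nN h1 h2.
have ec := lnpow_em_cvg0 c k k0; have fc := lnpow_cvg0 (lnpow_deriv3 c k) k.+3.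
have nd : nondecreasing_seq S.
  by apply/nondecreasing_seqP => N; rewrite /S lnpow_sumS lerDl lnpow_ge0.
pose U N : R := S n - lnpow_em c k n%:R + lnpow_em c k N%:R.
have Uc : U @ \oo --> S n - lnpow_em c k n%:R.
  by rewrite -[X in _ --> X]addr0; apply: cvgD => //; exact: cvg_cst.
have SU N : (n <= N)%N -> S N <= U N.
  by move=> /em /andP[q _]; move: q; rewrite -/S /U; clear; lra.
have Sc : cvgn S.
  apply: nondecreasing_is_cvgn => //.
  have [M [_ HM]] : bounded_fun U by apply: cvg_seq_bounded; apply/cvg_ex; eexists; exact: Uc.
  exists (`|M| + 1) => _ [N _ <-].
  apply: (le_trans (nd _ _ (leq_maxr n N))); apply: (le_trans (SU _ (leq_maxl n N))).
  apply: (le_trans (ler_norm _)); apply: HM => //.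
  by apply: (le_lt_trans (ler_norm M)); rewrite ltrDl.
exists (limn S); split.
- exact: Sc.
- by move=> N; exact: nondecreasing_cvgn_le.
- rewrite -(cvg_lim _ Uc)//; apply: ler_lim => //; first by apply/cvg_ex; eexists; exact: Uc.
  by near=> N; apply: SU; near: N; exact: nbhs_infty_ge.
pose V N : R := S n - lnpow_em c k n%:R + lnpow (lnpow_deriv3 c k) k.+4 n%:R / 384
  + (lnpow_em c k N%:R - lnpow (lnpow_deriv3 c k) k.+4 N%:R / 384).
have Vc : V @ \oo --> S n - lnpow_em c k n%:R + lnpow (lnpow_deriv3 c k) k.+4 n%:R / 384.
  rewrite -[X in _ --> X]addr0; apply: cvgD; first exact: cvg_cst.
  rewrite [X in _ --> X](_ : 0 = 0 - 0 / 384); last by rewrite mul0r subr0.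
  by apply: cvgB => //; apply: cvgMl.
rewrite -(cvg_lim _ Vc)//; apply: ler_lim => //; first by apply/cvg_ex; eexists; exact: Vc.
near=> N; have nN : (n <= N)%N by near: N; exact: nbhs_infty_ge.
by have /andP[_ q] := em N nN; move: q; rewrite -/S /V; clear; lra.
Unshelve. all: by end_near. Qed.

End LnpowSeries.

(** * Sums over primes and the von Mangoldt convolution *)

Section PrimeSums.
Variable R : realType.
Implicit Types (s n d j k p N : nat).
Local Notation lnpow := (@lnpow R).
Local Notation lnpow_sum := (@lnpow_sum R).

(** The identity $\ln n = \sum_{d\mid n}\Lambda(d)$ for the von Mangoldt function, with summation
    ranges independent of $n$ so that the sums can be interchanged. *)
Lemma ln_factorization n N : (0 < n)%N -> (n <= N)%N ->
  ln (n%:R : R) = \sum_(1 <= p < N.+1 | prime p) ln (p%:R : R) * \sum_(1 <= k < N.+1) (p ^ k %| n)%:R.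
Proof.
move=> n0 nN.
have e : n = (\prod_(1 <= p < N.+1 | prime p) p ^ logn p n)%N.
  rewrite -[LHS](partnT n0) (widen_partn _ nN) big_ltn// [logn 0 n]lognE mul1n.
  rewrite [RHS]big_mkcond; apply: eq_bigr => p _; case: ifP => // np.
  by rewrite lognE np.
rewrite {1}e.
have : (0 < \prod_(1 <= p < N.+1 | prime p) p ^ logn p n)%N /\
  ln ((\prod_(1 <= p < N.+1 | prime p) p ^ logn p n)%:R : R) =
  \sum_(1 <= p < N.+1 | prime p) ln (p%:R : R) * (logn p n)%:R.
  apply: (big_rec2 (fun (a : nat) (x : R) => (0 < a)%N /\ ln (a%:R : R) = x)); first by rewrite ln1.
  move=> p x a pp [a0 <-]; have p0 := prime_gt0 pp.
  rewrite muln_gt0 expn_gt0 p0 a0; split=> //.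
  by rewrite natrM lnM ?posrE ?ltr0n ?expn_gt0 ?p0// natrX lnXn ?ltr0n// mulr_natr.
move=> [_ ->]; apply: eq_bigr => p pp; congr (_ * _).
have lN : (logn p n < N.+1)%N by rewrite ltnS (leq_trans (ltnW (ltn_logl _ n0))).
rewrite (eq_bigr (fun k => (k <= logn p n)%:R)); last by move=> k _; rewrite pfactor_dvdn.
rewrite (big_cat_nat _ (n := (logn p n).+1))//=.
rewrite [X in _ = _ + X]big_nat_cond [X in _ = _ + X]big1; last first.
  by move=> k /andP[/andP[h _] _]; rewrite leqNgt h.
rewrite addr0 big_nat_cond (eq_bigr (fun=> 1)); last first.
  by move=> k /andP[/andP[_ h] _]; rewrite -ltnS h.
by rewrite -big_nat_cond sumr_const_nat subn1.
Qed.

Lemma sum_ln_exchange (f : nat -> R) N :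
  \sum_(1 <= n < N.+1) ln n%:R * f n =
  \sum_(1 <= p < N.+1 | prime p) ln p%:R * \sum_(1 <= k < N.+1) \sum_(1 <= n < N.+1 | (p ^ k %| n)%N) f n.
Proof.
rewrite big_nat_cond (eq_bigr (fun n => \sum_(1 <= p < N.+1 | prime p)
    ln (p%:R : R) * \sum_(1 <= k < N.+1) (p ^ k %| n)%:R * f n)); last first.
  move=> n /andP[/andP[n0 nN] _]; rewrite (ln_factorization n N)// mulr_suml.
  by apply: eq_bigr => p _; rewrite -mulrA mulr_suml.
rewrite -big_nat_cond exchange_big; apply: eq_bigr => p _.
rewrite -mulr_sumr exchange_big; congr (_ * _); apply: eq_bigr => k _.
rewrite [RHS]big_mkcond; apply: eq_bigr => n _.
by case: (_ %| _)%N; rewrite ?mul1r ?mul0r.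
Qed.

Lemma sum_multiples (f : nat -> R) d N : (0 < d)%N ->
  \sum_(1 <= n < N.+1 | (d %| n)%N) f n = \sum_(1 <= j < (N %/ d).+1) f (d * j)%N.
Proof.
move=> d0; elim: N => [|N IH]; first by rewrite div0n !big_geq.
rewrite big_mkcond big_nat_recr//= -big_mkcond IH divnS//.
case: ifP => [dN|_]; last by rewrite addr0 add0n.
rewrite add1n [RHS]big_nat_recr//=; congr (_ + f _).
by have := divnK dN; rewrite divnS// dN add1n mulnC => ->.
Qed.

Definition zeta_sum s N : R := lnpow_sum (0, 1) s N.
Definition lnzeta_sum s N : R := lnpow_sum (1, 0) s N.
(** The share of all powers of $p$ in $-\zeta'/\zeta(s)$: the geometric series $\sum_{k\ge1}\ln
    p\;p^{-ks}$. *)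
Definition mangoldt_term s p : R := if prime p then ln p%:R / (p%:R ^+ s - 1) else 0.

Lemma zeta_sumE s N : zeta_sum s N = \sum_(1 <= n < N.+1) (n%:R : R)^-1 ^+ s.
Proof. by apply: eq_bigr => n _; rewrite /lnpow mul0r add0r mul1r. Qed.

Lemma zeta_sum_ge0 s N : 0 <= zeta_sum s N.
Proof. by rewrite zeta_sumE; apply: sumr_ge0 => n _; rewrite exprn_ge0 ?invr_ge0. Qed.

Lemma zeta_sum_le s N M : (N <= M)%N -> zeta_sum s N <= zeta_sum s M.
Proof.
move=> NM; rewrite !zeta_sumE [leRHS](big_cat_nat _ (n := N.+1))//= lerDl.
by apply: sumr_ge0 => n _; rewrite exprn_ge0 ?invr_ge0.
Qed.

Lemma mangoldt_term_ge0 s p : 0 <= mangoldt_term s p.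
Proof.
rewrite /mangoldt_term; case: ifP => // pp; have p1 : 1 <= (p%:R : R) by rewrite ler1n prime_gt0.
by rewrite divr_ge0 ?ln_ge0// subr_ge0 exprn_ege1.
Qed.

Lemma series_mangoldtE s N : series (mangoldt_term s) N.+1 =
  \sum_(1 <= p < N.+1 | prime p) ln (p%:R : R) / (p%:R ^+ s - 1).
Proof. by rewrite seriesEnat/= big_ltn// {1}/mangoldt_term /= add0r [RHS]big_mkcond. Qed.

Lemma lnzeta_sumE s N : lnzeta_sum s N =
  \sum_(1 <= p < N.+1 | prime p) ln (p%:R : R) *
    \sum_(1 <= k < N.+1) (p%:R^-1 ^+ s) ^+ k * zeta_sum s (N %/ p ^ k).
Proof.
have -> : lnzeta_sum s N = \sum_(1 <= n < N.+1) ln n%:R * (n%:R : R)^-1 ^+ s.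
  by apply: eq_bigr => n _; rewrite /lnpow mul1r addr0.
rewrite sum_ln_exchange; apply: eq_bigr => p pp; congr (_ * _).
apply: eq_bigr => k _; rewrite sum_multiples ?expn_gt0 ?prime_gt0// zeta_sumE mulr_sumr.
apply: eq_bigr => j _; rewrite natrM invfM exprMn natrX -exprVn -!exprM.
by rewrite [(k * s)%N]mulnC.
Qed.

Lemma prime_power_inv s p : (0 < s)%N -> prime p -> 0 < (p%:R : R)^-1 ^+ s <= 1 / 2.
Proof.
move=> s0 pp; have p0 : 0 < (p%:R : R) by rewrite ltr0n prime_gt0.
have p2 : 2 <= (p%:R : R) by rewrite (ler_nat _ 2) prime_gt1.
have i2 : (p%:R : R)^-1 <= 1 / 2 by rewrite div1r lef_pV2 ?posrE.
rewrite exprn_gt0 ?invr_gt0//=; case: s s0 => // s _.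
rewrite exprS; apply: le_trans i2; rewrite ler_piMr ?invr_ge0 ?(ltW p0)//.
by rewrite exprn_ile1 ?invr_ge0 ?(ltW p0)// invf_le1// (le_trans _ p2)// ler1n.
Qed.

Lemma geometric_sum (q : R) K : 0 < q <= 1 / 2 ->
  \sum_(1 <= k < K.+1) q ^+ k = (1 - q ^+ K) / (q^-1 - 1).
Proof.
move=> /andP[q0 q2]; have q1 : 1 - q != 0 by rewrite gt_eqF//; move: q2; clear; lra.
have -> : q^-1 - 1 = (1 - q) / q by field; rewrite gt_eqF.
elim: K => [|K IH]; first by rewrite big_geq// expr0 subrr mul0r.
by rewrite big_nat_recr//= IH exprS; field; rewrite q1 gt_eqF.
Qed.

Lemma lnzeta_sum_le s N : (0 < s)%N ->
  lnzeta_sum s N <= zeta_sum s N * series (mangoldt_term s) N.+1.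
Proof.
move=> s0; rewrite lnzeta_sumE series_mangoldtE mulr_sumr; apply: ler_sum => p pp.
rewrite mulrCA ler_wpM2l ?ln_ge0 ?ler1n ?prime_gt0//.
have qb := prime_power_inv s p s0 pp; have /andP[q0 q2] := qb.
apply: (@le_trans _ _ (\sum_(1 <= k < N.+1) (p%:R^-1 ^+ s) ^+ k * zeta_sum s N)).
  by apply: ler_sum => k _; rewrite ler_wpM2l ?exprn_ge0 ?(ltW q0)// zeta_sum_le// leq_div.
rewrite -mulr_suml geometric_sum// mulrC ler_wpM2l ?zeta_sum_ge0//.
have -> : (p%:R^-1 ^+ s)^-1 = p%:R ^+ s :> R by rewrite exprVn invrK.
by rewrite ler_piMl ?invr_ge0 ?subr_ge0 ?exprn_ege1 ?ler1n ?prime_gt0// lerBlDr lerDl exprn_ge0 ?(ltW q0).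
Qed.

(** With the cutoff $N = JP^K$ one has $N/p^k\ge J$ for all $p\le P$ and $k\le K$. The other terms
    are dropped, and truncating the geometric series at $K$ costs at most the factor $1-2^{-K}$. *)
Lemma lnzeta_sum_ge s J P K : (0 < s)%N -> (0 < J)%N -> (0 < P)%N -> (0 < K)%N ->
  zeta_sum s J * (series (mangoldt_term s) P.+1 * (1 - (1 / 2) ^+ K)) <= lnzeta_sum s (J * P ^ K).
Proof.
move=> s0 J0 P0 K0; set N := (J * P ^ K)%N.
rewrite lnzeta_sumE series_mangoldtE mulr_suml mulr_sumr.
have PN : (P <= N)%N.
  by rewrite /N -(prednK K0) expnS mulnCA leq_pmulr// muln_gt0 J0 expn_gt0 P0.
rewrite [leRHS](big_cat_nat _ (n := P.+1))//=.
have F0 p : prime p -> 0 <= ln (p%:R : R) *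
    \sum_(1 <= k < N.+1) (p%:R^-1 ^+ s) ^+ k * zeta_sum s (N %/ p ^ k).
  move=> pp; rewrite mulr_ge0 ?ln_ge0 ?ler1n ?prime_gt0//; apply: sumr_ge0 => k _.
  by rewrite mulr_ge0 ?zeta_sum_ge0 ?exprn_ge0 ?invr_ge0.
apply: (@le_trans _ _ (\sum_(1 <= p < P.+1 | prime p) ln (p%:R : R) *
    \sum_(1 <= k < N.+1) (p%:R^-1 ^+ s) ^+ k * zeta_sum s (N %/ p ^ k))); last first.
  by rewrite lerDl; apply: sumr_ge0 => p /F0.
rewrite big_nat_cond [leRHS]big_nat_cond; apply: ler_sum => p /andP[/andP[_ pP] pp].
have p0 := prime_gt0 pp.
have -> (u v w x : R) : u * (v / w * x) = v * (u * (x / w)) by ring.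
rewrite ler_wpM2l ?ln_ge0 ?ler1n//.
have qb := prime_power_inv s p s0 pp; have /andP[q0 q2] := qb.
have KN : (K <= N)%N.
  have p1 := prime_gt1 pp; apply: (leq_trans (ltnW (ltn_expl K p1))).
  by rewrite /N (leq_trans (leq_pmull _ J0))// leq_mul// leq_exp2r.
rewrite [leRHS](big_cat_nat _ (n := K.+1))//=.
apply: (@le_trans _ _ (\sum_(1 <= k < K.+1) (p%:R^-1 ^+ s) ^+ k * zeta_sum s (N %/ p ^ k))); last first.
  rewrite lerDl; apply: sumr_ge0 => k _.
  by rewrite mulr_ge0 ?zeta_sum_ge0 ?exprn_ge0 ?invr_ge0.
apply: (@le_trans _ _ (\sum_(1 <= k < K.+1) (p%:R^-1 ^+ s) ^+ k * zeta_sum s J)); last first.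
  rewrite big_nat_cond [leRHS]big_nat_cond; apply: ler_sum => k /andP[/andP[k0 kK] _].
  rewrite ler_wpM2l ?exprn_ge0 ?(ltW q0)// zeta_sum_le// leq_divRL ?expn_gt0 ?p0//.
  rewrite /N leq_mul// (@leq_trans (P ^ k)%N) ?leq_exp2r//.
  by rewrite leq_pexp2l.
rewrite -mulr_suml mulrC ler_wpM2r ?zeta_sum_ge0// geometric_sum//.
have -> : (p%:R^-1 ^+ s)^-1 = p%:R ^+ s :> R by rewrite exprVn invrK.
rewrite ler_wpM2r ?invr_ge0 ?subr_ge0 ?exprn_ege1 ?ler1n//.
by rewrite lerD2l lerN2 lerXn2r ?nnegrE ?(ltW q0).
Qed.

End PrimeSums.

(** * Enclosure of the prime series for kappa *)

Section KappaBounds.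
Variable R : realType.
Implicit Types (s n k p N : nat).
Local Notation lnpow := (@lnpow R).
Local Notation lnpow_sum := (@lnpow_sum R).
Local Notation lnpow_em := (@lnpow_em R).
Local Notation lnpow_deriv := (@lnpow_deriv R).
Local Notation lnpow_deriv3 := (@lnpow_deriv3 R).
Local Notation zeta_sum := (@zeta_sum R).
Local Notation lnzeta_sum := (@lnzeta_sum R).
Local Notation mangoldt_term := (@mangoldt_term R).

Lemma nneg_series_nondecreasing (u : R^nat) : (forall n, 0 <= u n) -> nondecreasing_seq (series u).
Proof. by move=> u0; apply/nondecreasing_seqP => n; rewrite seriesSr lerDl. Qed.

Lemma nneg_series_cvg (u : R^nat) (B : R) : (forall n, 0 <= u n) -> (forall n, series u n <= B) ->
  exists l, [/\ series u @ \oo --> l, (forall n, series u n <= l) & l <= B].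
Proof.
move=> u0 uB; have nd := nneg_series_nondecreasing u u0.
have c : cvgn (series u) by apply: nondecreasing_is_cvgn => //; exists B => _ [n _ <-].
exists (limn (series u)); split=> //; first by move=> n; exact: nondecreasing_cvgn_le.
by apply: limr_le => //; exact: nearW.
Qed.

(* The Dirichlet series of [- zeta' = zeta * (- zeta' / zeta)]. *)
Lemma mangoldt_series s (lL lZ : R) : (0 < s)%N ->
  lnzeta_sum s @ \oo --> lL -> (forall N, lnzeta_sum s N <= lL) ->
  zeta_sum s @ \oo --> lZ -> (forall N, zeta_sum s N <= lZ) ->
  [/\ 1 <= lZ, series (mangoldt_term s) @ \oo --> lL / lZ &
    forall N, series (mangoldt_term s) N <= lL / lZ].
Proof.
move=> s0 cL hL cZ hZ.
have Z1 : 1 <= lZ.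
  apply: le_trans (hZ 1%N); rewrite zeta_sumE big_nat1 invr1 expr1n//.
have Z0 : 0 < lZ by apply: lt_le_trans Z1.
have u0 := mangoldt_term_ge0 R s.
(* [h1] lets $K$ grow and [h2] lets $J$ grow, with the cutoff $P$ on the primes fixed; the reverse
   inequality [LA] needs only one limit. *)
have h1 J P : (0 < J)%N -> (0 < P)%N -> zeta_sum s J * series (mangoldt_term s) P.+1 <= lL.
  move=> J0 P0; set x := series _ _; set z := zeta_sum s J.
  have cK : (fun K => z * (x * (1 - (1 / 2) ^+ K))) @ \oo --> z * x.
    rewrite -[X in _ --> z * X]mulr1; apply: cvgMr; apply: cvgMr.
    rewrite -[X in _ --> X]subr0; apply: cvgB; first exact: cvg_cst.
    by apply: cvg_expr; rewrite ger0_norm; clear; lra.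
  rewrite -(cvg_lim _ cK)//; apply: limr_le; first by apply/cvg_ex; eexists; exact: cK.
  near=> K; apply: le_trans (hL (J * P ^ K)%N); apply: lnzeta_sum_ge => //.
  by near: K; exact: nbhs_infty_ge.
have h2 P : (0 < P)%N -> lZ * series (mangoldt_term s) P.+1 <= lL.
  move=> P0; set x := series _ _.
  have cJ : (fun J => zeta_sum s J * x) @ \oo --> lZ * x by apply: cvgMl.
  rewrite -(cvg_lim _ cJ)//; apply: limr_le; first by apply/cvg_ex; eexists; exact: cJ.
  by near=> J; apply: h1 => //; near: J; exact: nbhs_infty_ge.
have h3 P : series (mangoldt_term s) P <= lL / lZ.
  rewrite ler_pdivlMr// mulrC; apply: le_trans (h2 P.+1 isT).
  rewrite ler_pM2l//; apply: nneg_series_nondecreasing => //.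
  by rewrite -addn2 leq_addr.
have [A [cA hA AB]] := nneg_series_cvg _ _ u0 h3.
have LA : lL <= lZ * A.
  rewrite -(cvg_lim _ cL)//; apply: limr_le; first by apply/cvg_ex; eexists; exact: cL.
  near=> N; apply: (le_trans (lnzeta_sum_le R s N s0)).
  apply: ler_pM => //; first exact: zeta_sum_ge0.
  by rewrite seriesEnat; apply: sumr_ge0.
have AE : A = lL / lZ by apply/eqP; rewrite eq_le AB /= ler_pdivrMr// mulrC.
by split=> //; rewrite -AE.
Unshelve. all: by end_near. Qed.

Definition rest_term p : R :=
  if prime p then ln p%:R / (p%:R * (p%:R + 1) * (p%:R ^+ 3 - 1)) else 0.

Lemma kappa_termE p : kappa_term R p = mangoldt_term 2 p + mangoldt_term 3 p + rest_term p.
Proof.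
rewrite /kappa_term /mangoldt_term /rest_term; case: ifP => pp; last by rewrite !addr0.
have p1 : 1 < (p%:R : R) by rewrite ltr1n prime_gt1.
move: (p%:R : R) p1 => x x1; have x0 : 0 < x by apply: lt_trans x1.
have d1 : x - 1 != 0 by rewrite subr_eq0 gt_eqF.
have d2 : x + 1 != 0 by rewrite gt_eqF// addr_gt0.
have d3 : x ^+ 2 + x + 1 != 0 by rewrite gt_eqF// !addr_gt0 ?exprn_gt0.
have -> : x ^+ 2 - 1 = (x - 1) * (x + 1) by ring.
have -> : x ^+ 3 - 1 = (x - 1) * (x ^+ 2 + x + 1) by ring.
by field; rewrite d1 d2 d3 gt_eqF.
Qed.

Lemma series_kappaE N : series (kappa_term R) N =
  series (mangoldt_term 2) N + series (mangoldt_term 3) N + series rest_term N.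
Proof. by rewrite /series/= -!big_split; apply: eq_bigr => p _; exact: kappa_termE. Qed.

Lemma rest_term_bounds p : 0 <= rest_term p <= lnpow (1, 0) 5 p%:R.
Proof.
rewrite /rest_term; case: ifP => pp; last by rewrite lexx lnpow_ge0.
have p2 : 2 <= (p%:R : R) by rewrite (ler_nat _ 2) prime_gt1.
rewrite /lnpow mul1r addr0; move: (p%:R : R) p2 => x x2; have x0 : 0 < x by apply: lt_le_trans x2.
have l0 : 0 <= ln x by rewrite ln_ge0//; move: x2; clear; lra.
have x5 : 0 < x ^+ 5 by rewrite exprn_gt0.
have d : x ^+ 5 <= x * (x + 1) * (x ^+ 3 - 1).
  have q2 : 4 <= x ^+ 2 by move: x2; clear; nra.
  have q3 : x * 0 <= x * (x * (x ^+ 2 - 4) + (3 * x - 1)).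
    rewrite ler_pM2l// addr_ge0 ?mulr_ge0 ?(ltW x0)// ?subr_ge0//; move: x2; clear; lra.
  by move: q3; clear; lra.
have d0 : 0 < x * (x + 1) * (x ^+ 3 - 1) by apply: lt_le_trans d.
by rewrite divr_ge0 ?(ltW d0)//= exprVn ler_wpM2l// lef_pV2 ?posrE.
Qed.

(** The tail over primes beyond $M$ is at most the tail of $\sum\ln n/n^5$ over all integers, which
    Euler-Maclaurin evaluates. *)
Lemma rest_series N M : (0 < M)%N -> 2 <= ln (M%:R : R) ->
  series rest_term N <= series rest_term M.+1 - lnpow_em (1, 0) 4 M%:R.
Proof.
move=> M0 lM; have h (c := (1, 0) : R * R) : exists l, [/\ lnpow_sum c 5 @ \oo --> l,
   (forall N, lnpow_sum c 5 N <= l), l <= lnpow_sum c 5 M - lnpow_em c 4 M%:R &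
   lnpow_sum c 5 M - lnpow_em c 4 M%:R + lnpow (lnpow_deriv3 c 4) 8 M%:R / 384 <= l].
  apply: lnpow_series => //=; rewrite /lnpow_deriv3 /lnpow_deriv /=.
  by move: lM; clear; lra.
have [l [_ Sl lM' _]] := h.
have g n : (M <= n)%N -> series rest_term n.+1 - series rest_term M.+1 <= lnpow_sum (1, 0) 5 n - lnpow_sum (1, 0) 5 M.
  elim: n => [|n IH] Mn; first by move: Mn M0; rewrite leqn0 => /eqP ->.
  have [Mn'|nM] := leqP M n; last first.
    have -> : n.+1 = M by apply/eqP; rewrite eqn_leq nM Mn.
    by rewrite !subrr.
  have /andP[_ r1] := rest_term_bounds n.+1.
  rewrite seriesSr lnpow_sumS; have := IH Mn'; move: r1; clear; lra.
have nd : nondecreasing_seq (series rest_term).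
  by apply: nneg_series_nondecreasing => n; have /andP[] := rest_term_bounds n.
have := nd N (maxn M N).+1 (leqW (leq_maxr _ _)).
by have := g _ (leq_maxl M N); have := Sl (maxn M N); move: lM'; clear; lra.
Qed.

Definition lnpow_upper (c : R * R) k n : R := lnpow_sum c k.+1 n - lnpow_em c k n%:R.
Definition lnpow_lower (c : R * R) k n : R := lnpow_upper c k n + lnpow (lnpow_deriv3 c k) k.+4 n%:R / 384.

(** The condition $\ln n\ge2$ ensures that the fourth derivative of $\ln x/x^{k+1}$ is nonnegative
    from $n$ on. *)
Lemma mangoldt_bounds k n : (k == 1%N) || (k == 2) -> (0 < n)%N -> 2 <= ln (n%:R : R) ->
  0 < lnpow_lower (0, 1) k n -> 0 <= lnpow_lower (1, 0) k n ->
  exists A, [/\ series (mangoldt_term k.+1) @ \oo --> A, (forall N, series (mangoldt_term k.+1) N <= A),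
    A <= lnpow_upper (1, 0) k n / lnpow_lower (0, 1) k n &
    lnpow_lower (1, 0) k n / lnpow_upper (0, 1) k n <= A].
Proof.
move=> k12 n0 ln2 z0 l0.
have k0 : (0 < k)%N by case/orP: k12 => /eqP ->.
have [lL [cL hL L2 L1]] : exists l, [/\ lnzeta_sum k.+1 @ \oo --> l, (forall N, lnzeta_sum k.+1 N <= l),
    l <= lnpow_upper (1, 0) k n & lnpow_lower (1, 0) k n <= l].
  apply: lnpow_series => //=; rewrite /lnpow_deriv3 /lnpow_deriv /=;
    case/orP: k12 => /eqP ->; move: ln2; clear; lra.
have [lZ [cZ hZ Z2 Z1]] : exists l, [/\ zeta_sum k.+1 @ \oo --> l, (forall N, zeta_sum k.+1 N <= l),
    l <= lnpow_upper (0, 1) k n & lnpow_lower (0, 1) k n <= l].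
  apply: lnpow_series => //=; rewrite /lnpow_deriv3 /lnpow_deriv /=;
    case/orP: k12 => /eqP ->; clear; lra.
have [lZ1 cA hA] := mangoldt_series k.+1 lL lZ isT cL hL cZ hZ.
have lZ0 : 0 < lZ by apply: lt_le_trans lZ1.
have lL0 : 0 <= lL by apply: le_trans L1.
exists (lL / lZ); split=> //.
  by apply: ler_pM => //; rewrite ?invr_ge0 ?(ltW lZ0)// lef_pV2 ?posrE.
have u0 : 0 < lnpow_upper (0, 1) k n by apply: lt_le_trans Z2.
by apply: ler_pM => //; rewrite ?invr_ge0 ?(ltW u0)// lef_pV2 ?posrE.
Qed.

Lemma kappa_bounds n M : (0 < n)%N -> 2 <= ln (n%:R : R) -> (0 < M)%N -> 2 <= ln (M%:R : R) ->
  0 < lnpow_lower (0, 1) 1 n -> 0 <= lnpow_lower (1, 0) 1 n ->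
  0 < lnpow_lower (0, 1) 2 n -> 0 <= lnpow_lower (1, 0) 2 n ->
  exists kappa, [/\ series (kappa_term R) @ \oo --> kappa, (forall N, series (kappa_term R) N <= kappa),
    lnpow_lower (1, 0) 1 n / lnpow_upper (0, 1) 1 n + lnpow_lower (1, 0) 2 n / lnpow_upper (0, 1) 2 n
      + series rest_term M.+1 <= kappa &
    kappa <= lnpow_upper (1, 0) 1 n / lnpow_lower (0, 1) 1 n + lnpow_upper (1, 0) 2 n / lnpow_lower (0, 1) 2 n
      + (series rest_term M.+1 - lnpow_em (1, 0) 4 M%:R)].
Proof.
move=> n0 ln2 M0 lM z1 l1 z2 l2.
have [A2 [c2 h2 u2 w2]] := mangoldt_bounds 1 n isT n0 ln2 z1 l1.
have [A3 [c3 h3 u3 w3]] := mangoldt_bounds 2 n isT n0 ln2 z2 l2.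
have r0 p : 0 <= rest_term p by have /andP[] := rest_term_bounds p.
have [B [cB hB uB]] := nneg_series_cvg _ _ r0 (fun N => rest_series N M M0 lM).
exists (A2 + A3 + B); split.
- rewrite (_ : series (kappa_term R) = (fun N => series (mangoldt_term 2) N + series (mangoldt_term 3) N + series rest_term N)).
    by apply: cvgD => //; exact: cvgD.
  by apply/funext => N; exact: series_kappaE.
- by move=> N; rewrite series_kappaE !lerD.
- by rewrite !lerD.
- by rewrite !lerD.
Qed.

End KappaBounds.

(** * Interval arithmetic with integer endpoints *)

Section FixedPoint.
Variable R : realType.
Implicit Types (x y : R) (a b c n : Z).

Definition ZR (a : Z) : R := (int_of_Z a)%:~R.

Lemma ZRD a b : ZR (a + b)%ZZ = ZR a + ZR b.
Proof. by rewrite /ZR -rmorphD -(rmorphD int_of_Z). Qed.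

Lemma ZRM a b : ZR (a * b)%ZZ = ZR a * ZR b.
Proof. by rewrite /ZR -rmorphM -(rmorphM int_of_Z). Qed.

Lemma ZRN a : ZR (- a)%ZZ = - ZR a.
Proof. by rewrite /ZR -rmorphN -(rmorphN int_of_Z). Qed.

Lemma ZRB a b : ZR (a - b)%ZZ = ZR a - ZR b.
Proof. by rewrite -ZRN -ZRD. Qed.

Lemma ZR_nat (n : nat) : ZR (Z.of_nat n) = n%:R.
Proof.
rewrite /ZR; have -> : int_of_Z (Z.of_nat n) = n%:Z by lia.
by rewrite pmulrn.
Qed.

Lemma ZR0 : ZR 0 = 0. Proof. exact: (ZR_nat 0). Qed.
Lemma ZR1 : ZR 1 = 1. Proof. exact: (ZR_nat 1). Qed.

Lemma ZR_le a b : (a <= b)%ZZ -> ZR a <= ZR b.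
Proof. by move=> ab; rewrite /ZR ler_int; lia. Qed.

Lemma ZR_lt a b : (a < b)%ZZ -> ZR a < ZR b.
Proof. by move=> ab; rewrite /ZR ltr_int; lia. Qed.

Lemma ZR_lt_inv a b : ZR a < ZR b -> (a < b)%ZZ.
Proof. by rewrite /ZR ltr_int; lia. Qed.

Lemma ZR_le_inv a b : ZR a <= ZR b -> (a <= b)%ZZ.
Proof. by rewrite /ZR ler_int; lia. Qed.

Opaque ZR.

Lemma ZR_ge0 a : (0 <= a)%ZZ -> 0 <= ZR a.
Proof. by move=> h; rewrite -ZR0; exact: ZR_le. Qed.

Lemma ZR_gt0 a : (0 < a)%ZZ -> 0 < ZR a.
Proof. by move=> h; rewrite -ZR0; exact: ZR_lt. Qed.

Lemma ZR_div_le a b : (0 < b)%ZZ -> ZR (a / b) * ZR b <= ZR a.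
Proof. by move=> b0; rewrite -ZRM; apply: ZR_le; have := Z.mul_div_le a b b0; lia. Qed.

Lemma ZR_div_gt a b : (0 < b)%ZZ -> ZR a <= (ZR (a / b + 1)) * ZR b.
Proof.
move=> b0; rewrite -ZRM; apply: ZR_le; have := Z.mul_succ_div_gt a b b0.
by rewrite Z.mul_comm; lia.
Qed.

(* Fixed-point numbers: the integer [a] stands for [a / scale], where
   [scale = 2 ^ 70]. *)
Definition scale : Z := 1180591620717411303424%ZZ.

Fact scale_pos : (0 < scale)%ZZ.
Proof. by []. Qed.

Opaque scale.

Lemma scale_gt0 : 0 < ZR scale.
Proof. by apply: ZR_gt0; exact: scale_pos. Qed.
Local Notation S := (ZR scale).

Definition encl (i : Z * Z) x := (ZR i.1 <= x * S) && (x * S <= ZR i.2).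

Definition iadd (i j : Z * Z) := ((i.1 + j.1)%ZZ, (i.2 + j.2)%ZZ).
Definition isub (i j : Z * Z) := ((i.1 - j.2)%ZZ, (i.2 - j.1)%ZZ).
Definition iint (a : Z) := ((a * scale)%ZZ, (a * scale)%ZZ).
Definition imulZ (c : Z) (i : Z * Z) := ((c * i.1)%ZZ, (c * i.2)%ZZ).
(** [Z.div] rounds down, so only the upper ends have to be corrected by $1$. *)
Definition idivZ (i : Z * Z) (c : Z) := ((i.1 / c)%ZZ, (i.2 / c + 1)%ZZ).
(* product of intervals with nonnegative left ends *)
Definition imul (i j : Z * Z) := ((i.1 * j.1 / scale)%ZZ, (i.2 * j.2 / scale + 1)%ZZ).
Definition idiv (i j : Z * Z) := ((i.1 * scale / j.2)%ZZ, (i.2 * scale / j.1 + 1)%ZZ).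

Lemma encl_add i j x y : encl i x -> encl j y -> encl (iadd i j) (x + y).
Proof. by move=> /andP[? ?] /andP[? ?]; rewrite /encl /= !ZRD mulrDl !lerD. Qed.

Lemma encl_sub i j x y : encl i x -> encl j y -> encl (isub i j) (x - y).
Proof.
move=> /andP[h1 h2] /andP[h3 h4]; rewrite /encl /= (ZRB i.1) (ZRB i.2).
by rewrite mulrBl (lerB h1 h4) (lerB h2 h3).
Qed.

Lemma encl_int a : encl (iint a) (ZR a).
Proof. by rewrite /encl /= ZRM !lexx. Qed.

Lemma encl_nat (n : nat) : encl (iint (Z.of_nat n)) n%:R.
Proof. by rewrite -ZR_nat; exact: encl_int. Qed.

Lemma encl_mulZ c i x : (0 <= c)%ZZ -> encl i x -> encl (imulZ c i) (ZR c * x).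
Proof.
move=> c0 /andP[h1 h2]; rewrite /encl /= !ZRM -mulrA.
by rewrite (ler_wpM2l (ZR_ge0 _ c0) h1) (ler_wpM2l (ZR_ge0 _ c0) h2).
Qed.

Lemma encl_divZ c i x : (0 < c)%ZZ -> encl i x -> encl (idivZ i c) (x / ZR c).
Proof.
move=> c0 /andP[h1 h2]; have C0 := ZR_gt0 _ c0; rewrite /encl /= mulrAC.
rewrite ler_pdivlMr// ler_pdivrMr//; apply/andP; split.
  exact: le_trans (ZR_div_le _ _ c0) h1.
exact: le_trans h2 (ZR_div_gt _ _ c0).
Qed.

Lemma encl_ge0 i x : (0 <= i.1)%ZZ -> encl i x -> 0 <= x.
Proof.
move=> i0 /andP[h _]; rewrite -(pmulr_lge0 _ scale_gt0).
exact: le_trans (ZR_ge0 _ i0) h.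
Qed.

Lemma encl_mul i j x y : (0 <= i.1)%ZZ -> (0 <= j.1)%ZZ ->
  encl i x -> encl j y -> encl (imul i j) (x * y).
Proof.
move=> i0 j0 hx hy; have x0 := encl_ge0 _ _ i0 hx; have y0 := encl_ge0 _ _ j0 hy.
move: hx hy => /andP[h1 h2] /andP[h3 h4].
have e : x * y * S * S = (x * S) * (y * S) by ring.
have S0 := ltW scale_gt0.
have b1 := ler_pM (ZR_ge0 _ i0) (ZR_ge0 _ j0) h1 h3.
have b2 := ler_pM (mulr_ge0 x0 S0) (mulr_ge0 y0 S0) h2 h4.
rewrite /encl /=; apply/andP; split; rewrite -(ler_pM2r scale_gt0) e.
  by apply: le_trans (ZR_div_le _ _ scale_pos) _; rewrite ZRM; exact: b1.
by apply: le_trans _ (ZR_div_gt (i.2 * j.2)%ZZ _ scale_pos); rewrite ZRM; exact: b2.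
Qed.

Lemma encl_div i j x y : (0 <= i.1)%ZZ -> (0 < j.1)%ZZ ->
  encl i x -> encl j y -> encl (idiv i j) (x / y).
Proof.
move=> i0 j0 hx hy; have x0 := encl_ge0 _ _ i0 hx.
move: hx hy => /andP[h1 h2] /andP[h3 h4].
have J1 := ZR_gt0 _ j0.
have yS : 0 < y * S by exact: lt_le_trans J1 h3.
have y0 : 0 < y by rewrite -(pmulr_lgt0 _ scale_gt0).
have J2 : (0 < j.2)%ZZ.
  by have := lt_le_trans yS h4; rewrite -ZR0; exact: ZR_lt_inv.
have gen (s : R) : 0 < s -> x / y * s = x * s * s / (y * s).
  by move=> s0; field; rewrite (gt_eqF y0) (gt_eqF s0).
have e := gen _ scale_gt0.
have S0 := ltW scale_gt0.
have i2 : (0 <= i.2)%ZZ.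
  by apply: ZR_le_inv; rewrite ZR0; apply: le_trans h2; apply: mulr_ge0.
have q1 : 0 <= ZR (i.1 * scale / j.2)%ZZ.
  exact: ZR_ge0 _ (Z.div_pos _ _ (Z.mul_nonneg_nonneg _ _ i0 (Z.lt_le_incl _ _ scale_pos)) J2).
have q2 : 0 <= ZR (i.2 * scale / j.1 + 1)%ZZ.
  apply: ZR_ge0; apply: Z.add_nonneg_nonneg => //.
  exact (Z.div_pos _ _ (Z.mul_nonneg_nonneg _ _ i2 (Z.lt_le_incl _ _ scale_pos)) j0).
rewrite /encl /= e (ler_pdivlMr _ _ yS) (ler_pdivrMr _ _ yS); apply/andP; split.
  have r1 := le_trans (ler_wpM2l q1 h4) (ZR_div_le _ _ J2).
  by apply: (le_trans r1); rewrite ZRM; exact: ler_wpM2r S0 _ _ h1.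
have r1 := le_trans (ZR_div_gt (i.2 * scale)%ZZ _ j0) (ler_wpM2l q2 h3).
by apply: le_trans _ r1; rewrite ZRM; exact: ler_wpM2r S0 _ _ h2.
Qed.

Lemma encl_lt i j x y : (i.2 < j.1)%ZZ -> encl i x -> encl j y -> x < y.
Proof.
move=> ij /andP[_ h1] /andP[h2 _]; rewrite -(ltr_pM2r scale_gt0).
exact: le_lt_trans h1 (lt_le_trans (ZR_lt _ _ ij) h2).
Qed.

Lemma encl_le i j x y : (i.2 <= j.1)%ZZ -> encl i x -> encl j y -> x <= y.
Proof.
move=> ij /andP[_ h1] /andP[h2 _]; rewrite -(ler_pM2r scale_gt0).
exact: le_trans h1 (le_trans (ZR_le _ _ ij) h2).
Qed.

End FixedPoint.

(** * Interval enclosures of logarithms *)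

Section LnInterval.
#[local] Arguments Z.mul : simpl never.
#[local] Arguments Z.add : simpl never.
#[local] Arguments Z.div : simpl never.
#[local] Arguments Z.of_nat : simpl never.
Variable R : realType.
Local Notation ZR := (@ZR R).
Local Notation S := (ZR scale).
Local Notation encl := (@encl R).
Implicit Types (a b c p q t : Z).

(** The state carries the odd denominator [k] and the scaled odd power [t] of $z$, with $z^2 = a/b$;
    every division rounds down. *)
Fixpoint atanh_lo (n : nat) (k t a b : Z) : Z :=
  if n is n'.+1 then (2 * t / k + atanh_lo n' (k + 2) (t * a / b) a b)%ZZ else 0%ZZ.

(** The base case $3t$ covers the tail of the series: for $z\le1/3$ the factor
    $\frac{2}{(2n+1)(1-z^2)}$ is at most $3$. *)
Fixpoint atanh_hi (n : nat) (k t a b : Z) : Z :=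
  if n is n'.+1 then (2 * t / k + 1 + atanh_hi n' (k + 2) (t * a / b + 1) a b)%ZZ
  else (3 * t)%ZZ.

Lemma atanh_loP n (k : nat) t a b (w y : R) : (0 < k)%N -> (0 <= t)%ZZ ->
  (0 <= a)%ZZ -> (0 < b)%ZZ -> y * ZR b = ZR a -> ZR t <= w * S ->
  ZR (atanh_lo n (Z.of_nat k) t a b) <= (\sum_(i < n) 2 / (k + 2 * i)%:R * (w * y ^+ i)) * S.
Proof.
move=> + + a0 b0 yb; elim: n k t w => [|n IH] k t w k0 t0 tw /=.
  by rewrite big_ord0 mul0r ZR0.
have B0 := @ZR_gt0 R _ b0; have K0 : (0 < Z.of_nat k)%ZZ by lia.
rewrite big_ord_recl mulrDl ZRD; apply: lerD.
  rewrite muln0 addn0 expr0 mulr1 -(ler_pM2r (@ZR_gt0 R _ K0)).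
  apply: le_trans (ZR_div_le R _ _ K0) _; rewrite ZRM ZR_nat.
  have k1 : (k%:R : R) != 0 by rewrite pnatr_eq0 -lt0n.
  have -> (s : R) : 2 / k%:R * w * s * k%:R = 2 * (w * s) by field.
  by rewrite (ZR_nat R 2) ler_wpM2l.
have -> : (Z.of_nat k + 2)%ZZ = Z.of_nat (k + 2) by lia.
apply: le_trans (IH _ _ (w * y) _ _ _) _ => //; first by rewrite addn_gt0 k0.
- by apply: Z.div_pos => //; lia.
- rewrite -(ler_pM2r B0); apply: le_trans (ZR_div_le R _ _ b0) _.
  have -> (s : R) : w * y * s * ZR b = (w * s) * (y * ZR b) by ring.
  by rewrite yb ZRM; apply: ler_wpM2r => //; exact: ZR_ge0.
rewrite le_eqVlt; apply/orP; left; apply/eqP; congr (_ * _).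
apply: eq_bigr => i _; rewrite /bump /= -addnA -mulnS exprS; ring.
Qed.

Lemma atanh_hiP n (k : nat) t a b (w y : R) : (0 < k)%N -> 
  (0 <= a)%ZZ -> (0 < b)%ZZ -> y * ZR b = ZR a -> w * S <= ZR t ->
  (\sum_(i < n) 2 / (k + 2 * i)%:R * (w * y ^+ i) + 3 * (w * y ^+ n)) * S <=
  ZR (atanh_hi n (Z.of_nat k) t a b).
Proof.
move=> + a0 b0 yb; elim: n k t w => [|n IH] k t w k0 tw /=.
  by rewrite big_ord0 add0r expr0 mulr1 -mulrA ZRM (ZR_nat R 3) ler_wpM2l.
have B0 := @ZR_gt0 R _ b0; have K0 : (0 < Z.of_nat k)%ZZ by lia.
rewrite big_ord_recl -addrA mulrDl ZRD; apply: lerD.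
  rewrite muln0 addn0 expr0 mulr1 -(ler_pM2r (@ZR_gt0 R _ K0)).
  apply: le_trans _ (ZR_div_gt R _ _ K0); rewrite ZRM ZR_nat.
  have k1 : (k%:R : R) != 0 by rewrite pnatr_eq0 -lt0n.
  have -> (s : R) : 2 / k%:R * w * s * k%:R = 2 * (w * s) by field.
  by rewrite (ZR_nat R 2) ler_wpM2l.
have -> : (Z.of_nat k + 2)%ZZ = Z.of_nat (k + 2) by lia.
apply: le_trans _ (IH _ _ (w * y) _ _) => //.
- rewrite le_eqVlt; apply/orP; left; apply/eqP; congr (_ * _); congr (_ + _).
    by apply: eq_bigr => i _; rewrite /bump /= -addnA -mulnS exprS; ring.
  by rewrite exprS; ring.
- by rewrite addn_gt0 k0.
rewrite -(ler_pM2r B0); apply: le_trans _ (ZR_div_gt R _ _ b0).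
have -> (s : R) : w * y * s * ZR b = (w * s) * (y * ZR b) by ring.
by rewrite yb ZRM; apply: ler_wpM2r => //; exact: ZR_ge0.
Qed.

(* encloses [ln (p / q)] for [q <= p <= 2 q] *)
Definition iln_ratio (n : nat) (p q : Z) : Z * Z :=
  let a := (p - q)%ZZ in let b := (p + q)%ZZ in
  let t := (a * scale / b)%ZZ in
  (atanh_lo n 1 t (a * a) (b * b), atanh_hi n 1 (t + 1) (a * a) (b * b)).

Lemma encl_ln_ratio n p q : (0 < q)%ZZ -> (q <= p)%ZZ -> (p <= 2 * q)%ZZ ->
  encl (iln_ratio n p q) (ln (ZR p / ZR q)).
Proof.
move=> q0 qp p2q.
have a0 : (0 <= p - q)%ZZ by lia.
have b0 : (0 < p + q)%ZZ by lia.
have Q0 := @ZR_gt0 R _ q0; have A0 := @ZR_ge0 R _ a0; have B0 := @ZR_gt0 R _ b0.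
have P0 : 0 < ZR p by apply: ZR_gt0; lia.
(* Chosen so that $p/q = (1+z)/(1-z)$; the condition $p\le 2q$ means $z\le1/3$. *)
pose z : R := ZR (p - q)%ZZ / ZR (p + q)%ZZ.
have z0 : 0 <= z by rewrite divr_ge0// ltW.
have z3 : z <= 1 / 3.
  rewrite ler_pdivrMr// -subr_ge0.
  have -> : 1 / 3 * ZR (p + q)%ZZ - ZR (p - q)%ZZ = 2 / 3 * ZR (2 * q - p)%ZZ.
    by rewrite ZRD !ZRB ZRM (ZR_nat R 2); field.
  by rewrite mulr_ge0// ?divr_ge0//; apply: ZR_ge0; lia.
have z1 : z < 1 by lra.
have lnE : ln (ZR p / ZR q) = ln (1 + z) - ln (1 - z).
  have e1 : 1 + z = 2 * ZR p / ZR (p + q)%ZZ.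
    by move: (gt_eqF B0); rewrite /z ZRB ZRD => h; field; rewrite h.
  have e2 : 1 - z = 2 * ZR q / ZR (p + q)%ZZ.
    by move: (gt_eqF B0); rewrite /z ZRB ZRD => h; field; rewrite h.
  rewrite e1 e2 -ln_div ?posrE ?divr_gt0 ?mulr_gt0//; congr ln.
  have gen (u v w : R) : 0 < v -> 0 < w -> u / v = 2 * u / w / (2 * v / w).
    by move=> v0 w0; field; rewrite (gt_eqF v0) (gt_eqF w0).
  exact: gen.
have zE : z ^+ 2 * ZR ((p + q) * (p + q))%ZZ = ZR ((p - q) * (p - q))%ZZ.
  have gen (u w : R) : 0 < w -> (u / w) ^+ 2 * (w * w) = u * u.
    by move=> w0; field; rewrite (gt_eqF w0).
  by rewrite /z !ZRM; exact: gen.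
have sumE : \sum_(i < n) 2 / (1 + 2 * i)%:R * (z * (z ^+ 2) ^+ i) = atanh_sum R n z.
  by apply: eq_bigr => i _; rewrite -exprM addn1 exprS add1n.
have zS : z * S * ZR (p + q)%ZZ = ZR ((p - q) * scale)%ZZ.
  have gen (u w s : R) : 0 < w -> u / w * s * w = u * s.
    by move=> w0; field; rewrite (gt_eqF w0).
  by rewrite /z ZRM; exact: gen.
rewrite /encl /= lnE; apply/andP; split.
  apply: (@le_trans _ _ (atanh_sum R n z * S)).
    rewrite -sumE; apply: (@atanh_loP n 1) => //.
    - by apply: Z.div_pos => //; apply: Z.mul_nonneg_nonneg.
    - by apply: Z.mul_nonneg_nonneg.
    - by apply: Z.mul_pos_pos.
    - rewrite -(ler_pM2r B0) zS; exact: ZR_div_le.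
  by rewrite ler_wpM2r ?(ltW (scale_gt0 R))// ln_ge_atanh// z0.
apply: (@le_trans _ _ ((atanh_sum R n z + 3 * (z * (z ^+ 2) ^+ n)) * S)).
  rewrite ler_wpM2r ?(ltW (scale_gt0 R))//.
  apply: le_trans (ln_le_atanh _ n z _) _; first by rewrite z0.
  rewrite lerD2l -exprM -exprS addn1 mulrAC ler_wpM2r ?exprn_ge0//.
  have z2 : z ^+ 2 <= 1 / 9.
    have -> : 1 / 9 = (1 / 3) ^+ 2 :> R by field.
    by rewrite lerXn2r// nnegrE// divr_ge0.
  have [d1 d2] : 0 < 1 - z ^+ 2 /\ 2 <= 3 * (1 - z ^+ 2) by clear -z2; lra.
  rewrite ler_pdivrMr//; apply: le_trans d2.
  by rewrite ler_pdivrMr ?ltr0n// ler_peMr// ler1n.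
rewrite -sumE; apply: (@atanh_hiP n 1) => //.
- by apply: Z.mul_nonneg_nonneg.
- by apply: Z.mul_pos_pos.
- rewrite -(ler_pM2r B0) zS; exact: ZR_div_gt.
Qed.

Definition iln2 := iln_ratio 14 2 1.

Lemma encl_ln2 : encl iln2 (ln 2).
Proof.
have := @encl_ln_ratio 14 2 1; rewrite (ZR_nat R 2) (ZR_nat R 1) divr1.
exact.
Qed.

(* [l2] encloses [ln 2]; argument reduction by [2 ^ log2 p] *)
Definition iln (l2 : Z * Z) (p : Z) : Z * Z :=
  let e := Z.log2 p in iadd (imulZ e l2) (iln_ratio 14 p (2 ^ e)%ZZ).

Lemma encl_ln l2 p : encl l2 (ln 2) -> (0 < p)%ZZ -> encl (iln l2 p) (ln (ZR p)).
Proof.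
move=> h2 p0; rewrite /iln; have [h3 h4] := Z.log2_spec p p0.
have e0 := Z.log2_nonneg p; set e := Z.log2 p in h3 h4 e0 *.
have q0 : (0 < 2 ^ e)%ZZ by apply: Z.pow_pos_nonneg.
have Q0 := @ZR_gt0 R _ q0; have P0 := @ZR_gt0 R _ p0.
have -> : ln (ZR p) = ZR e * ln 2 + ln (ZR p / ZR (2 ^ e)%ZZ).
  rewrite ln_div ?posrE//; have -> : ZR (2 ^ e)%ZZ = 2 ^+ Z.to_nat e.
    rewrite -{1}(Z2Nat.id _ e0); elim: (Z.to_nat e) => [|k IH].
      by rewrite expr0 (ZR_nat R 1).
    rewrite Nat2Z.inj_succ Z.pow_succ_r; last by lia.
    by rewrite ZRM IH exprS (ZR_nat R 2).
  rewrite lnXn// -{1}(Z2Nat.id _ e0) ZR_nat mulr_natl; ring.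
apply: encl_add; first exact: encl_mulZ.
apply: encl_ln_ratio => //; move: h4; rewrite Z.pow_succ_r//; lia.
Qed.
End LnInterval.

(** * The sum of all derivatives of a polynomial *)

Section SumDerivatives.
Variable A : idomainType.
Implicit Types (f g : {poly A}) (a : A).

Definition sumder f : {poly A} := \sum_(i < size f) f^`(i).

(** Algebraic form of $\int_0^\infty g(t)e^{-t}\,dt$. By Taylor's formula, $F(a)$ is this functional
    applied to $f(X+a)$, which reduces divisibility and size of $F(a)$ to the coefficients of a
    shifted polynomial. *)
Definition facT g : A := \sum_(i < size g) (i`!)%:R * g`_i.

Lemma sumderE n f : (size f <= n)%N -> sumder f = \sum_(i < n) f^`(i).
Proof.
move=> fn; rewrite /sumder -(subnKC fn) big_split_ord /= [X in _ = _ + X]big1 ?addr0// => i _.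
apply/polyP => j; rewrite coef_derivn coef0 nth_default ?mul0rn//.
by rewrite -addnA leq_addr.
Qed.

Lemma sumder_is_linear : linear sumder.
Proof.
move=> a f g; pose n := maxn (size f) (size g).
have hn : (size (a *: f + g)%R <= n)%N.
  rewrite (leq_trans (size_polyD _ _))// geq_max leq_maxr andbT.
  by rewrite (leq_trans (size_scale_leq _ _)) ?leq_maxl.
rewrite (sumderE n)// (sumderE n f) ?leq_maxl// (sumderE n g) ?leq_maxr//.
rewrite scaler_sumr -big_split; apply: eq_bigr => i _ /=.
by rewrite derivnD derivnZ.
Qed.
HB.instance Definition _ := GRing.isLinear.Build A {poly A} {poly A} _ sumder sumder_is_linear.

Lemma sumder_deriv f : sumder f - (sumder f)^`() = f.
Proof.
have e : (sumder f)^`() = \sum_(i < size f) f^`(i.+1).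
  by rewrite /sumder raddf_sum; apply: eq_bigr => i _; rewrite derivnS.
rewrite e (sumderE (size f).+1)// big_ord_recl.
by under eq_bigr => i _ do rewrite lift0; rewrite addrK.
Qed.

Lemma derivn_shift i f a : (f \Po ('X + a%:P))^`(i) = f^`(i) \Po ('X + a%:P).
Proof.
elim: i => [|i IH]; first by rewrite !derivn0.
by rewrite !derivnS IH deriv_comp derivD derivX derivC addr0 mulr1.
Qed.

Lemma sumder_horner f a : (sumder f).[a] = facT (f \Po ('X + a%:P)).
Proof.
have sz : size (f \Po ('X + a%:P)) = size f.
  have [->|f0] := eqVneq f 0; first by rewrite comp_poly0.
  by rewrite size_comp_poly2// size_XaddC.
rewrite /sumder /facT sz horner_sum; apply: eq_bigr => i _.
have -> : f^`(i).[a] = ((f \Po ('X + a%:P))^`(i)).[0].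
  by rewrite derivn_shift horner_comp !hornerE.
by rewrite horner_coef0 coef_derivn addn0 ffactnn mulr_natl.
Qed.
End SumDerivatives.

(** * Powers of the ideal $(p, X)$ and divisibility of $F(a)$ *)

Section Divisibility.
Implicit Types (p l m n e : nat) (f g h q : {poly int}).

Lemma dvd_fact m n : (m <= n)%N -> (m`! %| n`!)%N.
Proof. by move=> mn; rewrite -(ffact_fact (leq_subr m n)) subKn// dvdn_mull. Qed.

(* [g] lies in the [n]-th power of the ideal [(p, 'X)] *)
Definition pX_adic p n g := forall i, ((p ^ (n - i))%:Z %| g`_i)%Z.

Lemma pX_adicM p n n' g g' : pX_adic p n g -> pX_adic p n' g' -> pX_adic p (n + n') (g * g').
Proof.
move=> hg hg' i; rewrite coefM; apply: rpred_sum => k _.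
apply: (@dvdz_trans ((p ^ (n - k))%:Z * (p ^ (n' - (i - k)))%:Z)).
  by rewrite -PoszM -expnD dvdzE /= dvdn_exp2l//; have := ltn_ord k; lia.
by apply: dvdz_mul.
Qed.

Lemma pX_adic0 p g : pX_adic p 0 g.
Proof. by move=> i; rewrite sub0n expn0 dvd1z. Qed.

Lemma pX_adic_lin p (c : int) : (p%:Z %| c)%Z -> pX_adic p 1 ('X + c%:P).
Proof.
move=> pc [|i]; rewrite coefD coefX coefC /=; first by rewrite add0r.
by rewrite dvd1z.
Qed.

Lemma pX_adicX p n k g : pX_adic p n g -> pX_adic p (n * k) (g ^+ k).
Proof.
by move=> h; elim: k => [|k IH]; rewrite ?muln0 ?expr0 ?mulnS ?exprS; [exact: pX_adic0|exact: pX_adicM].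
Qed.

Lemma pX_adic_facT p n e g : (forall i, (i <= n)%N -> (p ^ e %| p ^ (n - i) * i`!)%N) ->
  pX_adic p n g -> ((p ^ e)%:Z %| facT int g)%Z.
Proof.
move=> he hg; apply: rpred_sum => i _.
apply: (@dvdz_trans ((i : nat)`!%:Z * (p ^ (n - i))%:Z)); last first.
  by rewrite natz; apply: dvdz_mul.
(* For $i>n$ the power of $p$ comes from the factorial alone: the case $i=n$ gives $p^e\mid n!$, and
   $n!\mid i!$. *)
rewrite -PoszM dvdzE /= mulnC; have [/he//|ni] := leqP i n.
have := he n (leqnn _); rewrite subnn mul1n => /dvdn_trans; apply.
by apply: dvdn_mull; exact: dvd_fact (ltnW ni).
Qed.

Lemma facT_XnM l g : ((l`!)%:Z %| facT int ('X^l * g))%Z.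
Proof.
apply: rpred_sum => i _.
rewrite coefXnM; case: ltnP => il; first by rewrite mulr0 dvdz0.
by rewrite natz dvdz_mulr// dvdzE /= dvd_fact.
Qed.

Definition nodes (A : nzRingType) m : {poly A} := \prod_(j < m.+1) ('X - (j%:R)%:P).

Lemma nodes_shift m (a : nat) : (a <= m)%N ->
  nodes int m \Po ('X + (a%:Z)%:P) =
  'X * (\prod_(i < a) ('X + (i.+1%:Z)%:P) * \prod_(i < m - a) ('X + (- i.+1%:Z)%:P)).
Proof.
move=> am; rewrite /nodes rmorph_prod /=.
under eq_bigr => j _ do rewrite rmorphB /= comp_polyX comp_polyC -addrA -polyCN -polyCD natz.
rewrite -(big_mkord xpredT (fun j => 'X + (a%:Z - j%:Z)%:P)) (big_cat_nat _ (n := a))//=; last by lia.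
rewrite [X in _ * X]big_nat_recl; last by lia.
rewrite subrr addr0 mulrCA; congr (_ * (_ * _)).
  rewrite big_mkord [LHS](reindex_inj rev_ord_inj) /=; apply: eq_bigr => i _.
  by congr ('X + _%:P); have := ltn_ord i; lia.
rewrite -{1}[a]add0n big_addn big_mkord; apply: eq_bigr => i _.
by congr ('X + _%:P); lia.
Qed.

(** Exactly $\lfloor k/p\rfloor$ of the integers $1,\dots,k$ are multiples of $p$. The sign [s]
    covers the nodes on either side of the chosen one. *)
Lemma pX_adic_prod p k (s : int) : (0 < p)%N ->
  pX_adic p (k %/ p) (\prod_(i < k) ('X + (s * i.+1%:Z)%:P)).
Proof.
move=> p0; elim: k => [|k IH]; first by rewrite div0n; exact: pX_adic0.
rewrite big_ord_recr /= divnS// addnC; apply: pX_adicM => //.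
case: (boolP (p %| k.+1)%N) => pk; last exact: pX_adic0.
by apply: pX_adic_lin; rewrite dvdz_mull.
Qed.

Lemma minfloor_le m p a : (a <= m)%N -> (minfloor m p <= a %/ p + (m - a) %/ p)%N.
Proof.
move=> am; have ha : (a < m.+1)%N by [].
rewrite /minfloor (bigminD1 (Ordinal ha))//=.
exact: geq_minl.
Qed.
End Divisibility.

(** * The common divisor of the integers $F(0),\dots,F(m)$ *)

Section CommonFactor.
Implicit Types (p l m n : nat) (q : {poly int}).

(** The exponent of $p$ guaranteed in [facT g] when $g$ lies in $(p,X)^n$: the coefficient of $X^i$
    supplies $p^{n-i}$ and the functional supplies $i!$. The neutral element is the value at
    $i=n$. *)
Definition vmin p n : nat := \big[minn/logn p n`!]_(i < n.+1) (logn p i`! + (n - i))%N.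

Lemma vmin_le p n i : (i <= n)%N -> (vmin p n <= logn p i`! + (n - i))%N.
Proof.
move=> i_n; have hi : (i < n.+1)%N by [].
by rewrite /vmin (bigminD1 (Ordinal hi))//=; exact: geq_minl.
Qed.

(** Because subtraction on [nat] is truncated, the exponent of a prime $p\le(m+1)/2$ is exactly the
    maximum of $v_p(l!)$ and [vmin]. *)
Definition common_factor m l : nat :=
  (l`! * \prod_(p < ((m.+1)./2).+1 | prime p)
           p ^ (vmin p (l * (minfloor m p).+1) - logn p l`!))%N.

Lemma common_factor_gt0 m l : (0 < common_factor m l)%N.
Proof.
rewrite muln_gt0 fact_gt0 /=; apply: prodn_cond_gt0 => p pp.
by rewrite expn_gt0 prime_gt0.
Qed.

Lemma logn_prime_prod p B (e : nat -> nat) : prime p ->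
  logn p (\prod_(q < B | prime q) q ^ e q)%N = if (p < B)%N then e p else 0%N.
Proof.
move=> pp; elim: B => [|B IH]; first by rewrite big_ord0 logn1.
rewrite big_mkcond big_ord_recr -big_mkcond /= lognM; last 2 first.
- by apply: prodn_cond_gt0 => q pq; rewrite expn_gt0 prime_gt0.
- by case: ifP => // pB; rewrite expn_gt0 prime_gt0.
rewrite IH; have -> : logn p (if prime B then B ^ e B else 1)%N = if p == B then e p else 0%N.
  have [<-|pB] := eqVneq p B; first by rewrite pp pfactorK.
  case: (boolP (prime B)) => qB; last by rewrite logn1.
  by rewrite lognX logn_prime// (negPf pB) muln0.
rewrite [in RHS]ltnS [in RHS]leq_eqVlt; have [<-|pB] := eqVneq p B; first by rewrite ltnn.
by rewrite addn0.
Qed.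

(** Checked one prime at a time. After the shift by $a$ the node $a$ becomes $X$, so $X^l$ yields
    $l!$; the same $X$, together with the remaining factors whose constants are multiples of $p$,
    puts the polynomial in $(p,X)^{l(N+1)}$ with $N$ the value of [minfloor m p]. *)
Lemma dvd_sumder_nodes m l q (a : nat) : (a <= m)%N ->
  ((common_factor m l)%:Z %| (sumder int (nodes int m ^+ l * q)).[a%:Z])%Z.
Proof.
move=> am; rewrite sumder_horner rmorphM rmorphXn /= nodes_shift//.
set U := (X in 'X * X); set q' := (q \Po _); rewrite dvdzE /=.
set z := absz _.
have hfact : (l`! %| z)%N.
  rewrite /z; have := facT_XnM l (U ^+ l * q'); by rewrite dvdzE /= mulrA -exprMn.
apply/dvdn_partP; first exact: common_factor_gt0.
move=> p; rewrite mem_primes => /and3P[pp _ _]; rewrite p_part.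
rewrite /common_factor lognM ?fact_gt0//; last first.
  by apply: prodn_cond_gt0 => r pr; rewrite expn_gt0 prime_gt0.
rewrite (@logn_prime_prod p _ (fun r => vmin r (l * (minfloor m r).+1) - logn r l`!)%N)//.
have hl : (p ^ logn p l`! %| z)%N by rewrite -p_part (dvdn_trans (dvdn_part _ _)).
case: ifP => pB; last by rewrite addn0.
set n := (l * _)%N; have [hv|hv] := leqP (vmin p n) (logn p l`!).
  by rewrite (eqP hv) addn0.
rewrite subnKC; last exact: ltnW.
have := @pX_adic_facT p n (vmin p n) (('X * U) ^+ l * q'); rewrite dvdzE /=; apply.
  move=> i i_n; apply: (@dvdn_trans (p ^ (n - i) * p ^ logn p i`!)).
    by rewrite -expnD dvdn_exp2l// addnC vmin_le.
  by rewrite dvdn_mul// -p_part dvdn_part.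
have -> : n = ((minfloor m p).+1 * l + 0)%N by rewrite addn0 mulnC.
apply: pX_adicM; last exact: pX_adic0.
apply: pX_adicX; have p0 := prime_gt0 pp.
have h1 : pX_adic p (a %/ p + (m - a) %/ p) U.
  apply: pX_adicM.
    have := @pX_adic_prod p a 1 p0.
    by under eq_bigr => i _ do rewrite mul1r.
  have := @pX_adic_prod p (m - a) (-1) p0.
  by under eq_bigr => i _ do rewrite mulN1r.
have h2 : pX_adic p 1 'X by have := @pX_adic_lin p 0 (dvdz0 _); rewrite addr0.
move=> i; apply: dvdz_trans _ (pX_adicM _ _ _ _ _ h2 h1 i); rewrite dvdzE /= dvdn_exp2l//.
by apply: leq_sub2r; rewrite add1n ltnS minfloor_le.
Qed.

Lemma logn_fact_rec p n : prime p -> logn p n`! = (n %/ p + logn p (n %/ p)`!)%N.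
Proof.
move=> pp; have p1 := prime_gt1 pp; case: n => [|n]; first by rewrite div0n.
rewrite !logn_fact// big_nat_recl// expn1; congr addn.
under eq_big_nat => k _ do rewrite expnS divnMA.
set d := (n.+1 %/ p)%N.
have dn : (d <= n)%N by rewrite -ltnS ltn_Pdiv.
rewrite (big_cat_nat _ (n := d.+1))//= [X in (_ + X)%N]big1_seq ?addn0// => k.
rewrite mem_index_iota => /andP[_ /andP[dk _]]; rewrite divn_small//.
by apply: leq_trans dk _; rewrite ltnW// ltn_expl.
Qed.

Lemma logn_fact_le p l : prime p -> (0 < l)%N -> ((p - 1) * logn p l`! <= l - 1)%N.
Proof.
move=> pp; have p1 := prime_gt1 pp; elim/ltn_ind: l => l IH l0.
rewrite logn_fact_rec// mulnDr; set d := (l %/ p)%N.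
have pd : (p * d <= l)%N by rewrite mulnC leq_trunc_div.
have [d0|d0] := posnP d; first by rewrite d0 logn1 !muln0.
have dl : (d < l)%N by rewrite ltn_Pdiv.
have := IH d dl d0; move: pd; rewrite -[in X in X -> _](subnK (ltnW p1)) mulnDl mul1n; lia.
Qed.
End CommonFactor.

(** * Lower bound for the common divisor *)

Section CommonFactorSize.
Variable R : realType.
Implicit Types (p l m n : nat).

Lemma ln_nat_prime p : prime p -> 0 < ln (p%:R : R).
Proof. by move=> /prime_gt1 p1; rewrite ln_gt0// ltr1n. Qed.

Lemma natr_prime_gt1 p : prime p -> 0 < (p%:R - 1 : R).
Proof. by move=> /prime_gt1 p1; rewrite subr_gt0 ltr1n. Qed.

(* concavity of [ln], from the tangent at [y] *)
Lemma ln_chord (t P y : R) : 0 <= t <= 1 -> 0 < P -> 0 < y -> 1 - t + t * P <= y ->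
  t * ln P <= ln y.
Proof.
move=> /andP[t0 t1] P0 y0 h.
have l1 : - ln y <= y^-1 - 1.
  by rewrite -lnV// -[X in ln X](subrKC 1) le_ln1Dx// ltrBrDr addrC subrr invr_gt0.
have l2 : ln P - ln y <= P / y - 1.
  by rewrite -ln_div// -[X in ln X](subrKC 1) le_ln1Dx// ltrBrDr addrC subrr divr_gt0.
have s1 := ler_wpM2l t0 l2.
have t1' : 0 <= 1 - t by rewrite subr_ge0.
have s2 := ler_wpM2l t1' l1.
have s3 : (1 - t + t * P) / y <= 1 by rewrite ler_pdivrMr// mul1r.
have e : (1 - t + t * P) / y = (1 - t) / y + t * (P / y) by field; rewrite gt_eqF.
by move: s3; rewrite e; lra.
Qed.

(** By Legendre's formula $n-(p-1)v_p(n!)$ is the digit sum of $n$ in base $p$. The induction strips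
    the last digit $r$ of $n=dp+r$; concavity bounds its cost $\frac{r}{p-1}\ln p$ by
    $\ln\frac{n+1}{d+1}$, and these terms telescope to $\ln(n+1)$. *)
Lemma logn_fact_ge p n : prime p ->
  n%:R * (ln (p%:R : R) / (p%:R - 1)) <= (logn p n`!)%:R * ln (p%:R : R) + ln (n%:R + 1 : R).
Proof.
move=> pp; have p1 := prime_gt1 pp; have L0 := ln_nat_prime _ pp; have P1 := natr_prime_gt1 _ pp.
elim/ltn_ind: n => n IH; have [->|n0] := posnP n.
  by rewrite fact0 logn1 !mul0r add0r add0r ln1.
rewrite logn_fact_rec// natrD; set d := (n %/ p)%N; set r := (n %% p)%N.
have nE : (n = d * p + r)%N by exact: divn_eq.
have rp : (r < p)%N by rewrite ltn_mod prime_gt0.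
have dn : (d < n)%N by rewrite ltn_Pdiv.
have ihd := IH _ dn; have P0 : 0 < (p%:R : R) by rewrite ltr0n prime_gt0.
have d0 : 0 <= (d%:R : R) by [].
have r0 : 0 <= (r%:R : R) by [].
have d1 : 0 < (d%:R + 1 : R) by rewrite ltr_wpDl.
have n1 : 0 < (n%:R + 1 : R) by rewrite ltr_wpDl.
have rp1 : (r%:R : R) <= p%:R - 1 by rewrite lerBrDr natr1 ler_nat.
pose t : R := r%:R / (p%:R - 1).
have t0 : 0 <= t by rewrite divr_ge0// ltW.
have t1 : t <= 1 by rewrite ler_pdivrMr// mul1r.
have tE : t * (p%:R - 1) = r%:R by rewrite divfK// gt_eqF.
have nR : (n%:R : R) = d%:R * p%:R + r%:R by rewrite {1}nE natrD natrM.
have := @ln_chord t p%:R ((n%:R + 1) / (d%:R + 1)).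
rewrite t0 t1 => /(_ isT P0 (divr_gt0 n1 d1)).
have cond : 1 - t + t * p%:R <= (n%:R + 1) / (d%:R + 1).
  rewrite ler_pdivlMr// nR -subr_ge0.
  have -> : d%:R * p%:R + r%:R + 1 - (1 - t + t * p%:R) * (d%:R + 1) =
     d%:R * (p%:R - 1 - r%:R) by rewrite -tE; ring.
  by rewrite mulr_ge0// subr_ge0.
move=> /(_ cond); rewrite ln_div// => hc.
have e : n%:R * (ln (p%:R : R) / (p%:R - 1)) =
   d%:R * ln p%:R + d%:R * (ln p%:R / (p%:R - 1)) + t * ln p%:R.
  by rewrite nR /t; field; rewrite gt_eqF.
by rewrite e; move: ihd hc; rewrite mulrDl; lra.
Qed.

(** As $\ln p/(p-1)\le\ln p$, each of the $n-i$ free powers of $p$ contributes at least as much as a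
    unit of $i$ does through $i!$, so every $i$ satisfies the bound for $n$. *)
Lemma vmin_ge p n : prime p ->
  n%:R * (ln (p%:R : R) / (p%:R - 1)) - ln (n%:R + 1 : R) <= (vmin p n)%:R * ln (p%:R : R).
Proof.
move=> pp; have p1 := prime_gt1 pp; have L0 := ln_nat_prime _ pp; have P1 := natr_prime_gt1 _ pp.
have h i : (i <= n)%N -> n%:R * (ln (p%:R : R) / (p%:R - 1)) - ln (n%:R + 1 : R) <=
    (logn p i`! + (n - i))%:R * ln (p%:R : R).
  move=> i_n; have := @logn_fact_ge p i pp.
  have : ln (i%:R + 1 : R) <= ln (n%:R + 1).
    by rewrite ler_ln ?posrE ?ltr_wpDl// lerD2r ler_nat.
  have : (n - i)%:R * (ln (p%:R : R) / (p%:R - 1)) <= (n - i)%:R * ln (p%:R : R).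
    rewrite ler_wpM2l// ler_pdivrMr//; apply: ler_peMr; first exact: ltW.
    by rewrite lerBrDr -(natrD _ 1 1) ler_nat.
  by rewrite natrD !natrB//; set c := ln _ / _; lra.
rewrite /vmin; apply: (big_ind (fun k : nat => _ <= k%:R * ln (p%:R : R))) => [|a b ha hb|i _].
- by have := h n (leqnn _); rewrite subnn addn0.
- by rewrite /minn; case: ifP.
- by apply: h; rewrite -ltnS.
Qed.

(** This is $m\,\kappa_m$ with every weight $w_p$ replaced by $1$: the gain per unit of $l$ in the
    logarithm of the divisor. *)
Definition ksum m : R :=
  \sum_(p < ((m.+1)./2).+1 | prime p) (minfloor m p)%:R * (ln (p%:R : R) / (p%:R - 1)).

(** The loss in [vmin_ge] at $n=l(N+1)$ is $\ln(n+1)$; the term $\ln p/(p-1)$ is regained from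
    $v_p(l!)\le(l-1)/(p-1)$. *)
Definition kloss m l : R :=
  \sum_(p < ((m.+1)./2).+1 | prime p)
     (ln (l%:R * (minfloor m p).+1%:R + 1) - ln (p%:R : R) / (p%:R - 1)).

Lemma ln_common_factor_ge m l : (0 < l)%N ->
  ln (l`!%:R : R) + l%:R * ksum m - kloss m l <= ln ((common_factor m l)%:R : R).
Proof.
move=> l0; rewrite /common_factor natrM lnM ?posrE ?ltr0n ?fact_gt0//; last first.
  by apply: prodn_cond_gt0 => p pp; rewrite expn_gt0 prime_gt0.
rewrite -addrA lerD2l natr_prod /ksum mulr_sumr /kloss -sumrB.
have lnprod (P : pred 'I_((m.+1)./2).+1) (F : 'I_((m.+1)./2).+1 -> R) : (forall i, P i -> 0 < F i) ->
    ln (\prod_(i | P i) F i) = \sum_(i | P i) ln (F i).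
  move=> F0; have [] : 0 < \prod_(i | P i) F i /\ ln (\prod_(i | P i) F i) = \sum_(i | P i) ln (F i).
    apply: (big_ind2 (fun x y => 0 < x /\ ln x = y)) => [|x y z w [x0 <-] [z0 <-]|i Pi].
    - by rewrite ln1.
    - by rewrite mulr_gt0// lnM.
    - by split; first exact: F0.
  by [].
rewrite lnprod; last by move=> p pp; rewrite ltr0n expn_gt0 prime_gt0.
apply: ler_sum => p pp; have p1 := prime_gt1 pp.
have L0 := ln_nat_prime _ pp; have P1 := natr_prime_gt1 _ pp.
rewrite natrX lnXn ?ltr0n ?prime_gt0// -[ln _ *+ _]mulr_natl.
set N := minfloor m p; set n := (l * N.+1)%N.
have h1 := @vmin_ge p n pp.
have h2 : (logn p l`!)%:R * ln (p%:R : R) <= (l%:R - 1) * (ln (p%:R : R) / (p%:R - 1)).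
  rewrite mulrA ler_pdivlMr// mulrAC; apply: ler_wpM2r; first exact: ltW.
  have := logn_fact_le p l pp l0; rewrite -(ler_nat R) natrM !natrB// ?(ltnW p1)//.
  by rewrite mulrC.
have h3 : ((vmin p n)%:R - (logn p l`!)%:R) * ln (p%:R : R) <= (vmin p n - logn p l`!)%:R * ln (p%:R : R).
  apply: ler_wpM2r; first exact: ltW.
  by rewrite lerBlDr -natrD ler_nat; lia.
apply: le_trans _ h3; rewrite mulrBl.
have NR : (N.+1%:R : R) = N%:R + 1 by rewrite natr1.
have nR : (n%:R : R) = l%:R * (N%:R + 1) by rewrite natrM NR.
by move: h1; rewrite nR NR; move: h2; set c := ln _ / _; lra.
Qed.
End CommonFactorSize.

(** * Size of the remainder and of the values of $F$ *)

Section Remainder.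
Variable R : realType.
Implicit Types (f g : {poly R}) (x s : R).

(** This replaces the integral $\int_0^x e^{x-y}f(y)\,dy$: the function $e^{-y}(F(y)-s)$ has
    derivative $e^{-y}(s-f(y))\ge0$. *)
Lemma sumder_remainder_le f x s : 0 <= x -> (forall y, 0 <= y <= x -> f.[y] <= s) ->
  expR x * (sumder R f).[0] - (sumder R f).[x] <= (expR x - 1) * s.
Proof.
move=> x0 fs; set F := sumder R f.
pose h (y : R) := expR (- y) * (F.[y] - s).
have dF y : is_derive y (1 : R) (fun z => F.[z]) F^`().[y] by exact: is_derive_poly.
have : h 0 <= h x.
  apply: (@is_derive_le R h (fun y => expR (- y) * (s - f.[y]))) => // y xy.
    have := dF y => dFy; rewrite /h; der; rewrite -[f in RHS](sumder_deriv R f) -/F !hornerE; ring.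
  by rewrite mulr_ge0 ?expR_ge0// subr_ge0 fs.
rewrite /h oppr0 expR0 mul1r expRN mulrC ler_pdivlMr ?expR_gt0//; lra.
Qed.

Lemma sumder_remainder f x s : 0 <= x -> (forall y, 0 <= y <= x -> `|f.[y]| <= s) ->
  `|expR x * (sumder R f).[0] - (sumder R f).[x]| <= (expR x - 1) * s.
Proof.
move=> x0 fs; rewrite ler_norml sumder_remainder_le// ?andbT; last first.
  by move=> y /fs; exact: le_trans (ler_norm _).
have := @sumder_remainder_le (- f) x s x0; rewrite raddfN /= !hornerN.
have h y : 0 <= y <= x -> (- f).[y] <= s.
  by move=> /fs; rewrite hornerN; apply: le_trans; rewrite -normrN ler_norm.
move=> /(_ h); lra.
Qed.

Lemma facT_linM g n (a : R) : (forall i, 0 <= g`_i) -> 0 <= a -> (size g <= n)%N ->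
  facT R (g * ('X + a%:P)) <= (n%:R + a) * facT R g.
Proof.
move=> g0 a0 gn; have facTE (h : {poly R}) k : (size h <= k)%N -> facT R h = \sum_(i < k) (i`!)%:R * h`_i.
  move=> hk; rewrite /facT -(subnKC hk) big_split_ord /= [X in _ = _ + X]big1 ?addr0// => i _.
  by rewrite nth_default ?mulr0// leq_addr.
have sz : (size (g * ('X + a%:P))%R <= n.+1)%N.
  by rewrite (leq_trans (size_polyMleq _ _))// size_XaddC addn2.
rewrite (facTE _ _ sz) (facTE _ _ gn) mulrDl.
under eq_bigr => i _ do rewrite mulrDr coefD coefMX coefMC mulrDr.
rewrite big_split; apply: lerD.
  rewrite big_ord_recl /= mulr0 add0r mulr_sumr; apply: ler_sum => i _.
  rewrite /= mulrA; apply: ler_wpM2r => //; rewrite factS natrM; apply: ler_wpM2r => //.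
  by rewrite ler_nat; exact: ltn_ord.
rewrite big_ord_recr /= nth_default// mul0r mulr0 addr0 mulr_sumr.
by rewrite le_eqVlt; apply/orP; left; apply/eqP; apply: eq_bigr => i _; ring.
Qed.

Lemma coef_prod_ge0 (c : nat -> R) n i : (forall i, 0 <= c i) ->
  0 <= (\prod_(i < n) ('X + (c i)%:P))`_i.
Proof.
move=> c0; elim: n i => [|n IH] i; first by rewrite big_ord0 coef1.
rewrite big_ord_recr /= mulrDr coefD coefMX coefMC addr_ge0 ?mulr_ge0//.
by case: ifP.
Qed.

Lemma facT_prod_ge0 (c : nat -> R) n : (forall i, 0 <= c i) ->
  0 <= facT R (\prod_(i < n) ('X + (c i)%:P)).
Proof. by move=> c0; apply: sumr_ge0 => i _; rewrite mulr_ge0// coef_prod_ge0. Qed.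

(** A new factor multiplies the functional by at most $n+1+c_n\le(n+1)e^{c_n/(n+1)}$. The order of
    the factors is free, and large constants cost less when placed late. *)
Lemma facT_prod_le (c : nat -> R) n : (forall i, 0 <= c i) ->
  facT R (\prod_(i < n) ('X + (c i)%:P)) <= n`!%:R * expR (\sum_(i < n) c i / i.+1%:R).
Proof.
move=> c0; elim: n => [|n IH].
  by rewrite !big_ord0 expR0 /facT size_poly1 big_ord1 coef1 !mulr1.
have sz : (size (\prod_(i < n) ('X + (c i)%:P))%R <= n.+1)%N.
  elim: (n) => [|k IHk]; first by rewrite big_ord0 size_poly1.
  by rewrite big_ord_recr (leq_trans (size_polyMleq _ _))//= size_XaddC addn2.
rewrite !big_ord_recr /=.
apply: le_trans (facT_linM _ _ _ (fun i => coef_prod_ge0 _ _ i c0) (c0 n) sz) _.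
rewrite expRD factS natrM mulrC.
apply: (@le_trans _ _ (n`!%:R * expR (\sum_(i < n) c i / i.+1%:R) * (n.+1%:R + c n))).
  by rewrite ler_wpM2r// addr_ge0.
set e := expR (\sum_(i < n) _).
have -> : n.+1%:R + c n = n.+1%:R * (1 + c n / n.+1%:R) by field; rewrite nat1r pnatr_eq0.
have -> (u v w y : R) : u * v * (w * (1 + y)) = w * u * (v * (1 + y)) by ring.
by rewrite ler_wpM2l ?mulr_ge0// ler_wpM2l ?expR_ge0// expR_ge1Dx.
Qed.
End Remainder.

(** * Non-vanishing of the main sum *)

Section NonVanishing.
Variable R : realType.
Implicit Types (f q : {poly R}) (m l : nat).

(** One monic polynomial of each degree: as a basis of the admissible $q$ any sequence [r] works,
    and it is chosen later to keep the sup norm on $[0,m]$ small. *)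
Definition rootpoly (A : nzRingType) (r : nat -> nat) (k : nat) : {poly A} :=
  \prod_(i < k) ('X - ((r i)%:R)%:P).

Lemma monic_rootpoly (A : nzRingType) r k : rootpoly A r k \is monic.
Proof. by apply: monic_prod => i _; exact: monicXsubC. Qed.

Lemma size_rootpoly r k : size (rootpoly R r k) = k.+1.
Proof.
rewrite /rootpoly size_prod => [|i _]; last by rewrite polyXsubC_eq0.
under eq_bigr => i _ do rewrite size_XsubC.
by rewrite big_const_ord iter_addn_0 card_ord mulnC -{2}[k]mul1n -{1}[k.+1]addn0; lia.
Qed.

Lemma size_nodes m : size (nodes R m) = m.+2.
Proof. exact: (size_rootpoly id m.+1). Qed.

(* [F - F' = f] and [F (c) = 0] propagate the order of vanishing of [f] at [c] to [F] *)
Lemma root_sumder_dvd f (c : R) l : ('X - c%:P) ^+ l %| f -> root (sumder R f) c ->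
  ('X - c%:P) ^+ l.+1 %| sumder R f.
Proof.
set F := sumder R f => hf hF; elim: l hf => [|l IH] hf; first by rewrite expr1 dvdp_XsubCl.
have /IH /dvdpP[G FE] : ('X - c%:P) ^+ l %| f by apply: dvdp_trans hf; rewrite dvdp_exp2l.
have hF' : ('X - c%:P) ^+ l.+1 %| F^`().
  have -> : F^`() = F - f by rewrite -[f in RHS](sumder_deriv R f) opprB addrC subrK.
  by rewrite dvdp_sub// FE dvdp_mull.
have : ('X - c%:P) ^+ l.+1 %| G * (('X - c%:P) ^+ l *+ l.+1).
  move: hF'; rewrite FE derivM deriv_exp derivXsubC mul1r /=.
  by rewrite dvdp_addr// dvdp_mull.
have X0 : ('X - c%:P) ^+ l != 0 by rewrite expf_neq0// polyXsubC_eq0.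
rewrite -scaler_nat -scalerAr scalerAl exprS dvdp_mul2r// dvdpZr ?pnatr_eq0//.
by move=> /dvdpP[G' GE]; rewrite FE GE exprS -mulrA dvdp_mull.
Qed.

Lemma rootpoly_id_exp_dvd n l f : (forall j, (j < n)%N -> ('X - (j%:R)%:P) ^+ l %| f) ->
  rootpoly R id n ^+ l %| f.
Proof.
elim: n => [|n IH] h; first by rewrite /rootpoly big_ord0 expr1n dvd1p.
rewrite /rootpoly big_ord_recr exprMn /= Gauss_dvdp; last first.
  apply/coprimep_expl/coprimep_expr; rewrite coprimep_XsubC rootE horner_prod.
  apply/prodf_neq0 => i _; rewrite hornerXsubC subr_eq0 eqr_nat.
  by rewrite gtn_eqF.
by rewrite h// andbT IH// => j jn; rewrite h// ltnW.
Qed.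

(** If $F$ vanishes at all nodes, it is divisible by the $(l+1)$-st power of the node polynomial, of
    degree $(m+1)(l+1)$, while $\deg F\le(m+1)l+m$. So $F=0$, hence $f=F-F'=0$. *)
Lemma sumder_nodes_inj m l q : (size q <= m.+1)%N ->
  (forall j, (j < m.+1)%N -> root (sumder R (nodes R m ^+ l * q)) j%:R) -> q = 0.
Proof.
set f := _ * q => sq h.
have n0 k : nodes R m ^+ k != 0.
  by rewrite expf_neq0// monic_neq0// (monic_rootpoly R id m.+1).
have d : nodes R m ^+ l.+1 %| sumder R f.
  apply: rootpoly_id_exp_dvd => j jm; apply: root_sumder_dvd; last exact: h.
  apply: dvdp_mulr; rewrite dvdp_exp2r//.
  by rewrite /nodes (bigD1 (Ordinal jm))//= dvdp_mulIl.
have szf : (size f < size (nodes R m ^+ l.+1))%N.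
  rewrite (leq_ltn_trans (size_polyMleq _ _))// exprS size_mul ?n0//; last by rewrite -(expr1 (nodes R m)).
  have : (0 < size (nodes R m ^+ l))%N by rewrite size_poly_gt0.
  rewrite size_nodes. case: (size (nodes R m ^+ l)) => // a _; move: (size q) sq => b; lia.
have szF : (size (sumder R f) <= size f)%N.
  rewrite /sumder (leq_trans (size_sum _ _ _))//; apply/bigmax_leqP => i _.
  elim: (i : nat) => // k; rewrite derivnS; apply: leq_trans.
  have [->|gn0] := eqVneq f^`(k) 0; first by rewrite linear0.
  exact: ltnW (lt_size_deriv gn0).
have F0 : sumder R f = 0.
  apply/eqP; apply: contraTT d => F0; apply/negP => /(dvdp_leq F0).
  by rewrite leqNgt (leq_ltn_trans szF szf).
have : f = 0 by rewrite -(sumder_deriv R f) F0 deriv0 subr0.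
by move/eqP; rewrite mulf_eq0 (negPf (n0 l)) => /eqP.
Qed.

(** Otherwise the matrix of the values $F_k(j)$ is singular; a relation between its rows gives a
    combination $q$ of the basis whose $F$ vanishes at all nodes, so $q=0$, against linear
    independence. *)
Lemma sumder_nodes_nonvanishing m l (r : nat -> nat) (lam : 'I_m.+1 -> R) :
  (exists j, lam j != 0) ->
  exists k : 'I_m.+1,
    \sum_(j < m.+1) lam j * (sumder R (nodes R m ^+ l * rootpoly R r k)).[j%:R] != 0.
Proof.
move=> [j0 lj0]; apply: contrapT => /forallNP h.
pose A : 'M[R]_m.+1 := \matrix_(k, j) (sumder R (nodes R m ^+ l * rootpoly R r k)).[j%:R].
pose v : 'rV[R]_m.+1 := \row_j lam j.
have vA : v *m A^T = 0.
  apply/rowP => k; rewrite !mxE.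
  under eq_bigr => j _ do rewrite !mxE.
  by apply: contrapT => /eqP; apply: h.
have : \det A == 0.
  rewrite -det_tr; apply/det0P; exists v => //.
  by apply/eqP => /rowP /(_ j0); rewrite !mxE => /eqP; rewrite (negPf lj0).
move=> /det0P[w w0 wA]; move/negP: w0; apply.
pose q := \sum_(k < m.+1) w 0 k *: rootpoly R r k.
have q0 : q = 0.
  apply: (@sumder_nodes_inj m l).
    rewrite (leq_trans (size_sum _ _ _))//; apply/bigmax_leqP => i _.
    by rewrite (leq_trans (size_scale_leq _ _))// size_rootpoly; exact: ltn_ord.
  move=> j jm; move/rowP: wA => /(_ (Ordinal jm)); rewrite !mxE => wA.
  rewrite rootE /q mulr_sumr linear_sum horner_sum /=; apply/eqP.
  rewrite -[RHS]wA; apply: eq_bigr => k _.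
  by rewrite -scalerAr linearZ /= hornerZ mxE.
apply/eqP/rowP => k; rewrite mxE.
(* The coefficients are eliminated from the top degree downwards: the coefficient of $X^k$ involves
   only [w] at indices at least $k$. *)
have [n] := ubnP (m - k); elim: n k => // n IH k kn.
have : q`_k = 0 by rewrite q0 coef0.
rewrite /q coef_sum (bigD1 k)//= coefZ.
have -> : (rootpoly R r k)`_k = 1.
  by have /eqP := monic_rootpoly R r k; rewrite lead_coefE size_rootpoly.
rewrite mulr1 big1 ?addr0// => i ik; rewrite coefZ.
case: (ltngtP i k) => [ltik|gtik|eqik].
- by rewrite nth_default ?mulr0// size_rootpoly.
- by rewrite IH ?mul0r//; have := ltn_ord i; lia.
- by move/eqP: ik => []; apply: val_inj.
Qed.
End NonVanishing.

(** * From integer polynomials to a lower bound for the linear form *)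

Section Transfer.
Variable R : realType.
Implicit Types (m l : nat) (r : nat -> nat).

Lemma map_sumder (f : {poly int}) :
  map_poly intr (sumder int f) = sumder R (map_poly intr f).
Proof.
rewrite /sumder rmorph_sum /= size_map_inj_poly//; last exact: intr_inj.
by apply: eq_bigr => i _; rewrite derivn_map.
Qed.

Lemma map_nodes_rootpoly m l r k :
  map_poly intr (nodes int m ^+ l * rootpoly int r k) = nodes R m ^+ l * rootpoly R r k.
Proof.
have h n (s : nat -> nat) : map_poly (intr : int -> R) (rootpoly int s n) = rootpoly R s n.
  rewrite /rootpoly rmorph_prod; apply: eq_bigr => i _.
  by rewrite rmorphB /= map_polyX map_polyC /= rmorph_nat.
by rewrite rmorphM rmorphXn /= h (h m.+1 id).
Qed.

Lemma sumder_nodes_int m l r k (j : nat) :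
  (sumder R (nodes R m ^+ l * rootpoly R r k)).[j%:R] =
  ((sumder int (nodes int m ^+ l * rootpoly int r k)).[j%:Z])%:~R.
Proof.
rewrite -map_nodes_rootpoly -map_sumder -(rmorph_nat (intr : int -> R)) horner_map /= natz //.
Qed.

Lemma nodes_shift_max m :
  nodes R m \Po ('X + m%:R%:P) = \prod_(j < m.+1) ('X + j%:R%:P).
Proof.
rewrite /nodes rmorph_prod [LHS](reindex_inj rev_ord_inj) /=; apply: eq_bigr => j _.
rewrite rmorphB /= comp_polyX comp_polyC -addrA -polyCB subSS natrB; last by rewrite -ltnS.
by congr ('X + _%:P); ring.
Qed.

Lemma prod_div_exp m l : (0 < l)%N ->
  \prod_(i < m * l) ('X + ((i %/ l)%:R : R)%:P) = (\prod_(j < m) ('X + j%:R%:P)) ^+ l.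
Proof.
move=> l0; elim: m => [|m IH]; first by rewrite mul0n !big_ord0 expr1n.
rewrite mulSn addnC big_split_ord /= IH big_ord_recr exprMn; congr (_ * _).
rewrite -[l in RHS]card_ord -prodr_const; apply: eq_bigr => i _.
by rewrite divnMDl// divn_small// addn0.
Qed.

(** At the right end $m$ all shifted factors $X+c$ have $c\ge0$. Sorted by $c$, the first $l$ have
    $c=0$ and the others satisfy $c_i/(i+1)\le1/l$, so the exponent in [facT_prod_le] is at most
    $(ml+k)/l$. *)
Lemma sumder_at_max m l r k : (0 < l)%N -> (k <= m)%N -> (forall i, (r i <= m)%N) ->
  `|(sumder R (nodes R m ^+ l * rootpoly R r k)).[m%:R]| <=
  (m.+1 * l + m)`!%:R * expR (m%:R + m%:R / l%:R).
Proof.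
move=> l0 km rm; pose n := (m.+1 * l)%N.
pose c (i : nat) : R := if (i < n)%N then (i %/ l)%:R else (m - r (i - n)%N)%:R.
have -> : (sumder R (nodes R m ^+ l * rootpoly R r k)).[m%:R] =
    facT R (\prod_(i < n + k) ('X + (c i)%:P)).
  rewrite sumder_horner rmorphM rmorphXn /= nodes_shift_max -prod_div_exp//.
  rewrite [in RHS]big_split_ord /=; congr (facT R _); congr (_ * _).
    by apply: eq_bigr => i _; rewrite /c ltn_ord.
  rewrite /rootpoly rmorph_prod; apply: eq_bigr => i _.
  rewrite rmorphB /= comp_polyX comp_polyC -addrA -polyCB /c ifF; last by lia.
  by rewrite addKn natrB.
have l1 : 0 < (l%:R : R) by rewrite ltr0n.
have c0 i : 0 <= c i by rewrite /c; case: ifP.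
rewrite ger0_norm; last exact: facT_prod_ge0.
apply: le_trans (facT_prod_le _ _ _ c0) _.
apply: ler_pM => //.
  by rewrite ler_nat; apply: dvdn_leq; rewrite ?fact_gt0// dvd_fact// leq_add2l.
rewrite ler_expR.
have ci (i : nat) : c i / i.+1%:R <= if (i < l)%N then 0 else l%:R^-1.
  rewrite /c; case: ltnP => i_n.
    case: ltnP => il; first by rewrite divn_small// mul0r.
    rewrite ler_pdivrMr ?ltr0n// ler_pdivlMl// -natrM ler_nat.
    by have := leq_trunc_div i l; lia.
  rewrite ifF; last by move: i_n; rewrite /n; nia.
  by rewrite ler_pdivrMr ?ltr0n// ler_pdivlMl// -natrM ler_nat; move: i_n; rewrite /n; nia.
apply: (@le_trans _ _ (\sum_(i < n + k) if (i < l)%N then 0 else (l%:R^-1 : R))).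
  by apply: ler_sum => i _; exact: ci.
have -> : (n + k = l + (m * l + k))%N by rewrite /n; lia.
rewrite big_split_ord /= big1 ?add0r => [|i _]; last by rewrite ltn_ord.
rewrite (eq_bigr (fun=> l%:R^-1)) => [|i _]; last by rewrite ltnNge leq_addr.
rewrite sumr_const card_ord -[_ *+ (_ + _)]mulr_natl natrD natrM mulrDl mulfK ?gt_eqF// lerD2l.
by apply: ler_wpM2r; [rewrite invr_ge0 ltW|rewrite ler_nat].
Qed.

(* The constant in front of [H] in the remainder [\sum_(0 < j <= m) |lam j| |e^j F(0) - F(j)|]. *)
Definition rem_const m : R := \sum_(j < m.+1) (expR j%:R - 1).

(** $F(0)$ is estimated through $F(m)$: since $e^mF(0)-F(m)$ is small, the factor $e^m$ in
    [sumder_at_max] cancels. The condition on the divisor leaves at least half of it after the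
    remainder is removed. *)
Lemma linear_form_ge m l r (H mu nu : R) (lam : 'I_m.+1 -> int) :
  (0 < l)%N -> (forall i, (r i <= m)%N) -> 0 <= mu -> 0 <= nu ->
  (forall x, 0 <= x <= m%:R -> `|(nodes R m).[x]| <= mu) ->
  (forall x k, 0 <= x <= m%:R -> (k <= m)%N -> `|(rootpoly R r k).[x]| <= nu) ->
  0 <= H -> 2 * (H * rem_const m * (mu ^+ l * nu)) <= (common_factor m l)%:R ->
  (exists i, lam i != 0) ->
  (forall i : 'I_m.+1, (0 < i)%N -> (`|lam i|%:~R : R) <= H) ->
  (common_factor m l)%:R <=
    2 * `|\sum_(i < m.+1) (lam i)%:~R * euler R ^+ i| *
      ((m.+1 * l + m)`!%:R * expR (m%:R / l%:R) + mu ^+ l * nu).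
Proof.
move=> l0 rm mu0 nu0 hmu hnu H0 hD [i0 li0] lamH.
set Lam := \sum_(i < _) _; set s := mu ^+ l * nu; set D := (common_factor m l)%:R.
have [] := @sumder_nodes_nonvanishing R m l r (fun i => (lam i)%:~R).
  by exists i0; rewrite intr_eq0.
move=> k; set f := _ * rootpoly R r k; set F := sumder R f => Sn0.
have km : (k <= m)%N by rewrite -ltnS.
have s0 : 0 <= s by rewrite mulr_ge0 ?exprn_ge0.
have fs x : 0 <= x <= m%:R -> `|f.[x]| <= s.
  move=> xm; rewrite /f hornerM horner_exp normrM normrX.
  apply: ler_pM; rewrite ?exprn_ge0 ?normr_ge0 ?hnu//.
  by apply: lerXn2r; rewrite ?nnegrE ?normr_ge0 ?hmu.
have rem (j : 'I_m.+1) : `|expR j%:R * F.[0] - F.[j%:R]| <= (expR j%:R - 1) * s.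
  apply: sumder_remainder => // y /andP[y0 yj]; apply: fs; rewrite y0 (le_trans yj)//.
  by rewrite ler_nat -ltnS.
pose z := \sum_(j < m.+1) lam j * (sumder int (nodes int m ^+ l * rootpoly int r k)).[(j : nat)%:Z].
have zE : \sum_(j < m.+1) (lam j)%:~R * F.[j%:R] = z%:~R.
  rewrite /z rmorph_sum; apply: eq_bigr => j _.
  by rewrite rmorphM /= -sumder_nodes_int.
have Dz : D <= `|\sum_(j < m.+1) (lam j)%:~R * F.[j%:R]|.
  rewrite zE -intr_norm -[D]/((common_factor m l)%:~R) ler_int.
  have z0 : z != 0 by move: Sn0; rewrite zE intr_eq0.
  have : ((common_factor m l)%:Z %| z)%Z.
    rewrite /z; apply: rpred_sum => j _; apply: dvdz_mull; apply: dvd_sumder_nodes.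
    by rewrite -ltnS.
  rewrite dvdzE /= => /dvdn_leq; rewrite absz_gt0 z0 => /(_ isT).
  by rewrite -lez_nat abszE.
have eulerX (j : nat) : euler R ^+ j = expR j%:R by rewrite /euler -expRM_natl mulr1.
have SE : \sum_(j < m.+1) (lam j)%:~R * F.[j%:R] =
    Lam * F.[0] - \sum_(j < m.+1) (lam j)%:~R * (expR j%:R * F.[0] - F.[j%:R]).
  by rewrite /Lam mulr_suml -sumrB; apply: eq_bigr => j _; rewrite eulerX; ring.
have remS : `|\sum_(j < m.+1) (lam j)%:~R * (expR j%:R * F.[0] - F.[j%:R])| <= H * rem_const m * s.
  apply: le_trans (ler_norm_sum _ _ _) _; rewrite /rem_const mulr_sumr mulr_suml.
  apply: ler_sum => j _; rewrite normrM -mulrA.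
  (* The term $j=0$ vanishes because $e^0F(0)=F(0)$; this is why only $\lambda_1,\dots,\lambda_m$
     are bounded by $H$. *)
  have [j0|j0] := posnP j.
    by rewrite j0 expR0 mul1r subrr normr0 mulr0 subrr mul0r mulr0.
  apply: ler_pM; [exact: normr_ge0|exact: normr_ge0| |exact: rem].
  by rewrite -intr_norm lamH.
have F0 : `|F.[0]| <= (m.+1 * l + m)`!%:R * expR (m%:R / l%:R) + s.
  have Fm : `|F.[m%:R]| <= (m.+1 * l + m)`!%:R * expR (m%:R + m%:R / l%:R).
    exact: sumder_at_max.
  have em := expR_gt0 (m%:R : R).
  have := rem ord_max; rewrite /= => rm'.
  rewrite -(ler_pM2l em); apply: (@le_trans _ _ (`|expR m%:R * F.[0]|)).
    by rewrite normrM (ger0_norm (ltW em)).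
  apply: (@le_trans _ _ (`|expR m%:R * F.[0] - F.[m%:R]| + `|F.[m%:R]|)).
    by rewrite -{1}(subrK F.[m%:R] (_ * _)) ler_normD.
  apply: (le_trans (lerD rm' Fm)); rewrite expRD mulrDr.
  have : 0 <= s by [].
  lra.
have := le_trans Dz _ ; rewrite SE => /(_ _ (ler_normB _ _)).
rewrite normrM => h.
have := ler_wpM2l (normr_ge0 Lam) F0.
by move: h remS hD; rewrite -/s -/D; lra.
Qed.
End Transfer.

(** * Explicit Stirling and harmonic bounds *)

Section Stirling.
Variable R : realType.
Implicit Types (n l m : nat) (x : R).

(** With $z=1/(2n+1)$ the middle term is $\frac{1}{2z}\ln\frac{1+z}{1-z}$; one term of the series
    and its remainder give $1$ and $1+\frac1{12n(n+1)}$. *)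
Lemma ln_succ_bounds n : (0 < n)%N ->
  1 <= (n%:R + 1 / 2) * (ln n.+1%:R - ln n%:R : R) <= 1 + (n%:R^-1 - n.+1%:R^-1) / 12.
Proof.
move=> n0; pose z : R := (2 * n%:R + 1)^-1.
have N0 : 0 < (n%:R : R) by rewrite ltr0n.
have N1 : 0 < (2 * n%:R + 1 : R) by lra.
have z0 : 0 < z by rewrite invr_gt0.
have z1 : z < 1 by rewrite invf_lt1//; lra.
have z01 : 0 <= z < 1 by rewrite z1 ltW.
have lnE : ln n.+1%:R - ln n%:R = ln (1 + z) - ln (1 - z) :> R.
  have p1 : 0 < 1 - z by rewrite subr_gt0.
  have p2 : 0 < 1 + z by rewrite addr_gt0.
  rewrite -!ln_div ?posrE ?ltr0n//; congr ln; rewrite -natr1 /z.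
  by field; rewrite !gt_eqF//; lra.
have hz : (n%:R + 1 / 2 : R) = (2 * z)^-1 by rewrite /z; field; rewrite gt_eqF.
have l1 := ln_ge_atanh R 1 z z01; have l2 := ln_le_atanh R 1 z z01.
rewrite lnE hz; move: l1 l2; rewrite /atanh_sum big_ord1 muln0 add0n divr1 expr1 /=.
move=> l1 l2; have z2 : 0 < 2 * z by rewrite mulr_gt0.
rewrite ler_pdivlMl// mulr1 l1 /= ler_pdivrMl//; apply: (le_trans l2).
rewrite le_eqVlt; apply/orP; left; apply/eqP; rewrite /z -natr1; field.
by rewrite !gt_eqF//; nra.
Qed.

(** The constants enclose $\frac12\ln 2\pi\approx0.919$. The induction starts from $n=1$ with
    constant $1$ and loses at most $1/12$ in total. *)
Lemma ln_fact_bounds n : (0 < n)%N ->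
  n%:R * ln n%:R - n%:R + ln n%:R / 2 + 9 / 10 <= ln (n`!%:R : R) <=
  n%:R * ln n%:R - n%:R + ln n%:R / 2 + 1.
Proof.
move=> n0; have : n%:R * ln n%:R - n%:R + ln n%:R / 2 + 1 - (1 - n%:R^-1) / 12 <= ln (n`!%:R : R) <=
  n%:R * ln n%:R - n%:R + ln n%:R / 2 + 1.
  elim: n n0 => // -[_ _|n IH _]; first by rewrite factS fact0 muln1 ln1 invr1; apply/andP; split; lra.
  have := IH isT; have := @ln_succ_bounds n.+1 isT.
  rewrite (factS n.+1) natrM lnM ?posrE ?ltr0n ?fact_gt0//.
  rewrite -[n.+2%:R]natr1; set N : R := n.+1%:R; set A := ln (N + 1); set B := ln N.
  move: N^-1 (N + 1)^-1 => r1 r2.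
  by move=> /andP[h1 h2] /andP[h3 h4]; apply/andP; split; lra.
have : 0 < (n%:R^-1 : R) by rewrite invr_gt0 ltr0n.
by move=> ? /andP[? ?]; apply/andP; split; lra.
Qed.

Definition harmonic_sum n : R := \sum_(i < n) i.+1%:R^-1.

Lemma harmonic_ge n : (0 < n)%N -> ln n%:R + 1 / 2 <= harmonic_sum n.
Proof.
(* Adding the trapezoidal correction $1/(2n)$ makes the statement inductive, with equality at
   $n=1$. *)
move=> n0; have : ln n%:R + 1 / 2 + n%:R^-1 / 2 <= harmonic_sum n.
  elim: n n0 => // -[_ _|n IH _].
    by rewrite ln1 invr1 /harmonic_sum big_ord1 invr1; lra.
  have := IH isT; rewrite /harmonic_sum [X in _ -> _ <= X]big_ord_recr /=.
  have /andP[_] := @ln_succ_bounds n.+1 isT.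
  rewrite -[n.+2%:R]natr1; set N : R := n.+1%:R; set A := ln (N + 1); set B := ln N.
  have N0 : 0 < N by rewrite ltr0n.
  have q0 : 0 < (N * (N + 1))^-1 by rewrite invr_gt0 mulr_gt0//; lra.
  have e1 : N^-1 - (N + 1)^-1 = (N * (N + 1))^-1 by field; rewrite !gt_eqF//; lra.
  have e2 : N^-1 + (N + 1)^-1 = 2 * ((N + 1 / 2) * (N * (N + 1))^-1).
    by field; rewrite !gt_eqF//; lra.
  have e3 : (N + 1 / 2) * ((N + 1 / 2) * (N * (N + 1))^-1) = 1 + (N * (N + 1))^-1 / 4.
    by field; rewrite !gt_eqF//; lra.
  rewrite e1 => h ih; have : A - B <= (N + 1 / 2) * (N * (N + 1))^-1.
    rewrite -(ler_pM2l (_ : 0 < N + 1 / 2)); last by lra.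
    by rewrite e3; apply: (le_trans h); move: q0; move: (N * (N + 1))^-1 => q; lra.
  move: ih e2; move: N^-1 (N + 1)^-1 (N * (N + 1))^-1 ((N + 1 / 2) * _) => r1 r2 q y; lra.
by apply: le_trans; rewrite lerDl divr_ge0.
Qed.

End Stirling.

(** * Sup norms of the auxiliary polynomials on $[0,m]$ *)

Section SupNorm.
Variable R : realType.
Implicit Types (m : nat) (x : R).

Lemma horner_nodes m x : (nodes R m).[x] = \prod_(j < m.+1) (x - j%:R).
Proof. by rewrite horner_prod; apply: eq_bigr => j _; rewrite hornerXsubC. Qed.

Lemma nodes_shift1 m x : x * (nodes R m).[x - 1] = (nodes R m).[x] * (x - m.+1%:R).
Proof.
rewrite !horner_nodes [in RHS]big_ord_recl subr0 -mulrA; congr (_ * _).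
rewrite big_ord_recr /=; congr (_ * _); last by rewrite -natr1; ring.
by apply: eq_bigr => j _; rewrite /bump /= add1n -natr1; ring.
Qed.

Lemma nodes_sym m x : `|(nodes R m).[m%:R - x]| = `|(nodes R m).[x]|.
Proof.
rewrite !horner_nodes !normr_prod [LHS](reindex_inj rev_ord_inj) /=.
apply: eq_bigr => j _; rewrite subSS natrB; last by rewrite -ltnS.
by rewrite distrC; congr `|_|; ring.
Qed.

(** Moving from $x-1$ to $x$ multiplies the absolute value by $x/(m+1-x)$, at most $1$ up to the
    middle $(m+1)/2$; so everything reduces to $[0,1]$, and symmetry covers the right half. *)
Lemma nodes_norm_le m (B : R) : (0 < m)%N ->
  (forall x, 0 <= x <= 1 -> `|(nodes R m).[x]| <= B) ->
  forall x, 0 <= x <= m%:R -> `|(nodes R m).[x]| <= B.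
Proof.
move=> m0 hB; have half x : 0 <= x <= (m%:R + 1) / 2 -> `|(nodes R m).[x]| <= B.
  move=> /andP[x0 xm]; have [n] : exists n, x <= n.+1%:R.
    by exists (Num.truncn x); exact/ltW/truncnS_gt.
  elim: n x x0 xm => [|n IH] x x0 xm xn; first by apply: hB; rewrite x0.
  have [x1|x1] := leP x 1; first by apply: hB; rewrite x0.
  have xp : 0 < x by lra.
  have mR : 0 <= m%:R :> R by [].
  have h : `|(nodes R m).[x - 1]| <= B by apply: IH; move: xn; rewrite -natr1; lra.
  have d0 : 0 <= m.+1%:R - x by rewrite -natr1; lra.
  have e : x * `|(nodes R m).[x - 1]| = `|(nodes R m).[x]| * (m.+1%:R - x).
    have -> : x * `|(nodes R m).[x - 1]| = `|x * (nodes R m).[x - 1]|.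
      by rewrite normrM (gtr0_norm xp).
    by rewrite nodes_shift1 normrM -[in LHS](opprB _ x) normrN (ger0_norm d0).
  apply: (le_trans _ h); rewrite -(ler_pM2l xp) e mulrC ler_wpM2l//.
  by rewrite -natr1; lra.
move=> x /andP[x0 xm]; have [h|h] := leP x (m%:R / 2).
  by apply: half; rewrite x0 /=; lra.
by rewrite -nodes_sym; apply: half; apply/andP; split; lra.
Qed.

Definition nodes_bound m : R := m`!%:R * expR (- 1) / (ln m%:R + 1 / 2).

(** On $[0,1]$ the factors $1-x/i\le e^{-x/i}$ give the bound $m!\,x\,e^{-xH}$ with $H$ the harmonic
    sum, and $ye^{-y}\le e^{-1}$ at $y=xH$. *)
Lemma nodes_norm_le_bound m x : (0 < m)%N -> 0 <= x <= m%:R ->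
  `|(nodes R m).[x]| <= nodes_bound m.
Proof.
move=> m0; apply: nodes_norm_le => // {}x /andP[x0 x1].
have lm : 0 <= ln (m%:R : R) by rewrite ln_ge0// ler1n.
have c0 : 0 < ln (m%:R : R) + 1 / 2 by lra.
have hH := @harmonic_ge R m m0; set H := harmonic_sum R m in hH.
have p1 : `|(nodes R m).[x]| <= x * (m`!%:R * expR (- (x * H))).
  rewrite horner_nodes big_ord_recl subr0 normrM (ger0_norm x0) ler_wpM2l//.
  rewrite /H /harmonic_sum mulr_sumr -sumrN expR_sum normr_prod.
  have -> : m`! = (\prod_(i < m) i.+1)%N.
    by rewrite fact_prod big_add1 big_mkord.
  rewrite natr_prod -big_split; apply: ler_prod => i _; rewrite normr_ge0 /=.
  rewrite /bump /= add1n -normrN opprB ger0_norm; last by rewrite subr_ge0 (le_trans x1)// ler1n.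
  have -> : i.+1%:R - x = i.+1%:R * (1 + - (x / i.+1%:R)) by field; rewrite nat1r pnatr_eq0.
  by rewrite ler_wpM2l// expR_ge1Dx.
apply: (le_trans p1); rewrite /nodes_bound ler_pdivlMr//.
have h1 : x * H <= expR (x * H - 1) by have := expR_ge1Dx (x * H - 1); lra.
have h2 : x * H * expR (- (x * H)) <= expR (- 1).
  apply: le_trans (ler_wpM2r (expR_ge0 _) h1) _.
  by rewrite -expRD; rewrite (_ : x * H - 1 - x * H = - 1)//; ring.
have -> : x * (m`!%:R * expR (- (x * H))) * (ln m%:R + 1 / 2) =
   m`!%:R * (x * (ln m%:R + 1 / 2) * expR (- (x * H))) by ring.
rewrite ler_wpM2l//; apply: le_trans _ h2; rewrite ler_wpM2r ?expR_ge0// ler_wpM2l//.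
Qed.

Lemma ln_nodes_bound_le m : (0 < m)%N ->
  ln (nodes_bound m) <= m%:R * ln m%:R - m%:R + ln m%:R / 2 - ln (ln m%:R + 1 / 2).
Proof.
move=> m0; have lm : 0 <= ln (m%:R : R) by rewrite ln_ge0// ler1n.
have c0 : 0 < ln (m%:R : R) + 1 / 2 by lra.
have f0 : 0 < (m`!%:R : R) by rewrite ltr0n fact_gt0.
rewrite /nodes_bound ln_div ?posrE ?mulr_gt0 ?expR_gt0//.
rewrite lnM ?posrE ?expR_gt0// expRK.
have /andP[_] := @ln_fact_bounds R m m0; lra.
Qed.

Lemma nodes_bound_gt0 m : (0 < m)%N -> 0 < nodes_bound m.
Proof.
move=> m0; have lm : 0 <= ln (m%:R : R) by rewrite ln_ge0// ler1n.
by rewrite divr_gt0 ?mulr_gt0 ?expR_gt0 ?ltr0n ?fact_gt0//; lra.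
Qed.

Lemma rootpoly_norm_le m k x : 0 <= x <= m%:R -> (k <= m)%N -> (0 < m)%N ->
  `|(rootpoly R (fun=> 0%N) k).[x]| <= m%:R ^+ m.
Proof.
move=> /andP[x0 xm] km m0; rewrite horner_prod normr_prod.
under eq_bigr => i _ do rewrite hornerXsubC subr0 ger0_norm//.
rewrite prodr_const card_ord; apply: (@le_trans _ _ (m%:R ^+ k)).
  by rewrite lerXn2r// ?nnegrE.
by rewrite ler_weXn2l// ler1n.
Qed.

Lemma nodes2_norm_le x : 0 <= x <= 2 -> `|(nodes R 2).[x]| <= 39 / 100.
Proof.
move=> /andP[x0 x2]; rewrite horner_nodes !big_ord_recr big_ord0 /= mul1r subr0.
(* The maximum $2/(3\sqrt3)\approx0.385$ is at $1/\sqrt3\approx0.577$, the near double root used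
   below; the third root is near $-1.154$. *)
have q (y : R) : -1 <= y <= 1 -> y - y ^+ 3 <= 39 / 100.
  move=> /andP[y1 y2]; have h : 0 <= y + 1154 / 1000 by lra.
  have := mulr_ge0 (sqr_ge0 (y - 577 / 1000)) h; nra.
have e : x * (x - 1) * (x - 2) = - ((x - 1) - (x - 1) ^+ 3) by ring.
rewrite e normrN ler_norml; apply/andP; split; last by apply: q; lra.
have := q (1 - x); have -> : 1 - x - (1 - x) ^+ 3 = - ((x - 1) - (x - 1) ^+ 3) by ring.
have h : -1 <= 1 - x <= 1 by lra.
by move=> /(_ h); rewrite lerNl.
Qed.

Lemma rootpoly2_norm_le k x : 0 <= x <= 2 -> `|(rootpoly R (fun=> 1%N) k).[x]| <= 1.
Proof.
move=> /andP[x0 x2]; rewrite horner_prod normr_prod.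
under eq_bigr => i _ do rewrite hornerXsubC.
by rewrite prodr_const card_ord exprn_ile1// ler_norml; lra.
Qed.

Lemma nodes3_norm_le x : 0 <= x <= 3 -> `|(nodes R 3).[x]| <= 1.
Proof.
move=> /andP[x0 x3]; rewrite horner_nodes !big_ord_recr big_ord0 /= mul1r subr0.
have -> : x * (x - 1) * (x - 2) * (x - 3) = (x ^+ 2 - 3 * x + 1) ^+ 2 - 1 by ring.
have h1 : - (5 / 4) <= x ^+ 2 - 3 * x + 1 by have := sqr_ge0 (x - 3 / 2); lra.
have h2 : x ^+ 2 - 3 * x + 1 <= 1.
  have : 0 <= x * (3 - x) by rewrite mulr_ge0//; lra.
  lra.
move: (x ^+ 2 - 3 * x + 1) h1 h2 => w h1 h2.
have : 0 <= (w + 5 / 4) * (5 / 4 - w) by rewrite mulr_ge0//; lra.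
by have := sqr_ge0 w; rewrite ler_norml; lra.
Qed.

(** The roots $2,0,2$ keep $1$, $X-2$, $X(X-2)$ and $X(X-2)^2$ within $3$ on $[0,3]$. *)
Definition roots3 (i : nat) : nat := if i == 1%N then 0%N else 2%N.

Lemma rootpoly3_norm_le k x : 0 <= x <= 3 -> (k <= 3)%N -> `|(rootpoly R roots3 k).[x]| <= 3.
Proof.
move=> /andP[x0 x3]; rewrite horner_prod.
under eq_bigr => i _ do rewrite hornerXsubC.
case: k => [|[|[|[|//]]]] _; rewrite ?big_ord_recr big_ord0 /= /roots3 /=.
- by rewrite normr1; lra.
- by rewrite mul1r ler_norml; lra.
- rewrite mul1r subr0 ler_norml.
  have h1 : 0 <= x * (3 - x) by rewrite mulr_ge0//; lra.
  have := sqr_ge0 (x - 1); lra.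
rewrite mul1r subr0 ler_norml.
have h1 : 0 <= x * (x - 2) ^+ 2 by rewrite mulr_ge0 ?sqr_ge0.
have h2 : 0 <= (3 - x) * ((x - 1 / 2) ^+ 2 + 3 / 4).
  by apply: mulr_ge0; [lra|apply: addr_ge0; [exact: sqr_ge0|lra]].
have e : x * (x - 2) ^+ 2 = 3 - (3 - x) * ((x - 1 / 2) ^+ 2 + 3 / 4) by field.
lra.
Qed.

Lemma nodes4_norm_le x : 0 <= x <= 4 -> `|(nodes R 4).[x]| <= 37 / 10.
Proof.
move=> /andP[x0 x4]; rewrite horner_nodes !big_ord_recr big_ord0 /= mul1r subr0.
have q (z : R) : -2 <= z <= 2 -> z ^+ 5 - 5 * z ^+ 3 + 4 * z <= 37 / 10.
  move=> /andP[z1 z2].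
  (* The maximum lies near $z=-1.644$; this cubic is the rounded quotient of the difference of both
     sides by $(z+1.644)^2$. *)
  have h : 0 <= - z ^+ 3 + 329 / 100 * z ^+ 2 - 311 / 100 * z + 135 / 100.
    have [z0|z0] := leP z (11 / 10).
      have := mulr_ge0 (_ : 0 <= 2 - z) (sqr_ge0 (z - 645 / 1000)); nra.
    have h1 : 0 <= (z - 11 / 10) * (2 - z) by rewrite mulr_ge0//; lra.
    have := mulr_ge0 h1 (_ : 0 <= z - 19 / 100); lra.
  have := mulr_ge0 (sqr_ge0 (z + 1644 / 1000)) h; nra.
have e : x * (x - 1) * (x - 2) * (x - 3) * (x - 4) =
  (x - 2) ^+ 5 - 5 * (x - 2) ^+ 3 + 4 * (x - 2) by ring.
rewrite e ler_norml; apply/andP; split; last by apply: q; lra.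
have := q (2 - x); have -> : (2 - x) ^+ 5 - 5 * (2 - x) ^+ 3 + 4 * (2 - x) =
  - ((x - 2) ^+ 5 - 5 * (x - 2) ^+ 3 + 4 * (x - 2)) by ring.
have h : -2 <= 2 - x <= 2 by lra.
by move=> /(_ h); rewrite lerNl.
Qed.
End SupNorm.

(** * The choice of $l$ and the resulting inequality in $\ln H$ *)

Section Optimization.
Variable R : realType.
Implicit Types (l m n : nat) (a b c w h : R).

Lemma ln_le_tangent (x y : R) : 0 < x -> 0 < y -> ln y <= ln x + (y / x - 1).
Proof.
move=> x0 y0; rewrite -lerBlDl -ln_div//.
by rewrite -[X in ln X](subrKC 1) le_ln1Dx// ltrBrDr addrC subrr divr_gt0.
Qed.

(* [v = h / l] turns the goal into an inequality between [v] and [ln v], monotone from [v1] on. *)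
Lemma optimization (l h a b beta eps eta v1 : R) :
  0 < l -> 0 < h -> 0 < ln h -> l * (ln l - a) <= h + eps * l ->
  0 < v1 -> v1 + ln v1 <= ln h - a - eps -> 0 < b + eta ->
  (b + eta) * (a + eps + ln v1) < (beta - b - eta) * v1 ->
  b + eta <= (beta - b - eta) * v1 ->
  (b + eta) * l < beta * h / ln h.
Proof.
move=> l0 h0 L0 hl v10 hv1 be0 h1 h2; pose v := h / l.
have v0 : 0 < v by rewrite divr_gt0.
have hE : h = v * l by rewrite /v divfK// gt_eqF.
have LE : ln h = ln v + ln l by rewrite hE lnM.
have lb : ln l - a <= v + eps.
  by rewrite -(ler_pM2l l0) (le_trans hl)// hE; lra.
have vv1 : v1 <= v.
  have [//|vv] := leP v1 v; have : ln v < ln v1 by rewrite ltr_ln.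
  lra.
(* Replacing $\ln v$ by its tangent at [v1] makes both sides affine in $v$: one hypothesis compares
   them at [v1], the other compares their slopes. *)
have t := @ln_le_tangent v1 v v10 v0.
have key : (b + eta) * (a + eps + ln v1 + (v / v1 - 1)) < (beta - b - eta) * v.
  have e : v / v1 - 1 = (v - v1) / v1 by field; rewrite gt_eqF.
  have : (b + eta) * ((v - v1) / v1) <= (beta - b - eta) * (v - v1).
    rewrite mulrA ler_pdivrMr// mulrAC -subr_ge0 -mulrBl -[_ * v1 - _]opprB.
    by rewrite opprB mulr_ge0// subr_ge0.
  by rewrite e; lra.
rewrite ltr_pdivlMr// hE mulrAC [X in _ < X]mulrA ltr_pM2r// -hE.
have : (b + eta) * ln h <= (b + eta) * (v + (a + eps + ln v1 + (v / v1 - 1))).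
  by rewrite ler_pM2l//; lra.
lra.
Qed.

(* Lower bound for [ln (common_factor m l)] minus [l * ln mu], where
   [a = 1 + ln mu - ksum m] and [kloss m l <= w * ln (c * (l + 1))]. *)
Definition gain a w c l : R :=
  l%:R * (ln l%:R - a) + ln l%:R / 2 + 9 / 10 - w * ln (c * (l%:R + 1)).

Lemma gain_unbounded a w c y : 0 <= w -> 0 < c -> exists2 l, (0 < l)%N & y <= gain a w c l.
Proof.
move=> w0 c0; pose l := (Num.truncn (expR (a + w * c + 1) + `|y| + w * c)).+1.
have wc : 0 <= w * c by rewrite mulr_ge0// ltW.
have hl : expR (a + w * c + 1) + `|y| + w * c <= l%:R by exact/ltW/truncnS_gt.
exists l => //; have l0 : 0 < (l%:R : R) by rewrite ltr0n.
have e0 := expR_gt0 (a + w * c + 1); have y0 := normr_ge0 y; have yy := ler_norm y.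
have l1 : 1 <= (l%:R : R) by rewrite ler1n.
have h1 : a + w * c + 1 <= ln l%:R by rewrite -[X in X <= _]expRK ler_ln ?posrE//; lra.
have h2 : ln (c * (l%:R + 1)) <= c * (l%:R + 1).
  by apply/ltW/ln_sublinear; rewrite mulr_gt0//; lra.
have h3 := ler_wpM2l w0 h2; have h4 := ln_ge0 l1.
have h5 : 1 * l%:R <= l%:R * (ln l%:R - a - w * c) by rewrite mulrC ler_pM2l//; lra.
rewrite /gain; lra.
Qed.

(** At the minimal $l$ the target lies above the gain of $l-1$, so this increment bounds the
    overshoot. The loss only grows and is dropped; $1/24$ is the Stirling error at $n=1$. *)
Lemma gain_succ_le a w c n : (0 < n)%N -> 0 <= w -> 0 < c ->
  gain a w c n.+1 <= gain a w c n + ln n.+1%:R + 1 - a + 1 / 24.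
Proof.
move=> n0 w0 c0; have /andP[_] := @ln_succ_bounds R n n0.
have h1 : (n%:R^-1 - n.+1%:R^-1 : R) / 12 <= 1 / 24.
  have N1 : 1 <= (n%:R : R) by rewrite ler1n.
  rewrite -natr1; set N : R := n%:R in N1 *.
  have -> : N^-1 - (N + 1)^-1 = (N * (N + 1))^-1 by field; rewrite !gt_eqF//; lra.
  have h : (N * (N + 1))^-1 <= 2^-1 by rewrite lef_pV2 ?posrE ?mulr_gt0//; nra.
  by move: h; set q := (N * _)^-1; lra.
have h2 : w * ln (c * (n%:R + 1)) <= w * ln (c * (n.+1%:R + 1)).
  rewrite ler_wpM2l// ler_ln ?posrE ?mulr_gt0 ?ltr_wpDl// ler_pM2l// lerD2r ler_nat//.
rewrite /gain => h3; move: h1 h2 h3; rewrite -[n.+1%:R]natr1.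
set N : R := n%:R; set A := ln (N + 1); set B := ln N; set U := w * ln _; set V := w * ln _.
move=> h1 h2 h3; have := le_trans h3 (lerD (lexx 1) h1); lra.
Qed.

Lemma exists_minimal_l a w c y : 0 <= w -> 0 < c ->
  exists l, [/\ (0 < l)%N, y <= gain a w c l &
    forall n, (0 < n)%N -> (n < l)%N -> gain a w c n < y].
Proof.
move=> w0 c0; have [l0 hl0 hy0] := @gain_unbounded a w c y w0 c0.
have ex : exists l, (0 < l)%N && (y <= gain a w c l) by exists l0; rewrite hl0.
case: (ex_minnP ex) => l /andP[p1 p2] pm; exists l; split=> // n n0 nl.
by rewrite ltNge; apply/negP => yn; have := pm n; rewrite n0 yn => /(_ isT); rewrite leqNgt nl.
Qed.
End Optimization.

(** * The bound for omega in terms of parameters *)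

Section OmegaBound.
Variable R : realType.
Implicit Types (l m : nat) (r : nat -> nat).

Lemma rem_const_ge2 m : (2 <= m)%N -> 2 <= rem_const R m.
Proof.
move=> m2; have m3 : (2 < m.+1)%N by [].
rewrite /rem_const (bigD1 (Ordinal m3))//= -[X in X <= _]addr0; apply: lerD.
  by have := expR_ge1Dx (2 : R); have := expR_ge1Dx (1 : R); rewrite -[2]mulr1 expRM_natl; nra.
by apply: sumr_ge0 => j _; rewrite subr_ge0 -expR0 ler_expR.
Qed.

(** When $|\Lambda|<1$, the term $2|\Lambda|\mu^l\nu$ is at most a quarter of the divisor, as $H$
    and [rem_const] are at least $2$; the resulting factor $4/3$ and $e^{m/l}\le e^{1/2}$ fit
    together into $e$. *)
Lemma linear_form_ln_ge m l r (H mu nu w c : R) (lam : 'I_m.+1 -> int) :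
  (2 <= m)%N -> (2 * m <= l)%N -> (forall i, (r i <= m)%N) -> 0 < mu -> 0 < nu ->
  (forall x, 0 <= x <= m%:R -> `|(nodes R m).[x]| <= mu) ->
  (forall x k, 0 <= x <= m%:R -> (k <= m)%N -> `|(rootpoly R r k).[x]| <= nu) ->
  kloss R m l <= w * ln (c * (l%:R + 1)) ->
  0 < H -> 1 <= ln H ->
  ln H + ln (2 * rem_const R m * nu) <= gain R (1 + ln mu - ksum R m) w c l ->
  (exists i, lam i != 0) ->
  (forall i : 'I_m.+1, (0 < i)%N -> (`|lam i|%:~R : R) <= H) ->
  let Lam := `|\sum_(i < m.+1) (lam i)%:~R * euler R ^+ i| in
  0 < Lam /\ (1 <= Lam \/ gain R (1 + ln mu - ksum R m) w c l + l%:R * ln mu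
     - ln 2 - 1 - ln (m.+1 * l + m)`!%:R <= ln Lam).
Proof.
move=> m2 ml rm mu0 nu0 hmu hnu hk H0 h1 hg lam0 lamH Lam.
have l0 : (0 < l)%N by lia.
have lR : 0 < (l%:R : R) by rewrite ltr0n.
set D : R := (common_factor m l)%:R; have D0 : 0 < D by rewrite ltr0n common_factor_gt0.
have C2 := rem_const_ge2 m m2.
have C0 : 0 < rem_const R m by lra.
have lnD : gain R (1 + ln mu - ksum R m) w c l + l%:R * ln mu <= ln D.
  have := ln_common_factor_ge R m l l0; have /andP[hf _] := @ln_fact_bounds R l l0.
  rewrite /gain -/D; lra.
have s0 : 0 < mu ^+ l * nu by rewrite mulr_gt0// exprn_gt0.
have cond : 2 * (H * rem_const R m * (mu ^+ l * nu)) <= D.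
  rewrite -ler_ln ?posrE ?mulr_gt0// ?exprn_gt0//; apply: le_trans lnD.
  have -> : 2 * (H * rem_const R m * (mu ^+ l * nu)) = H * (2 * rem_const R m * nu) * mu ^+ l by ring.
  rewrite lnM ?posrE ?mulr_gt0 ?exprn_gt0// lnM ?posrE ?mulr_gt0//.
  by rewrite lnXn// -[ln mu *+ l]mulr_natl lerD2r.
have := @linear_form_ge R m l r H mu nu lam l0 rm (ltW mu0) (ltW nu0) hmu hnu (ltW H0) cond lam0 lamH.
rewrite -/D -/Lam; set F : R := (_)`!%:R; set s := mu ^+ l * nu => hD.
have F0 : 0 < F by rewrite ltr0n fact_gt0.
have Lam0 : 0 < Lam.
  rewrite lt_neqAle normr_ge0 andbT; apply/negP => /eqP L0.
  by move: hD; rewrite -L0 mulr0 mul0r leNgt D0.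
split=> //; have [L1|L1] := leP 1 Lam; [by left|right].
have e1 : 2 <= expR 1 :> R by have := expR_ge1Dx (1 : R); clear; lra.
have H2 : 2 <= H by rewrite -[H]lnK ?posrE// (le_trans e1)// ler_expR.
have s8 : 8 * s <= D.
  have : 2 * 2 <= H * rem_const R m by apply: ler_pM.
  by move=> /(ler_wpM2r (ltW s0)); rewrite -/s; move: cond; rewrite -/s; clear; lra.
have Ls : Lam * s <= s by rewrite ler_piMl ?(ltW s0)// ltW.
have ex : expR (m%:R / l%:R) <= expR (1 / 2 : R).
  rewrite ler_expR ler_pdivrMr// -subr_ge0.
  have : (2 * m)%:R <= (l%:R : R) by rewrite ler_nat.
  by rewrite natrM; clear; lra.
have ehalf : 4 / 3 * expR (1 / 2) <= expR 1 :> R.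
  have -> : expR 1 = expR (1 / 2) * expR (1 / 2) :> R by rewrite -expRD; congr expR; clear; lra.
  rewrite ler_wpM2r ?expR_ge0//.
  by have := expR_ge1Dx (1 / 2 : R); clear; lra.
have fin : D <= 2 * Lam * (F * expR 1).
  have q1 : Lam * (F * expR (m%:R / l%:R)) <= Lam * (F * expR (1 / 2)).
    by rewrite ler_wpM2l ?(ltW Lam0)// ler_wpM2l// ltW.
  have q2 : Lam * F * (4 / 3 * expR (1 / 2)) <= Lam * F * expR 1.
    by rewrite ler_wpM2l// mulr_ge0 ?ltW.
  move: hD q1 q2 Ls s8; clear; lra.
have : ln D <= ln (2 * Lam * (F * expR 1)) by rewrite ler_ln ?posrE ?mulr_gt0 ?expR_gt0.
rewrite !lnM ?posrE ?mulr_gt0 ?expR_gt0// expRK; clear -lnD; lra.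
Qed.

(* [err_form] bounds [- ln |Lam| - (m ln H + b l)] and [err_gain] bounds [l (ln l - a) - ln H]. *)
Definition err_form m (k0 a w c : R) l : R :=
  m%:R * (k0 + ln l%:R + 1 - a + 1 / 24) + ln 2 + 2 + (m%:R + 1 / 2) * ln (m.+1 * l + m)%:R
  - m.+1%:R * (ln l%:R / 2 + 9 / 10) + m.+1%:R * (w * ln (c * (l%:R + 1))).

Definition err_gain (k0 a w c : R) l : R :=
  k0 + ln l%:R / 2 + 1 / 10 + 1 / 24 - a + w * ln (c * (l%:R + 1)).

(** The gain is split as $(m+1)$ times itself minus $m$ times itself: the first part cancels the
    $l\ln l$ terms of the factorial and leaves $b\,l$ plus errors, and by minimality of $l$ the
    second costs only about $m\ln H$. *)
Lemma omega_le m l0 r (H mu nu w c beta eps eta v1 : R) :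
  let K := ksum R m in
  let a := 1 + ln mu - K in
  let b := m.+1%:R * ln m.+1%:R + m%:R * ln mu - m.+1%:R * K in
  let k0 := ln (2 * rem_const R m * nu) in
  (2 <= m)%N -> (2 * m <= l0)%N -> (2 <= l0)%N -> (forall i, (r i <= m)%N) -> 0 < mu -> 0 < nu ->
  0 <= w -> 0 < c ->
  (forall x, 0 <= x <= m%:R -> `|(nodes R m).[x]| <= mu) ->
  (forall x k, 0 <= x <= m%:R -> (k <= m)%N -> `|(rootpoly R r k).[x]| <= nu) ->
  (forall l, (l0 <= l)%N -> kloss R m l <= w * ln (c * (l%:R + 1))) ->
  1 < ln H -> 0 <= beta ->
  (forall l, (0 < l)%N -> (l < l0)%N -> gain R a w c l < ln H + k0) ->
  (forall l, (l0 <= l)%N -> ln H + k0 <= gain R a w c l ->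
     err_form m k0 a w c l <= eta * l%:R /\ err_gain k0 a w c l <= eps * l%:R) ->
  0 < v1 -> v1 + ln v1 <= ln (ln H) - a - eps -> 0 < b + eta ->
  (b + eta) * (a + eps + ln v1) < (beta - b - eta) * v1 ->
  b + eta <= (beta - b - eta) * v1 ->
  omega m H <= m%:R + beta / ln (ln H).
Proof.
move=> K a b k0 m2 ml0 l02 rm mu0 nu0 w0 c0 hmu hnu hk H1 beta0 hsmall herr v10 hv1 be0 c1 c2.
have H0 : 0 < H by rewrite ltNge; apply/negP => /(fun h => le_trans h ler01)/ln_le0; lra.
have L0 : 0 < ln (ln H) by rewrite ln_gt0.
have [l [lp hl hmin]] := @exists_minimal_l R a w c (ln H + k0) w0 c0.
have l0l : (l0 <= l)%N.
  by rewrite leqNgt; apply/negP => ll0; have := hsmall l lp ll0; rewrite ltNge hl.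
have [e1 e2] := herr l l0l hl.
have lR : 0 < (l%:R : R) by rewrite ltr0n.
have up : gain R a w c l <= ln H + k0 + ln l%:R + 1 - a + 1 / 24.
  have ln1 : (0 < l.-1)%N by rewrite -subn1 subn_gt0 (leq_trans l02).
  have := @gain_succ_le R a w c l.-1 ln1 w0 c0; rewrite prednK//.
  have := hmin l.-1 ln1; rewrite ltn_predL lp => /(_ isT); lra.
have B0 : 0 < m%:R + beta / ln (ln H).
  by apply: ltr_pwDl; [rewrite ltr0n (leq_trans _ m2)|rewrite divr_ge0// ltW].
apply: ge_inf; first by exists 0 => x [x0 _]; exact: ltW.
split=> // lam lam0 lamH.
have [Lam0 hLam] := @linear_form_ln_ge m l r H mu nu w c lam m2 (leq_trans ml0 l0l) rm mu0 nu0 hmu hnu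
  (hk l l0l) H0 (ltW H1) hl lam0 lamH.
set Lam := `|_| in Lam0 hLam *.
have -> : H `^ (- (m%:R + beta / ln (ln H))) = expR (- ((m%:R + beta / ln (ln H)) * ln H)).
  by rewrite /powR gt_eqF// mulNr.
have hb : 0 < (m%:R + beta / ln (ln H)) * ln H by rewrite mulr_gt0//; clear -H1; lra.
case: hLam => [L1|hL].
  by apply: lt_le_trans L1; rewrite expR_lt1 oppr_lt0.
rewrite -[X in _ < X](@lnK R Lam) ?posrE// ltr_expR; apply: lt_le_trans hL.
have lower : l%:R * (ln l%:R - a) <= ln H + eps * l%:R.
  by move: e2 up; rewrite /gain /err_gain; clear; lra.
have opt := @optimization R l%:R (ln H) a b beta eps eta v1 lR (lt_trans ltr01 H1) L0 lower v10 hv1 be0 c1 c2.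
have fact_up : ln ((m.+1 * l + m)`!%:R : R) <=
    m.+1%:R * l%:R * (ln m.+1%:R + ln l%:R) - m.+1%:R * l%:R + (m%:R + 1 / 2) * ln (m.+1 * l + m)%:R + 1.
  have M0 : (0 < m.+1 * l + m)%N by rewrite addn_gt0 muln_gt0 lp.
  have /andP[_ hf] := @ln_fact_bounds R _ M0; apply: (le_trans hf).
  set M : R := (m.+1 * l + m)%:R.
  have Mp : 0 < M by rewrite ltr0n.
  have ME : M = m.+1%:R * l%:R + m%:R by rewrite /M natrD natrM.
  have N0 : 0 < (m.+1%:R * l%:R : R) by rewrite mulr_gt0// ltr0n.
  have lnN : ln (m.+1%:R * l%:R) = ln m.+1%:R + ln l%:R :> R by rewrite lnM ?posrE ?ltr0n.
  have t := @ln_le_tangent R (m.+1%:R * l%:R) M N0 Mp.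
  have t2 := ler_wpM2l (ltW N0) t; move: t2; rewrite lnN.
  have -> : m.+1%:R * l%:R * (ln m.+1%:R + ln l%:R + (M / (m.+1%:R * l%:R) - 1)) =
     m.+1%:R * l%:R * (ln m.+1%:R + ln l%:R) + m%:R.
    by rewrite ME; field; rewrite !gt_eqF// nat1r ltr0n.
  rewrite [X in X * ln M]ME; clear -ME; lra.
have up' : m%:R * gain R a w c l <= m%:R * (ln H + k0 + ln l%:R + 1 - a + 1 / 24) by rewrite ler_wpM2l.
have -> : (m%:R + beta / ln (ln H)) * ln H = m%:R * ln H + beta * ln H / ln (ln H).
  by field; rewrite gt_eqF.
move: opt e1 up' fact_up; rewrite /err_form /gain -/K -/a /b.
rewrite -[m.+1%:R]natr1.
set X := beta * ln H / _; set y1 := ln H; set y2 := ln l%:R; set y3 := w * _.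
set y4 := ln (m.+1 * l + m)%:R; set y5 := ln (m%:R + 1).
have aE : a = 1 + ln mu - K by [].
rewrite aE; clear; lra.
Qed.
End OmegaBound.

(** * Rational bounds for logarithms of integers *)

Section NumericLogarithms.
Variable R : realType.

Lemma ln_nat_ge (p q n : nat) : (0 < q)%N -> (0 < n)%N ->
  Z.leb (Z.of_nat p * scale) ((iln iln2 (Z.of_nat n)).1 * Z.of_nat q) ->
  p%:R / q%:R <= ln (n%:R : R).
Proof.
move=> q0 n0 /Z.leb_le h; have n1 : (0 < Z.of_nat n)%ZZ by lia.
have /andP[h1 _] := @encl_ln R iln2 (Z.of_nat n) (encl_ln2 R) n1.
have q1 : 0 < (q%:R : R) by rewrite ltr0n.
rewrite ler_pdivrMr// -(ler_pM2r (scale_gt0 R)) mulrAC -(ZR_nat R n).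
apply: le_trans (_ : _ <= ZR R ((iln iln2 (Z.of_nat n)).1 * Z.of_nat q)%ZZ) _.
  by rewrite -!(ZR_nat R) -ZRM; exact: ZR_le.
by rewrite ZRM (ZR_nat R q); apply: ler_wpM2r h1; exact: ltW.
Qed.

Lemma ln_nat_le (p q n : nat) : (0 < q)%N -> (0 < n)%N ->
  Z.leb ((iln iln2 (Z.of_nat n)).2 * Z.of_nat q) (Z.of_nat p * scale) ->
  ln (n%:R : R) <= p%:R / q%:R.
Proof.
move=> q0 n0 /Z.leb_le h; have n1 : (0 < Z.of_nat n)%ZZ by lia.
have /andP[_ h1] := @encl_ln R iln2 (Z.of_nat n) (encl_ln2 R) n1.
have q1 : 0 < (q%:R : R) by rewrite ltr0n.
rewrite ler_pdivlMr// -(ler_pM2r (scale_gt0 R)) mulrAC -(ZR_nat R n).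
apply: le_trans (_ : _ <= ZR R ((iln iln2 (Z.of_nat n)).2 * Z.of_nat q)%ZZ) _.
  by rewrite ZRM (ZR_nat R q); apply: ler_wpM2r h1; exact: ltW.
by rewrite -!(ZR_nat R) -ZRM; exact: ZR_le.
Qed.
End NumericLogarithms.

Ltac ln_num := first [apply: ln_nat_ge | apply: ln_nat_le]; [exact: isT|exact: isT|by vm_compute].

(** * Error terms for $m\ge5$ *)

Section GenericErrors.
Variable R : realType.
Implicit Types (l m p : nat).

(** The minimum is attained at $j=p-1$, where the first floor is zero. *)
Lemma minfloorE m p : (0 < p)%N -> (p <= m.+1)%N -> minfloor m p = (m.+1 %/ p).-1.
Proof.
move=> p0 pm; apply/eqP; rewrite eqn_leq; apply/andP; split.
  have h : (p.-1 <= m)%N by lia.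
  apply: leq_trans (minfloor_le m p p.-1 h) _.
  rewrite divn_small ?prednK// add0n.
  have -> : (m - p.-1 = m.+1 - p)%N by lia.
  by rewrite -[in X in (_ <= X.-1)%N](subnK pm) divnDr// divnn p0 addn1.
have hl a : (a <= m)%N -> ((m.+1 %/ p).-1 <= a %/ p + (m - a) %/ p)%N.
  move=> am; have := ltn_ceil a p0; have := ltn_ceil (m - a) p0.
  move: (a %/ p)%N ((m - a) %/ p)%N => u v h1 h2.
  have h3 : (m.+1 < (u + v).+2 * p)%N by nia.
  by move: h3; rewrite -ltn_divLR//; lia.
rewrite /minfloor; apply: (big_ind (fun k => ((m.+1 %/ p).-1 <= k)%N)) => [|a b ha hb|i _].
- by have := hl 0%N; rewrite div0n add0n subn0; apply.
- by rewrite leq_min ha.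
- by apply: hl; rewrite -ltnS.
Qed.

Lemma kloss_le m l : (3 <= m)%N -> (0 < l)%N -> kloss R m l <= m%:R * ln (m.+1%:R * (l%:R + 1)).
Proof.
move=> m3 l0; have T0 : 0 <= ln (m.+1%:R * (l%:R + 1) : R).
  by rewrite ln_ge0// natr1 -natrM ler1n muln_gt0.
apply: (@le_trans _ _ (\sum_(p < ((m.+1)./2).+1 | prime p) ln (m.+1%:R * (l%:R + 1) : R))).
  apply: ler_sum => p pp; have p1 := prime_gt1 pp.
  apply: (@le_trans _ _ (ln (l%:R * (minfloor m p).+1%:R + 1))).
    by rewrite gerBl divr_ge0 ?ltW ?ln_nat_prime ?natr_prime_gt1.
  rewrite -natrM !natr1 -natrM ler_ln ?posrE ?ltr0n ?muln_gt0// ler_nat.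
  have h : (minfloor m p <= m)%N.
    by apply: leq_trans (minfloor_le m p 0 (leq0n _)) _; rewrite div0n subn0 add0n leq_div.
  nia.
apply: (@le_trans _ _ (\sum_(p < ((m.+1)./2).+1) ln (m.+1%:R * (l%:R + 1) : R))).
  by rewrite [leLHS]big_mkcond; apply: ler_sum => p _; case: ifP.
rewrite sumr_const card_ord -[leLHS]mulr_natl ler_wpM2r// ler_nat.
by rewrite -divn2; lia.
Qed.

Lemma rem_const_le m : rem_const R m <= m.+1%:R * expR m%:R.
Proof.
rewrite /rem_const -[m.+1 in leRHS]card_ord mulr_natl -sumr_const; apply: ler_sum => j _.
by rewrite lerBlDr ler_wpDr// ler_expR ler_nat -ltnS.
Qed.

(** $h/(\ln h)^2$ is nondecreasing once $\ln h\ge2$: for $h=Xt^2$ with $t\ge1$, $\ln h\le\ln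
    X+2(t-1)\le t\ln X$. *)
Lemma ln_gap_sqr (X h : R) : 0 < X -> 2 <= ln X -> X <= h ->
  forall c, 0 <= c -> c * ln X ^+ 2 <= X -> c * ln h ^+ 2 <= h.
Proof.
move=> X0 lX Xh c c0 hc; have h0 : 0 < h by exact: lt_le_trans Xh.
pose t := Num.sqrt (h / X).
have t1 : 1 <= t by rewrite -[1]sqrtr1 ler_wsqrtr// ler_pdivlMr// mul1r.
have tE : t ^+ 2 = h / X by rewrite sqr_sqrtr// divr_ge0// ltW.
have hE : h = X * t ^+ 2 by rewrite tE mulrC divfK// gt_eqF.
have lt1 : ln t <= t - 1 by rewrite -[X in ln X](subrKC 1) le_ln1Dx//; lra.
have lh : ln h = ln X + 2 * ln t.
  by rewrite hE lnM ?posrE// ?exprn_gt0 ?lnXn//; [rewrite mulr_natl| | ]; lra.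
have l1 : ln h <= ln X * t by rewrite lh; nra.
have l0 : 0 <= ln h by rewrite lh; have := ln_ge0 t1; lra.
have l2 : ln h ^+ 2 <= (ln X * t) ^+ 2 by rewrite lerXn2r ?nnegrE// (le_trans l0).
apply: (@le_trans _ _ (c * (ln X * t) ^+ 2)); first by rewrite ler_wpM2l.
by rewrite exprMn mulrA [leRHS]hE ler_wpM2r ?sqr_ge0.
Qed.

Lemma ln_nat_le_third m : (5 <= m)%N -> 8 / 5 <= ln (m%:R : R) <= m%:R / 3.
Proof.
move=> m5; have M5 : 5 <= (m%:R : R) by rewrite (ler_nat _ 5).
have h1 : 8%:R / 5%:R <= ln (5%:R : R) by ln_num.
have h2 : ln (5%:R : R) <= 33%:R / 20%:R by ln_num.
apply/andP; split.
  by apply: (le_trans h1); rewrite ler_ln ?posrE//; lra.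
have := @ln_le_tangent R 5%:R m%:R; lra.
Qed.

(* [l >= 200 m ^ 2 ln h] absorbs all error terms. *)
Lemma err_small m l (h mu a : R) :
  let x := ln (m%:R : R) in
  let k0 := ln (2 * rem_const R m * m%:R ^+ m) in
  (5 <= m)%N -> 0 <= a -> 1 < h -> m%:R * x ^+ 2 <= ln h ->
  400 * m%:R ^+ 2 * ln h ^+ 2 <= h -> h / ln h <= l%:R + 1 ->
  err_form R m k0 a m%:R m.+1%:R l <= l%:R / 25 /\
  err_gain R k0 a m%:R m.+1%:R l <= l%:R / 25.
Proof.
move=> x k0 m5 a0 h1 hs hh hl.
have /andP[x1 x2] := ln_nat_le_third _ m5; rewrite -/x in x1 x2.
have M5 : 5 <= (m%:R : R) by rewrite (ler_nat _ 5).
set M : R := m%:R in M5 hs hh x2 *; set L := ln h in hs hh hl *.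
have mx8 : 8 <= M * x by nra.
have L8 : 8 <= L by apply: le_trans hs; rewrite expr2 mulrA; nra.
have L0 : 0 < L by lra.
have y1 : 400 * M ^+ 2 * L <= h / L by rewrite ler_pdivlMr//; lra.
have MM : 25 <= M ^+ 2 by clear -M5; nra.
set y := h / L in y1 hl *.
have y2 : 2 <= y by clear -y1 MM L8; nra.
have ly : y / 2 <= l%:R by clear -hl y2; lra.
have lR : 0 < (l%:R : R) by clear -ly y2; lra.
have l200 : 200 * M ^+ 2 * L <= l%:R by clear -y1 ly; lra.
set lam : R := ln l%:R.
(* $l$ is bounded only from below, so $\ln l$ is compared with $l$ itself, by the tangent at
   $y=h/\ln h$. *)
have lamle : lam <= L + l%:R / y.
  have yp : 0 < y by clear -y2; lra.
  have := @ln_le_tangent R y l%:R yp lR.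
  have : ln y <= L by rewrite /y ler_ln ?posrE// ?divr_gt0//; [rewrite ler_pdivrMr//; clear -h1 L8; nra|clear -h1; lra].
  rewrite -/lam; clear; lra.
have lM : 4 * M ^+ 2 * lam <= 3 / 100 * l%:R.
  have q1 : 4 * M ^+ 2 * (l%:R / y) <= l%:R / 100.
    rewrite mulrA ler_pdivrMr; last by clear -y2; lra.
    have : 400 * M ^+ 2 <= y by clear -y1 L8 MM; nra.
    by move=> q; have := ler_wpM2l (ltW lR) q; clear; lra.
  have : 4 * M ^+ 2 * lam <= 4 * M ^+ 2 * (L + l%:R / y) by rewrite ler_wpM2l//; clear -MM; nra.
  clear -q1 l200; lra.
have l25 : M ^+ 2 <= l%:R by clear -l200 L8 MM; nra.
have lam1 : 1 <= lam.
  have e5 : 8%:R / 5%:R <= ln (5%:R : R) by ln_num.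
  have : ln 5%:R <= lam by rewrite /lam ler_ln ?posrE//; clear -l25 MM; lra.
  clear -e5; lra.
have lnmul (u : R) : 0 < u -> u <= l%:R ^+ 2 -> ln u <= 2 * lam.
  move=> u0 ul; rewrite mulr_natl -lnXn// ler_ln ?posrE// exprn_gt0//.
have c1 : ln (m.+1%:R * (l%:R + 1) : R) <= 2 * lam.
  apply: lnmul; rewrite -natr1 -/M; first by rewrite mulr_gt0//; clear -lR M5; lra.
  clear -M5 l25; nra.
have c2 : ln (m.+1 * l + m)%:R <= 2 * lam.
  apply: lnmul; first by rewrite ltr0n addn_gt0 (leq_trans _ m5)// orbT.
  rewrite natrD natrM -natr1 -/M; clear -M5 l25; nra.
have k0le : k0 <= 3 * (M * x).
  have C := rem_const_le m; have m2 : (2 <= m)%N by rewrite (leq_trans _ m5).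
  have C0 : 0 < rem_const R m by apply: lt_le_trans (rem_const_ge2 R m m2).
  have E0 := expR_gt0 (M : R); have Mp : 0 < M by apply: lt_le_trans M5.
  have : k0 <= ln (2 * (m.+1%:R * expR M) * M ^+ m).
    have Mm : 0 < M ^+ m by rewrite exprn_gt0.
    have M1 : 0 < (m.+1%:R : R) by rewrite ltr0n.
    have q1 : 0 < 2 * rem_const R m * M ^+ m by rewrite mulr_gt0// mulr_gt0.
    have q2 : 0 < 2 * (m.+1%:R * expR M) * M ^+ m by rewrite mulr_gt0// mulr_gt0// mulr_gt0.
    rewrite /k0 ler_ln ?posrE//.
    by apply: ler_wpM2r; [exact: ltW|rewrite ler_wpM2l].
  have -> : 2 * (m.+1%:R * expR M) * M ^+ m = 2 * m.+1%:R * expR M * M ^+ m by rewrite mulrA.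
  have P2 : 0 < (2 * m.+1%:R : R) by rewrite mulr_gt0.
  rewrite lnM ?posrE ?mulr_gt0 ?exprn_gt0//.
  rewrite (lnM (_ : 2 * m.+1%:R \is Num.pos) (_ : expR M \is Num.pos)) ?posrE//.
  rewrite expRK lnXn// -/x -[x *+ m]mulr_natl.
  have : ln (2 * m.+1%:R : R) <= 2 * x.
    rewrite [leRHS]mulr_natl -lnXn// ler_ln ?posrE ?exprn_gt0//.
    by rewrite -natr1 -/M; clear -M5; nra.
  rewrite -/M; clear -x1 M5; nra.
have mk0 : M * k0 <= l%:R / 500.
  have Mp : 0 < M by apply: lt_le_trans M5.
  have x0 : 0 <= x by apply: le_trans x1.
  have k1 : M * k0 <= M * (3 * (M * x)) by apply: ler_wpM2l => //; exact: ltW.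
  have L1 : 8 / 5 * (M * x) <= L.
    apply: le_trans hs; have := ler_wpM2l (mulr_ge0 (ltW Mp) x0) x1; clear; lra.
  have M2 : 0 <= 200 * M ^+ 2 by exact: mulr_ge0 (ler0n _ _) (sqr_ge0 _).
  have l1 := le_trans (ler_wpM2l M2 L1) l200.
  have t0 : 0 <= M ^+ 2 * x by apply: mulr_ge0 => //; exact: sqr_ge0.
  have t1 := ler_wpM2r t0 M5.
  move: k1 l1 t1 t0; clear; lra.
have ln2le : ln (2 : R) <= 1.
  have : ln (2%:R : R) <= 7%:R / 10%:R by ln_num.
  clear; lra.
have Mp : 0 < M by apply: lt_le_trans M5.
have M1 : (m.+1%:R : R) = M + 1 by rewrite -natr1.
have f1 : M * ln (m.+1%:R * (l%:R + 1)) <= M * (2 * lam) by rewrite ler_pM2l.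
have f2 : (M + 1) * (M * ln (m.+1%:R * (l%:R + 1))) <= (M + 1) * (M * (2 * lam)).
  by rewrite ler_pM2l// addr_gt0.
have f3 : (M + 1 / 2) * ln (m.+1 * l + m)%:R <= (M + 1 / 2) * (2 * lam).
  by rewrite ler_pM2l// addr_gt0.
have f4 : 0 <= M * a by rewrite mulr_ge0// ltW.
have f5 : 0 <= (2 * M ^+ 2 - 9 / 2 * M - 1 / 2) * (lam - 1).
  by apply: mulr_ge0; [clear -M5; nra|rewrite subr_ge0].
have f6 : 25 <= M ^+ 2 by [].
have f7 : 0 <= (M - 5) * M by rewrite mulr_ge0 ?subr_ge0// ltW.
have k0M : k0 <= M * k0.
  have K0 : 0 <= k0.
    rewrite /k0; apply: ln_ge0; have m2 : (2 <= m)%N by rewrite (leq_trans _ m5).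
    have C2 := rem_const_ge2 R m m2.
    have g1 : 1 <= 2 * rem_const R m by move: C2; clear; lra.
    have g2 : 1 <= M ^+ m by rewrite exprn_ege1//; move: M5; clear; lra.
    exact: (mulr_ege1 g1 g2).
  by rewrite ler_peMl//; move: M5; clear; lra.
rewrite M1 in f1 f2; rewrite /err_form /err_gain -/lam -/M M1; split.
  move: lR mk0 lM f2 f3 f4 f5 f6 f7 ln2le M5; clear.
  set A := ln (_ * l + _)%:R; set B := ln (_ * (l%:R + 1)); lra.
move: lR k0M mk0 lM f1 a0 f5 f6 f7 M5 lam1; clear.
set B := ln (_ * (l%:R + 1)); nra.
Qed.
End GenericErrors.

(** * Reduction of $m\ge5$ to an inequality at the threshold *)

Section GenericBound.
Variable R : realType.
Implicit Types (l m p : nat).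

(* upper bound for the logarithm of the sup norm of [nodes m] on [0, m] *)
Definition lnsup m : R :=
  m%:R * ln m%:R - m%:R + ln m%:R / 2 - ln (ln m%:R + 1 / 2).

Definition acoef m : R := 1 + lnsup m - ksum R m.

Definition bcoef m : R := m.+1%:R * ln m.+1%:R + m%:R * lnsup m - m.+1%:R * ksum R m.

(** As $\ln\ln H\ge s+\ln s$, the value $v_1=s-a-1/25$ is admissible in [optimization]; the last
    hypothesis is the inequality required there, with $\ln v_1$ enlarged to $\ln s=x+2\ln x$. *)
Lemma omega_le_generic m (H beta : R) :
  let x := ln (m%:R : R) in let s := m%:R * x ^+ 2 in
  (5 <= m)%N -> s * expR s <= ln H ->
  3 / 2 <= acoef m -> 0 <= bcoef m -> 3 <= s - acoef m - 1 / 25 ->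
  (bcoef m + 1 / 25) * (s + x + 2 * ln x) < beta * (s - acoef m - 1 / 25) ->
  omega m H <= m%:R + beta / ln (ln H).
Proof.
move=> x s m5 hH a1 b0 v3 star; set h := ln H in hH *; set L := ln h.
have /andP[x1 x2] := ln_nat_le_third R _ m5; rewrite -/x in x1 x2.
have M5 : 5 <= (m%:R : R) by rewrite (ler_nat _ 5).
have Mp : 0 < (m%:R : R) by apply: lt_le_trans M5.
have xp : 0 < x by apply: lt_le_trans x1.
have mx8 : 8 <= m%:R * x by clear -M5 x1; nra.
have s8 : 8 * x <= s by rewrite /s expr2 mulrA ler_pM2r.
have s12 : 64 / 5 <= s by move: s8 x1; clear; lra.
have s0 : 0 < s by move: s12; clear; lra.
set X := s * expR s in hH.
have X0 : 0 < X by rewrite mulr_gt0// expR_gt0.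
have lnX : ln X = s + ln s by rewrite lnM ?posrE ?expR_gt0// expRK addrC.
have lns : ln s = x + 2 * ln x.
  by rewrite /s lnM ?posrE ?exprn_gt0// lnXn// -/x [2 * _]mulr_natl.
have lns0 : 0 <= ln s by apply: ln_ge0; move: s12; clear; lra.
have h0 : 0 < h by apply: lt_le_trans hH.
have LX : s + ln s <= L by rewrite -lnX ler_ln ?posrE.
have expX : 400 * m%:R ^+ 2 * ln X ^+ 2 <= X.
  have t := @ln_le_tangent R 2 s (ltr0n _ 2) s0.
  have l2 : ln (2%:R : R) <= 7%:R / 10%:R by ln_num.
  have q1 : ln X <= 3 / 2 * s by move: t l2; rewrite lnX; clear; lra.
  have q2 : ln X ^+ 2 <= (3 / 2 * s) ^+ 2.
    have lX0 : 0 <= ln X by rewrite lnX addr_ge0// ltW.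
    have s1 : 0 <= 3 / 2 * s by move: s0; clear; lra.
    by rewrite lerXn2r ?nnegrE.
  have M2 : 0 <= 400 * m%:R ^+ 2 :> R by exact: mulr_ge0 (ler0n _ _) (sqr_ge0 _).
  apply: (le_trans (ler_wpM2l M2 q2)).
  have -> : 400 * m%:R ^+ 2 * (3 / 2 * s) ^+ 2 = s * (900 * m%:R ^+ 2 * s) by field.
  rewrite ler_wpM2l ?(ltW s0)//; apply: (@le_trans _ _ (m%:R ^+ 8)).
    apply: (@le_trans _ _ (900 * m%:R ^+ 2 * (m%:R ^+ 3 / 9))).
      apply: ler_wpM2l; first exact: mulr_ge0 (ler0n _ _) (sqr_ge0 _).
      have x3 : x ^+ 2 <= (m%:R / 3) ^+ 2 by rewrite lerXn2r ?nnegrE ?(ltW xp)// divr_ge0.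
      by have := ler_wpM2l (ltW Mp) x3; rewrite -/s; clear; lra.
    have -> : 900 * m%:R ^+ 2 * (m%:R ^+ 3 / 9) = m%:R ^+ 5 * 100 :> R by field.
    have -> : m%:R ^+ 8 = m%:R ^+ 5 * m%:R ^+ 3 :> R by rewrite -exprD.
    rewrite ler_wpM2l ?exprn_ge0//.
    have := @lerXn2r _ 3 5 (m%:R : R); rewrite !nnegrE => /(_ (ler0n _ _) (ltW Mp) M5); lra.
  have -> : m%:R ^+ 8 = expR (8 * x) :> R by rewrite expRM_natl /x lnK ?posrE.
  by rewrite ler_expR.
have lnX2 : 2 <= ln X by rewrite lnX; move: s12 lns0; clear; lra.
have c0 : 0 <= 400 * m%:R ^+ 2 :> R by exact: mulr_ge0 (ler0n _ _) (sqr_ge0 _).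
have hL : 400 * m%:R ^+ 2 * L ^+ 2 <= h by exact: (ln_gap_sqr R _ _ X0 lnX2 hH _ c0 expX).
have sL : s <= L by move: LX lns0; clear; lra.
have L12 : 64 / 5 <= L by apply: le_trans sL.
have L0 : 0 < L by move: L12; clear; lra.
have h1 : 1 < h by rewrite -ltr_ln ?posrE// ln1.
have yge : 400 * m%:R ^+ 2 * L <= h / L by rewrite ler_pdivlMr//; move: hL; clear; lra.
(* Since [acoef m] is at least $3/2$, for $l$ below $h/\ln h$ the gain is at most $l\ln l<h$; so the
   minimal $l$ is not below this integer part. *)
pose l0 := Num.truncn (h / L).
have y0 : 0 <= h / L by rewrite divr_ge0 ?ltW.
have l0y : l0%:R <= h / L by rewrite truncn_le.
have yl0 : h / L < l0%:R + 1 by rewrite natr1 truncnS_gt.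
have l0m : (2 * m < l0)%N.
  rewrite truncn_gt_nat; apply: le_trans yge; rewrite -natr1 natrM.
  have p : 5 * (64 / 5) <= m%:R * L by exact: ler_pM.
  by move: (ler_wpM2l (ltW Mp) p) M5; clear; lra.
have mu0 : 0 < expR (lnsup m) by exact: expR_gt0.
have m1 : (0 < m)%N by rewrite (leq_trans _ m5).
have hk0 : 0 <= ln (2 * rem_const R m * m%:R ^+ m).
  have m2 : (2 <= m)%N by rewrite (leq_trans _ m5).
  apply: ln_ge0; apply: mulr_ege1; first by have := rem_const_ge2 R m m2; clear; lra.
  by rewrite exprn_ege1// ler1n.
have v0 : 0 < s - acoef m - 1 / 25 by move: v3; clear; lra.
have star' : (bcoef m + 1 / 25) * (1 / 25 + acoef m + ln (s - acoef m - 1 / 25)) <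
    (beta - bcoef m - 1 / 25) * (s - acoef m - 1 / 25).
  have lv : ln (s - acoef m - 1 / 25) <= ln s.
    by rewrite ler_ln ?posrE//; move: a1; clear; lra.
  have q : 0 <= bcoef m + 1 / 25 by rewrite addr_ge0.
  by have := ler_wpM2l q lv; rewrite lns; move: star; clear; lra.
apply: (@omega_le R m l0 (fun=> 0%N) H (expR (lnsup m)) (m%:R ^+ m) m%:R m.+1%:R beta (1 / 25) (1 / 25)
  (s - acoef m - 1 / 25)); rewrite ?expRK -/(acoef m) -/(bcoef m) -/h -/L //.
- by rewrite (leq_trans _ m5).
- exact: ltnW.
- by rewrite (leq_trans _ (ltnW l0m))// (leq_trans _ (leq_mul (leqnn 2) m1)).
- by rewrite exprn_gt0.
- move=> y ym; apply: (le_trans (nodes_norm_le_bound R m y m1 ym)).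
  rewrite -ler_ln ?posrE ?nodes_bound_gt0// expRK; exact: ln_nodes_bound_le.
- by move=> y k ym km; exact: rootpoly_norm_le.
- move=> l ll; apply: kloss_le; first by rewrite (leq_trans _ m5).
  by rewrite (leq_trans _ ll)// (leq_trans _ l0m).
- have : 0 < beta * (s - acoef m - 1 / 25).
    apply: le_lt_trans star; apply: mulr_ge0; first by rewrite addr_ge0.
    by rewrite -addrA; move: lns0 s0; rewrite lns; clear; lra.
  by rewrite pmulr_lgt0// => /ltW.
- move=> l lp ll; apply: (@lt_le_trans _ _ h); last by rewrite lerDl.
  have lR : 1 <= (l%:R : R) by rewrite ler1n.
  have lR0 : 0 < (l%:R : R) by apply: lt_le_trans lR.
  have lnl : ln l%:R <= l%:R - 1 :> R.
    by rewrite -[X in ln X](subrKC 1) le_ln1Dx//; move: lR; clear; lra.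
  have W0 : 0 <= m%:R * ln (m.+1%:R * (l%:R + 1)) :> R.
    by rewrite mulr_ge0// ln_ge0// natr1 -natrM ler1n muln_gt0.
  have g1 : gain R (acoef m) m%:R m.+1%:R l <= l%:R * ln l%:R.
    have := ler_wpM2l (ltW lR0) a1; rewrite /gain.
    by move: lnl lR W0; clear; lra.
  apply: (le_lt_trans g1).
  have ly : l%:R <= h / L by apply: le_trans l0y; rewrite ler_nat ltnW.
  have ly0 : 0 < h / L by apply: lt_le_trans ly.
  have lnly : ln l%:R <= ln (h / L) by rewrite ler_ln ?posrE.
  have ln0 : 0 <= ln (l%:R : R) by exact: ln_ge0.
  have lL : ln (h / L) < L.
    rewrite ln_div ?posrE// -/L gtrBl; apply: ln_gt0; move: L12; clear; lra.
  apply: (@le_lt_trans _ _ (h / L * ln (h / L))); first exact: ler_pM.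
  by rewrite -[ltRHS](divfK (lt0r_neq0 L0)) ltr_pM2l.
- move=> l ll _; have [] := @err_small R m l h 1 (acoef m) m5 _ h1 sL hL _.
  + by move: a1; clear; lra.
  + by apply: ltW; apply: (lt_le_trans yl0); rewrite lerD2r ler_nat.
  + have e : 1 / 25 * l%:R = l%:R / 25 :> R by field.
    by rewrite e.
- have lv : ln (s - acoef m - 1 / 25) <= ln s.
    by rewrite ler_ln ?posrE//; move: a1; clear; lra.
  by move: lv LX; clear; lra.
- by move: b0; clear; lra.
- by rewrite [acoef m + _]addrC; exact: star'.
have lv0 : 0 <= ln (s - acoef m - 1 / 25) by apply: ln_ge0; move: v3; clear; lra.
apply: ltW; apply: le_lt_trans star'; apply: ler_peMr; first by move: b0; clear; lra.
by move: a1 lv0; clear; lra.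
Qed.
End GenericBound.

(** * Interval verification for $5\le m<30$ *)

Section StarCheck.
Variable R : realType.
Local Notation encl := (@encl R).

(** A fixed-point argument $y$ is handled as $\ln(yS)-\ln S$, where $S$ is the scale, so that
    logarithms of integers suffice. *)
Definition ilnF (i : Z * Z) : Z * Z :=
  ((isub (iln iln2 i.1) (iln iln2 scale)).1, (isub (iln iln2 i.2) (iln iln2 scale)).2).

Lemma encl_lnF i (y : R) : (0 < i.1)%ZZ -> encl i y -> encl (ilnF i) (ln y).
Proof.
move=> i1 /andP[h1 h2]; have S0 := scale_gt0 R; have I1 := ZR_gt0 R _ i1.
have y0 : 0 < y by rewrite -(pmulr_lgt0 _ S0); exact: lt_le_trans h1.
have i2 : (0 < i.2)%ZZ.
  by apply: ZR_lt_inv (_ : ZR R _ < ZR R _); rewrite ZR0; apply: lt_le_trans I1 (le_trans h1 h2).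
have e1 := encl_ln R iln2 _ (encl_ln2 R) i1.
have e2 := encl_ln R iln2 _ (encl_ln2 R) i2.
have e3 := encl_ln R iln2 _ (encl_ln2 R) scale_pos.
have /andP[f1 _] := encl_sub R _ _ _ _ e1 e3; have /andP[_ f2] := encl_sub R _ _ _ _ e2 e3.
have yp : y \is Num.pos by rewrite posrE.
have Sp : ZR R scale \is Num.pos by rewrite posrE; exact: S0.
have P1 : ZR R i.1 \is Num.pos by rewrite posrE; exact: I1.
have P2 : ZR R i.2 \is Num.pos by rewrite posrE; exact: ZR_gt0 R _ i2.
have yS : y * ZR R scale \is Num.pos by rewrite posrE; exact: mulr_gt0.
have lyE : ln y = ln (y * ZR R scale) - ln (ZR R scale).
  by apply: etrans (esym (addrK (ln (ZR R scale)) (ln y))) _; congr (_ - _); exact: esym (lnM yp Sp).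
have g1 : ln (ZR R i.1) <= ln (y * ZR R scale) by rewrite (ler_ln P1 yS).
have g2 : ln (y * ZR R scale) <= ln (ZR R i.2) by rewrite (ler_ln yS P2).
rewrite /ilnF lyE; apply/andP; split.
  exact (le_trans f1 (ler_wpM2r (ltW S0) (lerB g1 (lexx _)))).
exact (le_trans (ler_wpM2r (ltW S0) (lerB g2 (lexx _))) f2).
Qed.

Definition iksum (m : nat) : Z * Z :=
  foldr (fun p acc => iadd (imulZ (Z.of_nat (m.+1 %/ p).-1)
           (idivZ (iln iln2 (Z.of_nat p)) (Z.of_nat p.-1))) acc) (iint 0)
    [seq p <- iota 0 ((m.+1)./2).+1 | prime p].

Lemma encl_ksum m : encl (iksum m) (ksum R m).
Proof.
have -> : ksum R m = \sum_(p <- [seq p <- iota 0 ((m.+1)./2).+1 | prime p])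
    ((m.+1 %/ p).-1)%:R * (ln (p%:R : R) / (p.-1)%:R).
  rewrite /ksum big_filter -(big_mkord prime (fun p => (minfloor m p)%:R * (ln (p%:R : R) / (p%:R - 1)))).
  rewrite /index_iota subn0 big_seq_cond [RHS]big_seq_cond; apply: eq_bigr => p.
  rewrite mem_iota add0n => /andP[/andP[_ pm] pp].
  rewrite minfloorE ?prime_gt0//; last by move: pm; rewrite -divn2; lia.
  by rewrite -[p.-1]subn1 natrB ?prime_gt0.
rewrite /iksum; elim: (iota _ _) => [|p s IH] /=.
  by rewrite big_nil; have := encl_int R 0; rewrite ZR0.
case: ifP => // pp; rewrite big_cons; apply: encl_add => //.
rewrite -(ZR_nat R (m.+1 %/ p).-1); apply: encl_mulZ; first by lia.
rewrite -(ZR_nat R p.-1); have p1 := prime_gt1 pp; apply: encl_divZ; first by lia.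
by rewrite -(ZR_nat R p); apply: encl_ln; [exact: encl_ln2|lia].
Qed.

(* checks the hypotheses of [omega_le_generic] for [beta = (s - d K) (m x - K) / x^2], where
   [d K] stands for [c K] plus [e m] *)
Definition star_check (m : nat) (c e : Z) : bool :=
  let M := Z.of_nat m in
  let x := iln iln2 M in
  let s := imulZ M (imul x x) in
  let K := iksum m in
  let lx := ilnF x in
  let xh := iadd x (idivZ (iint 1) 2) in
  let U := isub (iadd (isub (imulZ M x) (iint M)) (idivZ x 2)) (ilnF xh) in
  let a := isub (iadd (iint 1) U) K in
  let b := isub (iadd (imulZ (M + 1) (iln iln2 (M + 1))) (imulZ M U)) (imulZ (M + 1) K) in
  let v := isub (isub s a) (idivZ (iint 1) 25) in
  let b' := iadd b (idivZ (iint 1) 25) in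
  let q := iadd (iadd s x) (imulZ 2 lx) in
  let f1 := isub s (iadd (imulZ c K) (iint (e * M))) in
  let f2 := isub (imulZ M x) K in
  let lhs := imul (imul b' q) (imul x x) in
  let rhs := imul (imul f1 f2) v in
  [&& Z.ltb 0 x.1, Z.ltb 0 xh.1, Z.leb (2 * scale) a.1, Z.leb 0 b.1, Z.leb (3 * scale) v.1,
      Z.leb 0 q.1, Z.leb 0 f1.1, Z.leb 0 f2.1, Z.leb 0 (imul b' q).1, Z.leb 0 (imul x x).1,
      Z.leb 0 (imul f1 f2).1, Z.leb 0 b'.1, Z.leb K.2 (M * scale) & Z.ltb lhs.2 rhs.1].

Definition all_star_checks : bool :=
  all (fun m => if (m <= 14)%N then star_check m 2 0 else star_check m 1 1) (iota 5 25).

Lemma star_checkP m c e : (2 <= m)%N -> (0 <= c)%ZZ -> star_check m c e ->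
  let x := ln (m%:R : R) in let s := m%:R * x ^+ 2 in let K := ksum R m in
  let f1 := s - (ZR R c * K + ZR R e * m%:R) in let v := s - acoef R m - 1 / 25 in
  [/\ 3 / 2 <= acoef R m, 0 <= bcoef R m, 3 <= v, K <= m%:R & 
   [/\ 0 <= f1, 0 <= m%:R * x - K &
   (bcoef R m + 1 / 25) * (s + x + 2 * ln x) * x ^+ 2 < f1 * (m%:R * x - K) * v]].
Proof.
move=> m2 c0 chk x s K f1 v.
have M0 : (0 <= Z.of_nat m)%ZZ by lia.
have M1 : (0 <= Z.of_nat m + 1)%ZZ by lia.
have Mp : (0 < Z.of_nat m)%ZZ by lia.
have M1p : (0 < Z.of_nat m + 1)%ZZ by lia.
have z2 : (0 < 2)%ZZ by [].
have z02 : (0 <= 2)%ZZ by [].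
have z25 : (0 < 25)%ZZ by [].
have MR := ZR_nat R m.
have M1R : ZR R (Z.of_nat m + 1)%ZZ = m.+1%:R by rewrite ZRD MR (ZR1 R) natr1.
move: chk; rewrite /star_check.
set ix := iln iln2 (Z.of_nat m); set iS := imulZ _ (imul ix ix); set iK := iksum m.
set il := ilnF ix; set ih := ilnF _; set iU := isub _ ih; set ia := isub _ iK.
set ib := isub _ (imulZ _ iK); set iv := isub _ (idivZ (iint 1) 25).
set ib' := iadd ib _; set iq := iadd (iadd iS ix) _; set i1 := isub iS _; set i2 := isub _ iK.
case/and5P => /Z.ltb_lt c1 /Z.ltb_lt c2 /Z.leb_le c3 /Z.leb_le c4.
case/and5P => /Z.leb_le c5 /Z.leb_le c6 /Z.leb_le c7 /Z.leb_le c8.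
case/and5P => /Z.leb_le c9 /Z.leb_le c10 /Z.leb_le c11 /Z.leb_le c12.
case/andP => /Z.leb_le c13 /Z.ltb_lt c14.
have ex : encl ix x by rewrite /x -MR; exact: (encl_ln R iln2 _ (encl_ln2 R) Mp).
have x0 : (0 <= ix.1)%ZZ := Z.lt_le_incl _ _ c1.
have exx : encl (imul ix ix) (x ^+ 2) by rewrite expr2; exact: encl_mul.
have es : encl iS s by rewrite /s -MR; exact: encl_mulZ.
have eK : encl iK K by exact: encl_ksum.
have el : encl il (ln x) by exact: encl_lnF.
have e1 : encl (iint 1) 1 by rewrite -(ZR1 R); exact: encl_int.
have ehalf : encl (idivZ (iint 1) 2) (1 / 2) by rewrite -(ZR_nat R 2); exact: encl_divZ.
have e25 : encl (idivZ (iint 1) 25) (1 / 25) by rewrite -(ZR_nat R 25); exact (encl_divZ R _ _ _ z25 e1).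
have eh : encl ih (ln (x + 1 / 2)) by apply: encl_lnF => //; exact: encl_add.
have eM : encl (iint (Z.of_nat m)) m%:R by rewrite -MR; exact: encl_int.
have eMx : encl (imulZ (Z.of_nat m) ix) (m%:R * x) by rewrite -MR; exact: encl_mulZ.
have ex2 : encl (idivZ ix 2) (x / 2) by rewrite -(ZR_nat R 2); exact: encl_divZ.
have eU : encl iU (lnsup R m).
  by apply: encl_sub => //; apply: encl_add => //; exact: encl_sub.
have ea : encl ia (acoef R m) by apply: encl_sub => //; exact: encl_add.
have eb : encl ib (bcoef R m).
  have u1 : encl (imulZ (Z.of_nat m + 1) iK) (m.+1%:R * K) by rewrite -M1R; exact: encl_mulZ.
  have u2 : encl (imulZ (Z.of_nat m) iU) (m%:R * lnsup R m) by rewrite -MR; exact: encl_mulZ.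
  have u3 : encl (imulZ (Z.of_nat m + 1) (iln iln2 (Z.of_nat m + 1))) (m.+1%:R * ln m.+1%:R).
    by rewrite -M1R; apply: encl_mulZ => //; exact: (encl_ln R iln2 _ (encl_ln2 R) M1p).
  by apply: encl_sub => //; exact: encl_add.
have ev : encl iv v by apply: encl_sub => //; exact: encl_sub.
have eb' : encl ib' (bcoef R m + 1 / 25) by exact: encl_add.
have e2l : encl (imulZ 2 il) (2 * ln x) by rewrite -(ZR_nat R 2); exact: encl_mulZ.
have eq : encl iq (s + x + 2 * ln x) by apply: encl_add => //; exact: encl_add.
have ef1 : encl i1 f1.
  apply: encl_sub => //; apply: encl_add; first exact: encl_mulZ.
  by rewrite -MR -ZRM; exact: encl_int.
have ef2 : encl i2 (m%:R * x - K) by exact: encl_sub.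
have v0 : (0 <= iv.1)%ZZ.
  refine (Z.le_trans _ _ _ (Z.mul_nonneg_nonneg 3 _ _ (Z.lt_le_incl _ _ scale_pos)) c5).
  exact: Zle_0_pos.
split.
- have : encl (iint 2) (2 : R) by exact: (encl_nat R 2).
  move=> e2; apply: le_trans (encl_le R (iint 2) ia _ _ c3 e2 ea).
  by clear; lra.
- exact (encl_ge0 R _ _ c4 eb).
- have e3 : encl (iint 3) (3 : R) by exact: (encl_nat R 3).
  exact (encl_le R (iint 3) iv _ _ c5 e3 ev).
- exact (encl_le R iK (iint (Z.of_nat m)) _ _ c13 eK eM).
split; [exact (encl_ge0 R _ _ c7 ef1)|exact (encl_ge0 R _ _ c8 ef2)|].
by apply: (encl_lt R _ _ _ _ c14); apply: encl_mul => //; apply: encl_mul.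
Qed.
End StarCheck.

(** * Polynomial estimates for $m\ge30$ and the bound for all $m\ge5$ *)

Section LargeCases.
Variable R : realType.
Implicit Types (M x k t j : R).

(* The inequality in [star_asymptotic] follows from
   [0 < M ^+ 3 * star_A + M ^+ 2 * star_B - M * star_C - star_D], where [3.4 <= x] and
   [29.9 e ^ (x - 3.4) <= M]. *)
Definition star_A x k : R :=
  (x ^+ 2 - (1 + k)) * (x - k) * (x ^+ 2 - x + (1 + k)) - x ^+ 4 * (x - (1 + k)).
Definition star_B x k : R :=
  (x ^+ 2 - (1 + k)) * (x - k) * (- (1 / 2) * x + 26 / 100)
  - x ^+ 2 * (x - (1 + k)) * (3 / 2 * x + 8 / 10) - x ^+ 4 * (3 / 2 * x - 13 / 10 - k).
Definition star_C x k : R :=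
  x ^+ 2 * (3 / 2 * x - 13 / 10 - k) * (3 / 2 * x + 8 / 10) + x ^+ 4 * (x + 114 / 100).
Definition star_D x : R := x ^+ 2 * (x + 114 / 100) * (3 / 2 * x + 8 / 10).

(** In the shifted variables the claim is a nonnegative combination of the products $t^n$, $t^nj$,
    $t^nj^3$ and $t^n(j/2-j^2)$, where the last encodes $j\le1/2$; it is thus linear in
    monomials. *)
Lemma star_poly t j : 0 <= t -> 0 <= j <= 1 / 2 ->
  let x := 34 / 10 + t in let k := 1 / 2 + j in
  0 < star_A x k /\
  0 < 299 / 10 * (1 + t + t ^+ 2 / 2 + t ^+ 3 / 6) * star_A x k + star_B x k
      - star_C x k / 29 - star_D x / 29 ^+ 2.
Proof.
move=> t0 /andP[j0 j1] x k.
have J n : 0 <= t ^+ n * j by rewrite mulr_ge0// exprn_ge0.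
have T n : 0 <= t ^+ n by rewrite exprn_ge0.
have J2 n : 0 <= t ^+ n * (j / 2 - j ^+ 2).
  by rewrite mulr_ge0 ?exprn_ge0//; clear -j0 j1; nra.
have J3 n : 0 <= t ^+ n * j ^+ 3 by rewrite mulr_ge0 ?exprn_ge0.
split.
  move: (T 1%N) (T 2%N) (T 3%N) (J 0%N) (J 1%N) (J 2%N) (J 3%N) (J2 0%N) (J2 1%N) (J3 0%N).
  by rewrite /star_A /x /k; clear; lra.
move: (T 1%N) (T 2%N) (T 3%N) (T 4%N) (T 5%N) (T 6%N).
move: (J 0%N) (J 1%N) (J 2%N) (J 3%N) (J 4%N) (J 5%N) (J 6%N).
move: (J2 0%N) (J2 1%N) (J2 2%N) (J2 3%N) (J2 4%N) (J3 0%N) (J3 1%N) (J3 2%N) (J3 3%N).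
by rewrite /star_A /star_B /star_C /star_D /x /k; clear; lra.
Qed.

(** [lx], [lh] and [lm] stand for $\ln x$, $\ln(x+1/2)$ and $\ln(m+1)$ with $M=m$ and $x=\ln m$. As
    independent variables with affine bounds they leave, after multiplication by $x^2$, an
    inequality cubic in $M$. *)
Lemma star_asymptotic M x k lx lh lm :
  34 / 10 <= x -> 1 / 2 <= k <= 1 -> 29 <= M ->
  299 / 10 * (1 + (x - 34 / 10) + (x - 34 / 10) ^+ 2 / 2 + (x - 34 / 10) ^+ 3 / 6) <= M ->
  lx <= 4 / 10 + x / 4 -> 0 <= lx -> 13 / 10 <= lh -> lh <= x -> 0 <= lm -> lm <= x + M^-1 ->
  let U := M * x - M + x / 2 - lh in
  let a := 1 + U - k * M in
  let b := (M + 1) * lm + M * U - (M + 1) * (k * M) in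
  let s := M * x ^+ 2 in
  let v := s - a - 1 / 25 in
  [/\ 3 / 2 <= a, 0 <= b, 3 <= v &
   (b + 1 / 25) * (s + x + 2 * lx) <
     (1 - (1 + k) / x ^+ 2) * (1 - k / x) * (M ^+ 2 * x) * v].
Proof.
move=> x34 /andP[k1 k2] M29 Mt hlx lx0 h1 h2 lm0 hlm U a b s v.
have x0 : 0 < x by clear -x34; lra.
have M0 : 0 < M by clear -M29; lra.
have p1 : 29 * (x - 2) <= M * (x - 1 - k).
  apply: ler_pM => //; clear -x34 k2; lra.
have aE : a = M * (x - 1 - k) + 1 + x / 2 - lh by rewrite /a /U; ring.
have a32 : 3 / 2 <= a by rewrite aE; clear -p1 x34 h2; lra.
have b0 : 0 <= b.
  have q1 : 0 <= (M + 1) * lm by rewrite mulr_ge0// addr_ge0// ltW.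
  have q2 : 0 <= M * (M * (x - 1 - k) - x / 2 - k).
    by apply: mulr_ge0; [exact: ltW|clear -p1 x34 k2; lra].
  have q3 : M * lh <= M * x by rewrite ler_pM2l.
  rewrite /b /U; clear -q1 q2 q3; lra.
have vlow : M * (x ^+ 2 - x + (1 + k)) - x / 2 + 26 / 100 <= v.
  by rewrite /v /s aE; clear -h1; lra.
have v3 : 3 <= v.
  apply: le_trans vlow.
  have : 29 * (2 * x) <= M * (x ^+ 2 - x + (1 + k)).
    by apply: ler_pM => //; clear -x34 k1; nra.
  clear -x34; lra.
split=> //.
have t0 : 0 <= x - 34 / 10 by rewrite subr_ge0.
have j01 : 0 <= k - 1 / 2 <= 1 / 2 by clear -k1 k2; lra.
have := star_poly _ _ t0 j01.
have -> : 34 / 10 + (x - 34 / 10) = x by ring.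
have -> : 1 / 2 + (k - 1 / 2) = k by ring.
move=> [A0 tot].
have c1 : 0 <= 3 / 2 * x - 13 / 10 - k by clear -x34 k2; lra.
have C0 : 0 <= star_C x k.
  rewrite /star_C; apply: addr_ge0; last by rewrite mulr_ge0 ?exprn_ge0 ?(ltW x0)//; clear -x0; lra.
  by rewrite mulr_ge0 ?mulr_ge0 ?exprn_ge0 ?(ltW x0)//; clear -x0; lra.
have D0 : 0 <= star_D x.
  by rewrite /star_D mulr_ge0 ?mulr_ge0 ?exprn_ge0 ?(ltW x0)//; clear -x0; lra.
have G0 : 0 < M ^+ 3 * star_A x k + M ^+ 2 * star_B x k - M * star_C x k - star_D x.
  have g1 := ler_wpM2r (ltW A0) Mt.
  have g2 : 0 < M * star_A x k + star_B x k - star_C x k / 29 - star_D x / 29 ^+ 2.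
    by apply: lt_le_trans tot _; move: g1; clear; lra.
  have g3 : M * star_C x k <= M ^+ 2 * (star_C x k / 29).
    have := ler_wpM2r (mulr_ge0 (ltW M0) C0) M29; clear; lra.
  have g4 : star_D x <= M ^+ 2 * (star_D x / 29 ^+ 2).
    have m2 : 29 ^+ 2 <= M ^+ 2 by rewrite lerXn2r// nnegrE// ltW.
    have := ler_wpM2r D0 m2; clear; lra.
  have M2 : 0 < M ^+ 2 by rewrite exprn_gt0.
  have := mulr_gt0 M2 g2; move: g3 g4; clear; lra.
have bup : b + 1 / 25 <= M ^+ 2 * (x - 1 - k) + M * (3 / 2 * x - 13 / 10 - k) + (x + 114 / 100).
  have i1 : M^-1 <= 29^-1 by rewrite lef_pV2 ?posrE//; clear; lra.
  have i2 : (M + 1) * lm <= (M + 1) * x + 1 + M^-1.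
    apply: (@le_trans _ _ ((M + 1) * (x + M^-1))).
      by rewrite ler_pM2l//; clear -M0; lra.
    by rewrite le_eqVlt; apply/orP; left; apply/eqP; field; rewrite gt_eqF.
  have i3 : M * (13 / 10) <= M * lh by rewrite ler_pM2l.
  by move: i1 i2 i3; rewrite /b /U; move: M^-1 => I; clear; lra.
have qup : s + x + 2 * lx <= M * x ^+ 2 + (3 / 2 * x + 8 / 10).
  by rewrite /s; clear -hlx; lra.
have q0 : 0 <= s + x + 2 * lx.
  by rewrite !addr_ge0 ?mulr_ge0 ?sqr_ge0 ?(ltW x0) ?(ltW M0).
have lhs := ler_pM (addr_ge0 b0 (_ : 0 <= 1 / 25)) q0 bup qup.
have f0 : 0 <= M ^+ 2 * ((x ^+ 2 - (1 + k)) * (x - k)).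
  rewrite mulr_ge0 ?sqr_ge0// mulr_ge0//; clear -x34 k2; nra.
have rhs := ler_wpM2l f0 vlow.
have x2 : 0 < x ^+ 2 by rewrite exprn_gt0.
have -> : (1 - (1 + k) / x ^+ 2) * (1 - k / x) * (M ^+ 2 * x) * v =
    M ^+ 2 * ((x ^+ 2 - (1 + k)) * (x - k)) * v / x ^+ 2 by field; rewrite gt_eqF.
rewrite ltr_pdivlMr//; apply: lt_le_trans rhs.
apply: le_lt_trans (ler_wpM2r (ltW x2) (lhs _)) _; first by clear; lra.
by rewrite -subr_gt0; apply: lt_le_trans G0 _; rewrite /star_A /star_B /star_C /star_D; clear; lra.
Qed.

(** The primes $2,3,5$ suffice: their share tends to more than $0.6\,m$, and rounding down costs
    each prime a bounded multiple of $\ln p/(p-1)$. *)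
Lemma ksum_ge m : (30 <= m)%N -> 1 / 2 * m%:R <= ksum R m.
Proof.
move=> m30; pose F p : R := (minfloor m p)%:R * (ln (p%:R : R) / (p%:R - 1)).
have F0 p : prime p -> 0 <= F p.
  by move=> pp; rewrite mulr_ge0// divr_ge0// ltW ?ln_nat_prime ?natr_prime_gt1.
have -> : ksum R m = \sum_(0 <= p < ((m.+1)./2).+1 | prime p) F p by rewrite big_mkord.
have h6 : (6 <= ((m.+1)./2).+1)%N by rewrite -divn2; lia.
rewrite (big_cat_nat _ (n := 6))//=.
apply: (@le_trans _ _ (\sum_(0 <= p < 6 | prime p) F p)); last first.
  by rewrite lerDl; apply: sumr_ge0 => p /F0.
rewrite big_mkcond /= !big_nat_recl//= big_geq//.
have NF p (q : R) : (0 < p)%N -> (p <= 5)%N -> 0 <= q -> ((m%:R + 2) / p%:R - 2) * q <= (minfloor m p)%:R * q.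
  move=> p0 p5 q0; rewrite ler_wpM2r// minfloorE//; last by lia.
  have P0 : 0 < (p%:R : R) by rewrite ltr0n.
  rewrite lerBlDr ler_pdivrMr// -!natrD -natrM ler_nat.
  have := ltn_ceil m.+1 p0; have : (0 < m.+1 %/ p)%N by rewrite divn_gt0//; lia.
  by move: (m.+1 %/ p)%N => d; nia.
have l2 : 69%:R / 100%:R <= ln (2%:R : R) by ln_num.
have l3 : 109%:R / 100%:R <= ln (3%:R : R) by ln_num.
have l5 : 160%:R / 100%:R <= ln (5%:R : R) by ln_num.
have M30 : 30 <= (m%:R : R) by rewrite (ler_nat _ 30).
have q0 (p : nat) : prime p -> 0 <= ln (p%:R : R) / (p%:R - 1).
  by move=> pp; rewrite divr_ge0// ltW ?ln_nat_prime ?natr_prime_gt1.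
have b2 := NF 2%N _ isT isT (q0 2%N isT); have b3 := NF 3%N _ isT isT (q0 3%N isT).
have b5 := NF 5%N _ isT isT (q0 5%N isT).
have r2 := ler_wpM2l (_ : 0 <= (m%:R + 2) / 2%:R - 2) l2.
have r3 := ler_wpM2l (_ : 0 <= (m%:R + 2) / 3%:R - 2) l3.
have r5 := ler_wpM2l (_ : 0 <= (m%:R + 2) / 5%:R - 2) l5.
have {}r2 := r2 (_ : _); have {}r3 := r3 (_ : _); have {}r5 := r5 (_ : _).
have s2 := r2 ltac:(clear -M30; lra); have s3 := r3 ltac:(clear -M30; lra).
have s5 := r5 ltac:(clear -M30; lra).
have d2 : 2%:R - 1 = 1 :> R by clear; lra.
have d3 : 3%:R - 1 = 2 :> R by clear; lra.
have d5 : 5%:R - 1 = 4 :> R by clear; lra.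
rewrite /F; move: b2 b3 b5; rewrite d2 d3 d5.
by move: s2 s3 s5 M30; clear; lra.
Qed.

Lemma expR_ge_cubic t : 0 <= t -> 1 + t + t ^+ 2 / 2 + t ^+ 3 / 6 <= expR t.
Proof.
move=> t0.
have step (f df : R -> R) : f 0 = 1 -> (forall x, is_derive x (1 : R) f (df x)) ->
    (forall x, 0 <= x -> df x <= expR x) -> forall x, 0 <= x -> f x <= expR x.
  move=> f0 fd dfle x x0.
  have : expR 0 - f 0 <= expR x - f x.
    apply: (@is_derive_le R (fun y => expR y - f y) (fun y => expR y - df y))=> //.
    by move=> y /andP[y0 _]; rewrite subr_ge0 dfle.
  by rewrite f0 expR0 subrr subr_ge0.
have := step (fun t => 1 + t + t ^+ 2 / 2 + t ^+ 3 / 6) (fun t => 1 + t + t ^+ 2 / 2).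
apply=> //; first by ring.
  by move=> x; der; rewrite /GRing.scale /=; field.
have := step (fun t => 1 + t + t ^+ 2 / 2) (fun t => 1 + t); apply=> //; first by ring.
  by move=> x; der; rewrite /GRing.scale /=; field.
by move=> x _; exact: expR_ge1Dx.
Qed.

Lemma w_le1 (y z : R) : 1 < y -> 1 <= z -> w_ y z <= 1.
Proof.
move=> y1 z1; rewrite /w_; have z0 : 0 < z by apply: lt_le_trans z1.
have y0 : 0 < y by apply: lt_trans y1.
have h1 : 0 <= y / z by rewrite divr_ge0 ?ltW.
have h2 : 0 <= (y - 1) / ln y * (ln z / z).
  by apply: mulr_ge0; apply: divr_ge0; [rewrite subr_ge0 ltW|exact: ltW (ln_gt0 y1)|exact: ln_ge0|exact: ltW].
by move: h1 h2; clear; lra.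
Qed.

Lemma kappa_le m : (2 <= m)%N -> kappa_ R m <= ksum R m / m%:R.
Proof.
move=> m2; have m0 : 0 < (m%:R : R) by rewrite ltr0n (leq_trans _ m2).
rewrite /kappa_ /ksum mulrC; apply: ler_wpM2r; first by rewrite invr_ge0 ltW.
apply: ler_sum => p pp.
have p1 : 1 < (p%:R : R) by rewrite ltr1n prime_gt1.
rewrite ler_piMr//.
  by rewrite mulr_ge0// divr_ge0// ltW ?ln_nat_prime ?natr_prime_gt1.
apply: w_le1 => //.
have [->|m3] := eqVneq m 2%N.
  have e1 : 1 <= expR 1 :> R by rewrite -expR0 ler_expR.
  by rewrite /s_ /= /euler; apply: mulr_ege1 => //; rewrite -expR0 ler_expR expR_ge0.
rewrite /s_ (negPf m3).
have l3 : 1 <= ln (m%:R : R).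
  have e3 : 109%:R / 100%:R <= ln (3%:R : R) by ln_num.
  have : ln (3%:R : R) <= ln m%:R.
    by rewrite ler_ln ?posrE// ler_nat; move: m2 m3; clear; lia.
  by move: e3; clear; lra.
have s1 : 1 <= m%:R * ln m%:R ^+ 2 :> R.
  by apply: mulr_ege1; [rewrite ler1n (leq_trans _ m2)|rewrite exprn_ege1].
by apply: mulr_ege1 => //; rewrite -[leLHS]expR0 ler_expR; apply: le_trans s1.
Qed.

(** The bound is first proved with $k=K/m\ge\kappa_m$ in place of $\kappa_m$. Both factors decrease
    in $k$ and stay nonnegative for $k\le1$, so passing to $\kappa_m$ weakens it. *)
Lemma omega_le_bound_ge5 m (H : R) : (5 <= m)%N -> ksum R m <= m%:R ->
  s_ R m * expR (s_ R m) <= ln H -> omega m H <= omega_bound m H.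
Proof.
move=> m5 Km hH; set x : R := ln m%:R; set k := ksum R m / m%:R; set L := ln (ln H).
have m2 : (2 <= m)%N by rewrite (leq_trans _ m5).
have m0 : 0 < (m%:R : R) by rewrite ltr0n (leq_trans _ m5).
have sE : s_ R m = m%:R * x ^+ 2 by rewrite /s_ ifF//; apply/eqP => m2'; rewrite m2' in m5.
rewrite sE in hH; have /andP[x1 x2] := ln_nat_le_third R _ m5; rewrite -/x in x1 x2.
have x0 : 0 < x by apply: lt_le_trans x1.
have KE : ksum R m = k * m%:R by rewrite divfK// gt_eqF.
have k1 : k <= 1 by rewrite ler_pdivrMr// mul1r.
have kk : kappa_ R m <= k by exact: kappa_le.
pose d (q : R) : R := if (m <= 14)%N then 2 * q else 1 + q.
have d_le q : q <= 1 -> 0 <= 1 - d q / x ^+ 2.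
  have x22 : 2 <= x ^+ 2 by move: x1; clear; nra.
  have x20 : 0 < x ^+ 2 by apply: lt_le_trans x22.
  move=> q1; rewrite subr_ge0 ler_pdivrMr// mul1r; apply: le_trans x22.
  by rewrite /d; case: ifP => _; move: q1; clear; lra.
have dx q : q <= 1 -> 0 <= 1 - q / x.
  by move=> q1; rewrite subr_ge0 ler_pdivrMr// mul1r; apply: (le_trans q1); move: x1; clear; lra.
pose beta q := (1 - d q / x ^+ 2) * (1 - q / x) * (m%:R ^+ 2 * x).
have x2p : 0 < x ^+ 2 by rewrite exprn_gt0.
have gen : omega m H <= m%:R + beta k / L.
  have [m30|m29] := leqP 30 m.
    have lE : d k = 1 + k by rewrite /d leqNgt (leq_trans _ m30).
    have M30 : 30 <= (m%:R : R) by rewrite (ler_nat _ 30).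
    have l30 : 3401%:R / 1000%:R <= ln (30%:R : R) by ln_num.
    have l30' : ln (30%:R : R) <= 3402%:R / 1000%:R by ln_num.
    have x30 : ln (30%:R : R) <= x by rewrite ler_ln ?posrE.
    have x34 : 34 / 10 <= x by move: l30 x30; clear; lra.
    have t0 : 0 <= x - 34 / 10 by rewrite subr_ge0.
    (* $\ln30\approx3.4012$ barely exceeds $3.4$, so the first two factors are at least $29.9$, the
       constant in [star_poly]. *)
    have mE : m%:R = 30%:R * expR (- (ln 30%:R - 34 / 10)) * expR (x - 34 / 10) :> R.
      rewrite -mulrA -expRD -[X in _ = X * _](lnK (_ : _ \is Num.pos)) ?posrE// -expRD.
      by rewrite [X in expR X](_ : _ = x) ?lnK ?posrE//; ring.
    have exp3 : 1 + (x - 34 / 10) + (x - 34 / 10) ^+ 2 / 2 + (x - 34 / 10) ^+ 3 / 6 <= expR (x - 34 / 10).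
      exact: expR_ge_cubic.
    have Mt : 299 / 10 * (1 + (x - 34 / 10) + (x - 34 / 10) ^+ 2 / 2 + (x - 34 / 10) ^+ 3 / 6) <= m%:R.
      rewrite mE; apply: ler_pM; [by clear; lra| |  |exact: exp3].
        by move: (x - 34 / 10) t0 => t t0; rewrite !addr_ge0 ?divr_ge0 ?exprn_ge0.
      have := expR_ge1Dx (- (ln (30%:R : R) - 34 / 10)); move: l30'; clear; lra.
    have k12 : 1 / 2 <= k <= 1 by rewrite k1 andbT /k ler_pdivlMr// ksum_ge.
    have M29 : 29 <= (m%:R : R) by move: M30; clear; lra.
    have x40 : 0 < 4 :> R by [].
    have lx1 : ln x <= 4 / 10 + x / 4.
      have l4 : ln (4%:R : R) <= 14%:R / 10%:R by ln_num.
      by have := @ln_le_tangent R 4 x x40 x0; move: l4; clear; lra.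
    have lx0 : 0 <= ln x by apply: ln_ge0; move: x34; clear; lra.
    have lh1 : 13 / 10 <= ln (x + 1 / 2).
      have e1 : 39 / 10 <= x + 1 / 2 by move: x34; clear; lra.
      have l39 : 366%:R / 100%:R <= ln (39%:R : R) by ln_num.
      have l10 : ln (10%:R : R) <= 231%:R / 100%:R by ln_num.
      have : ln (39 / 10) <= ln (x + 1 / 2) by rewrite ler_ln ?posrE//; apply: lt_le_trans e1.
      by rewrite ln_div ?posrE//; move: l39 l10; clear; lra.
    have lh2 : ln (x + 1 / 2) <= x.
      have -> : x + 1 / 2 = 1 + (x - 1 / 2) by clear; lra.
      by apply: le_trans (le_ln1Dx _) _; move: x0; clear; lra.
    have lm0 : 0 <= ln (m.+1%:R : R) by rewrite ln_ge0// ler1n.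
    have lm1 : ln (m.+1%:R : R) <= x + m%:R^-1.
      have := @ln_le_tangent R m%:R m.+1%:R m0 (ltr0n _ _); rewrite -/x -natr1.
      by rewrite mulrDl mulfV ?gt_eqF// mul1r; move: m%:R^-1 => I; clear; lra.
    have [a1 b1 v1 star] := star_asymptotic _ _ _ _ _ _ x34 k12 M29 Mt lx1 lx0 lh1 lh2 lm0 lm1.
    have aE : acoef R m = 1 + (m%:R * x - m%:R + x / 2 - ln (x + 1 / 2)) - k * m%:R.
      by rewrite /acoef /lnsup KE.
    have bE : bcoef R m = (m%:R + 1) * ln m.+1%:R + m%:R * (m%:R * x - m%:R + x / 2 - ln (x + 1 / 2)) - (m%:R + 1) * (k * m%:R).
      by rewrite /bcoef /lnsup KE natr1.
    apply: omega_le_generic => //; rewrite -/x ?aE ?bE//.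
    by rewrite /beta lE.
  have chk : if (m <= 14)%N then star_check m 2 0 else star_check m 1 1.
    have : all_star_checks by vm_compute.
    by move=> /allP /(_ m); apply; rewrite mem_iota m5 m29.
  have [a1 b1 v1 star] : [/\ 3 / 2 <= acoef R m, 0 <= bcoef R m, 3 <= m%:R * x ^+ 2 - acoef R m - 1 / 25 &
     (bcoef R m + 1 / 25) * (m%:R * x ^+ 2 + x + 2 * ln x) * x ^+ 2 <
     (m%:R * x ^+ 2 - d k * m%:R) * (m%:R * x - ksum R m) * (m%:R * x ^+ 2 - acoef R m - 1 / 25)].
    move: chk; rewrite /d; case: ifP => _ chk.
      have [c1 c2 c3 _ [_ _ c4]] := star_checkP R m _ _ m2 (Z.le_0_2) chk.
      split=> //; move: c4; rewrite (ZR_nat R 2) (ZR0 R) mul0r addr0 -/x.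
      by rewrite -[2 * k * m%:R]mulrA -KE.
    have [c1 c2 c3 _ [_ _ c4]] := star_checkP R m _ _ m2 (Z.le_0_1) chk.
    split=> //; move: c4; rewrite (ZR1 R) !mul1r -/x.
    by rewrite [(1 + k) * _]mulrDl mul1r -KE [_ + ksum R m]addrC.
  apply: omega_le_generic => //; rewrite -/x.
  have -> : beta k * (m%:R * x ^+ 2 - acoef R m - 1 / 25) = (m%:R * x ^+ 2 - d k * m%:R) *
      (m%:R * x - ksum R m) * (m%:R * x ^+ 2 - acoef R m - 1 / 25) / x ^+ 2.
    by rewrite /beta KE; field; rewrite gt_eqF.
  by rewrite ltr_pdivlMr.
apply: (le_trans gen).
have -> : omega_bound m H = m%:R + beta (kappa_ R m) / L.
  rewrite /omega_bound ifF; last by apply/eqP => mE; rewrite mE in m5.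
  rewrite ifF; last by apply/eqP => mE; rewrite mE in m5.
  rewrite ifF; last by apply/eqP => mE; rewrite mE in m5.
  by rewrite /beta /d; case: ifP => _; rewrite -/x -/L !mulrA.
rewrite lerD2l; have L0 : 0 < L.
  apply: ln_gt0; apply: lt_le_trans hH.
  have m5R : 5 <= (m%:R : R) by rewrite (ler_nat _ 5).
  have y1 : 1 < m%:R * x ^+ 2 by move: x1 m5R; clear; nra.
  by apply: mulr_egt1 => //; apply: lt_le_trans (expR_ge1Dx _); rewrite ltrDl; exact: lt_trans y1.
rewrite ler_pM2r ?invr_gt0// /beta ler_wpM2r ?mulr_ge0 ?sqr_ge0 ?(ltW x0)//.
have kk1 : kappa_ R m <= 1 by apply: le_trans k1.
apply: ler_pM; [exact: d_le|exact: dx| |].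
  rewrite lerD2l lerN2 ler_pM2r ?invr_gt0// /d; case: ifP => _; move: kk; clear; lra.
by rewrite lerD2l lerN2 ler_pM2r ?invr_gt0.
Qed.
End LargeCases.

(** * The cases $m=2$ and $m=3$ *)

Section SmallCases.
Variable R : realType.

Lemma ln_natD_le (x d : R) : 0 < x -> 0 <= d -> ln (x + d) <= ln x + d / x.
Proof.
move=> x0 d0; have := @ln_le_tangent R x (x + d) x0 (ltr_wpDr d0 x0).
by rewrite mulrDl divff ?gt_eqF// [1 + _]addrC addrK.
Qed.

Lemma ln_natV (p q : nat) : (0 < p)%N -> (0 < q)%N -> ln (p%:R / q%:R) = ln p%:R - ln q%:R :> R.
Proof. by move=> p0 q0; rewrite ln_div ?posrE ?ltr0n. Qed.

(** Tangents at $n$ bound the growth of the logarithms beyond $n$; the slopes add up to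
    $(\frac32m+(m+1)w)/n$, so one check at $n$ serves all larger $l$. *)
Lemma err_form_linear m n l (k0 a w eta : R) : (0 < n)%N -> (n <= l)%N -> 0 <= w -> (0 < m)%N ->
  3 / 2 * m%:R + m.+1%:R * w <= eta * n%:R ->
  err_form R m k0 a w 1 n <= eta * n%:R -> err_form R m k0 a w 1 l <= eta * l%:R.
Proof.
move=> n0 nl w0 m0 slope; pose d : R := (l - n)%:R.
have d0 : 0 <= d by rewrite ler0n.
have N0 : 0 < (n%:R : R) by rewrite ltr0n.
have lE : l%:R = n%:R + d :> R by rewrite /d -natrD subnKC.
have t1 := ln_natD_le _ _ N0 d0.
have t2 : ln (l%:R + 1) <= ln (n%:R + 1) + d / n%:R :> R.
  rewrite lE addrAC; apply: le_trans (ln_natD_le _ _ (ltr_wpDr ler01 N0) d0) _.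
  by rewrite lerD2l ler_wpM2l// lef_pV2 ?posrE ?ltr_wpDr// lerDl.
have t3 : ln (m.+1 * l + m)%:R <= ln (m.+1 * n + m)%:R + d / n%:R :> R.
  have e : (m.+1 * l + m)%:R = (m.+1 * n + m)%:R + m.+1%:R * d :> R.
    by rewrite !natrD !natrM lE; ring.
  have M0 : 0 < ((m.+1 * n + m)%:R : R) by rewrite ltr0n addn_gt0 m0 orbT.
  rewrite e; apply: le_trans (ln_natD_le _ _ M0 _) _; first exact: mulr_ge0.
  rewrite lerD2l ler_pdivrMr// mulrAC ler_pdivlMr// mulrAC [d * _]mulrC ler_wpM2r//.
  by rewrite -natrM ler_nat leq_addr.
have M1 : 1 <= (m%:R : R) by rewrite ler1n.
have u1 := ler_wpM2l (_ : 0 <= m%:R - m.+1%:R / 2) t1.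
have u2 := ler_wpM2l (mulr_ge0 (ler0n R m.+1) w0) t2.
have u3 := ler_wpM2l (_ : 0 <= m%:R + 1 / 2) t3.
have {}u1 := u1 (_ : _); have {}u3 := u3 (_ : _).
have h : (3 / 2 * m%:R + m.+1%:R * w) * (d / n%:R) <= eta * n%:R * (d / n%:R).
  by apply: ler_wpM2r slope; rewrite divr_ge0.
have {}h : (3 / 2 * m%:R + m.+1%:R * w) * (d / n%:R) <= eta * d.
  by apply: (le_trans h); rewrite mulrA mulrAC mulfK ?gt_eqF.
have v1 := u1 ltac:(rewrite -natr1; move: M1; clear; lra).
have v3 := u3 ltac:(move: M1; clear; lra).
have e1 : l%:R = n%:R + d :> R by [].
rewrite /err_form !mul1r; move: v1 u2 v3 h; rewrite e1 -natr1.
move: (d / n%:R) => q v1 u2 v3 h; clear -v1 u2 v3 h; lra.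
Qed.

Lemma err_gain_linear n l (k0 a w eps : R) : (0 < n)%N -> (n <= l)%N -> 0 <= w ->
  1 / 2 + w <= eps * n%:R ->
  err_gain R k0 a w 1 n <= eps * n%:R -> err_gain R k0 a w 1 l <= eps * l%:R.
Proof.
move=> n0 nl w0 slope; pose d : R := (l - n)%:R.
have d0 : 0 <= d by rewrite ler0n.
have N0 : 0 < (n%:R : R) by rewrite ltr0n.
have lE : l%:R = n%:R + d :> R by rewrite /d -natrD subnKC.
have t1 := ln_natD_le _ _ N0 d0.
have t2 : ln (l%:R + 1) <= ln (n%:R + 1) + d / n%:R :> R.
  rewrite lE addrAC; apply: le_trans (ln_natD_le _ _ (ltr_wpDr ler01 N0) d0) _.
  by rewrite lerD2l ler_wpM2l// lef_pV2 ?posrE ?ltr_wpDr// lerDl.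
have u2 := ler_wpM2l w0 t2.
have h : (1 / 2 + w) * (d / n%:R) <= eps * d.
  have := ler_wpM2r (divr_ge0 d0 (ltW N0)) slope.
  have -> : eps * n%:R * (d / n%:R) = eps * d by field; rewrite gt_eqF.
  by [].
rewrite /err_gain !mul1r; move: t1 u2 h; rewrite lE.
by move: (d / n%:R) => q t1 u2 h; clear -t1 u2 h; lra.
Qed.

Lemma gain_small n l (a w : R) : (0 < l)%N -> (l <= n)%N -> 0 <= w -> a <= ln n%:R ->
  gain R a w 1 l <= n%:R * (ln n%:R - a) + ln n%:R / 2 + 9 / 10.
Proof.
move=> l0 ln_ w0 an; have n0 : (0 < n)%N by apply: leq_trans ln_.
have l1 : ln (l%:R : R) <= ln n%:R by rewrite ler_ln ?posrE ?ltr0n// ler_nat.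
have W0 : 0 <= w * ln (1 * (l%:R + 1)) by rewrite mulr_ge0// ln_ge0// mul1r lerDr.
have h : l%:R * (ln l%:R - a) <= n%:R * (ln n%:R - a).
  apply: (@le_trans _ _ (l%:R * (ln n%:R - a))); first by rewrite ler_wpM2l// lerD2r.
  by rewrite ler_wpM2r ?subr_ge0// ler_nat.
by rewrite /gain; move: l1 W0 h; clear; lra.
Qed.

Lemma omega_le_small m n r (H mu nu w beta eps eta v1 : R) :
  let K := ksum R m in
  let a := 1 + ln mu - K in
  let b := m.+1%:R * ln m.+1%:R + m%:R * ln mu - m.+1%:R * K in
  let k0 := ln (2 * rem_const R m * nu) in
  (2 <= m)%N -> (2 * m <= n)%N -> (forall i, (r i <= m)%N) -> 0 < mu -> 1 <= nu -> 0 <= w ->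
  (forall x, 0 <= x <= m%:R -> `|(nodes R m).[x]| <= mu) ->
  (forall x k, 0 <= x <= m%:R -> (k <= m)%N -> `|(rootpoly R r k).[x]| <= nu) ->
  (forall l, kloss R m l <= w * ln (1 * (l%:R + 1))) ->
  1 < ln H -> 0 <= beta -> a <= ln n%:R ->
  n%:R * (ln n%:R - a) + ln n%:R / 2 + 9 / 10 < ln H ->
  3 / 2 * m%:R + m.+1%:R * w <= eta * n.+1%:R -> err_form R m k0 a w 1 n.+1 <= eta * n.+1%:R ->
  1 / 2 + w <= eps * n.+1%:R -> err_gain R k0 a w 1 n.+1 <= eps * n.+1%:R ->
  0 < v1 -> v1 + ln v1 <= ln (ln H) - a - eps -> 0 < b + eta ->
  (b + eta) * (a + eps + ln v1) < (beta - b - eta) * v1 ->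
  b + eta <= (beta - b - eta) * v1 ->
  omega m H <= m%:R + beta / ln (ln H).
Proof.
move=> K a b k0 m2 mn rm mu0 nu1 w0 hmu hnu hk H1 beta0 an small s1 e1 s2 e2 v10 hv1 be0 c1 c2.
have nu0 : 0 < nu by apply: lt_le_trans nu1.
have k00 : 0 <= k0.
  apply: ln_ge0; apply: mulr_ege1 => //.
  by have := rem_const_ge2 R m m2; clear; lra.
apply: (@omega_le R m n.+1 r H mu nu w 1 beta eps eta v1) => //.
- exact: leqW.
- by move: m2 mn; clear; lia.
- move=> l l0; rewrite ltnS => ll.
  have := gain_small n l a w l0 ll w0 an; move: small k00; rewrite -/a -/K -/k0; clear; lra.
- move=> l ll _; split; first by apply: (err_form_linear m n.+1) => //; exact: ltnW.
  exact: (err_gain_linear n.+1).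
Qed.

Lemma kloss2_le l : kloss R 2 l <= 0 * ln (1 * (l%:R + 1)).
Proof. by rewrite /kloss mul0r big_mkcond !big_ord_recr big_ord0 /= !addr0. Qed.

Lemma ksum2 : ksum R 2 = 0.
Proof. by rewrite /ksum big_mkcond !big_ord_recr big_ord0 /= !addr0. Qed.

Lemma ksum34 m : (3 <= m <= 4)%N -> ksum R m = ln 2.
Proof.
move=> m34; rewrite /ksum (_ : (m.+1)./2.+1 = 3%N); last by case/andP: m34; case: m => [|[|[|[|[|]]]]].
rewrite big_mkcond !big_ord_recr big_ord0 /= !add0r minfloorE//; last by case/andP: m34; lia.
rewrite (_ : (m.+1 %/ 2).-1 = 1%N); last by case/andP: m34; case: m => [|[|[|[|[|]]]]].
by rewrite mul1r [2%:R - 1](_ : _ = 1) ?divr1//; ring.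
Qed.

Lemma kloss34_le m l : (3 <= m <= 4)%N -> kloss R m l <= 1 * ln (1 * (l%:R + 1)).
Proof.
move=> m34; rewrite /kloss (_ : (m.+1)./2.+1 = 3%N); last by case/andP: m34; case: m => [|[|[|[|[|]]]]].
rewrite big_mkcond !big_ord_recr big_ord0 /= !add0r minfloorE//; last by case/andP: m34; lia.
rewrite (_ : (m.+1 %/ 2).-1.+1 = 2%N); last by case/andP: m34; case: m => [|[|[|[|[|]]]]].
rewrite [2%:R - 1](_ : _ = 1); last by ring.
rewrite divr1 !mul1r lerBlDr -lnM ?posrE// ?ler_ln ?posrE//; first by clear; lra.
Qed.

Lemma expR1_bounds : 27 / 10 <= (expR 1 : R) <= 11 / 4.
Proof.
have a1 : ln (27%:R : R) <= 330%:R / 100%:R by ln_num.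
have a2 : 230%:R / 100%:R <= ln (10%:R : R) by ln_num.
have a3 : 239%:R / 100%:R <= ln (11%:R : R) by ln_num.
have a4 : ln (4%:R : R) <= 139%:R / 100%:R by ln_num.
apply/andP; split.
  by rewrite -ler_ln ?posrE ?expR_gt0// expRK ln_div ?posrE//; move: a1 a2; clear; lra.
by rewrite -ler_ln ?posrE ?expR_gt0// expRK ln_div ?posrE//; move: a3 a4; clear; lra.
Qed.

Lemma rem_constS m : rem_const R m.+1 = rem_const R m + (expR 1 ^+ m.+1 - 1).
Proof. by rewrite /rem_const big_ord_recr /= -expRM_natl mulr1. Qed.

Lemma rem_const0 : rem_const R 0 = 0.
Proof. by rewrite /rem_const big_ord_recr big_ord0 /= expR0 subrr addr0. Qed.

Lemma ge_of_lnln (n : nat) (h q : R) : (0 < n)%N -> ln (n%:R : R) <= q -> q <= ln h -> 0 < h -> n%:R <= h.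
Proof. by move=> n0 nq qh h0; rewrite -ler_ln ?posrE ?ltr0n//; apply: le_trans qh. Qed.

Lemma product_condition (b eta a beta v B Q : R) : 0 <= b + eta -> b + eta <= B -> a <= Q ->
  0 <= v -> 0 <= Q -> B * Q < (beta - B) * v -> (b + eta) * a < (beta - b - eta) * v.
Proof.
move=> b0 bB aQ v0 Q0 h; have h1 := ler_wpM2l b0 aQ; have h2 := ler_wpM2r Q0 bB.
by have h3 := ler_wpM2r v0 bB; move: h h1 h2 h3; clear; lra.
Qed.

Lemma omega_le_bound2 (H : R) : s_ R 2 * expR (s_ R 2) <= ln H -> omega 2 H <= omega_bound 2 H.
Proof.
rewrite /s_ eqxx /omega_bound eqxx /euler; have /andP[e1 e2] := expR1_bounds.
move: e1 e2; set e : R := expR 1 => e1 e2 hH.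
have e0 : 0 < e by exact: expR_gt0.
have h0 : 0 < ln H by apply: lt_le_trans hH; rewrite mulr_gt0 ?expR_gt0.
have L1 : 37 / 10 <= ln (ln H).
  have : ln (e * expR e) <= ln (ln H) by rewrite ler_ln ?posrE ?mulr_gt0 ?expR_gt0.
  by rewrite lnM ?posrE ?expR_gt0// /e !expRK -/e; move: e1; clear; lra.
have l40 : ln (40%:R : R) <= 369%:R / 100%:R by ln_num.
have hH40 : 40%:R <= ln H.
  by apply: (ge_of_lnln 40 _ (37 / 10) isT _ L1 h0); move: l40; clear; lra.
have l39 : ln (39%:R : R) <= 3664%:R / 1000%:R by ln_num.
have l39' : 3663%:R / 1000%:R <= ln (39%:R : R) by ln_num.
have l100 : ln (100%:R : R) <= 4606%:R / 1000%:R by ln_num.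
have l100' : 4605%:R / 1000%:R <= ln (100%:R : R) by ln_num.
have l3 : ln (3%:R : R) <= 1099%:R / 1000%:R by ln_num.
have l3' : 1098%:R / 1000%:R <= ln (3%:R : R) by ln_num.
have l14 : ln (14%:R : R) <= 264%:R / 100%:R by ln_num.
have l14' : 263%:R / 100%:R <= ln (14%:R : R) by ln_num.
have l15 : ln (15%:R : R) <= 271%:R / 100%:R by ln_num.
have l15' : 270%:R / 100%:R <= ln (15%:R : R) by ln_num.
have l17 : ln (17%:R : R) <= 284%:R / 100%:R by ln_num.
have l47 : ln (47%:R : R) <= 386%:R / 100%:R by ln_num.
have l2 : ln (2%:R : R) <= 70%:R / 100%:R by ln_num.
have l5' : 160%:R / 100%:R <= ln (5%:R : R) by ln_num.
have mu0 : 0 < 39 / 100 :> R by [].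
have lmu : ln (39 / 100) = ln 39%:R - ln 100%:R :> R by rewrite ln_div ?posrE.
have rc : rem_const R 2 = e + e ^+ 2 - 2.
  by rewrite !rem_constS rem_const0 expr1 -/e; ring.
have rc2 := rem_const_ge2 R 2 isT.
have k0 : ln (2 * rem_const R 2 * 1) <= 284 / 100.
  rewrite mulr1; apply: le_trans l17; rewrite ler_ln ?posrE//; last by move: rc2; clear; lra.
  by rewrite rc; move: e2 e0; clear; nra.
have lv : ln (12 / 5) <= 91 / 100 :> R.
  have -> : 12 / 5 = 2 * 2 * 3 / 5 :> R by field.
  by rewrite ln_div ?lnM ?posrE//; move: l2 l3 l5'; clear; lra.
(* At $l=14$ the gain is still below $40\le\ln H$, so $l\ge15$; there $3/10$ and $13/10$ bound the
   errors per unit of $l$. The value $12/5$ nearly solves $v+\ln v=3.7-a-0.3$. Powers of $X-1$ have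
   norm at most $1$. *)
apply: (@omega_le_small 2 14 (fun=> 1%N) H (39 / 100) 1 0 (493%:R / 100%:R) (3 / 10) (13 / 10) (12 / 5)).
- exact: isT.
- exact: isT.
- exact: (fun=> isT).
- exact: mu0.
- exact: lexx.
- exact: lexx.
- exact: nodes2_norm_le.
- by move=> x k x2 _; exact: rootpoly2_norm_le.
- exact: kloss2_le.
- by move: hH40; clear; lra.
- by clear; lra.
- by rewrite ksum2 lmu; move: l39 l100' l14'; clear; lra.
- by rewrite ksum2 lmu; move: l39 l39' l100 l100' l14 l14' hH40; clear; lra.
- by clear; lra.
- by rewrite ksum2 lmu /err_form; move: k0 l39' l100 l15 l15' l47 l2; rewrite ?mul0r; clear; lra.
- by clear; lra.
- by rewrite ksum2 lmu /err_gain; move: k0 l39' l100 l15; rewrite ?mul0r; clear; lra.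
- by clear; lra.
- by rewrite ksum2 lmu; move: lv L1 l39 l100'; clear; lra.
- by rewrite ksum2 lmu; move: l3' l39' l100; clear; lra.
- apply: (@product_condition _ _ _ _ _ (28 / 10) (14 / 10)); rewrite ?ksum2 ?lmu.
  + by move: l3' l39' l100; clear; lra.
  + by move: l3 l39 l100'; clear; lra.
  + by move: lv l39 l100'; clear; lra.
  + by clear; lra.
  + by clear; lra.
  + by clear; lra.
- by rewrite ksum2 lmu; move: l3 l39 l100'; clear; lra.
Qed.

Lemma omega_le_bound3 (H : R) : s_ R 3 * expR (s_ R 3) <= ln H -> omega 3 H <= omega_bound 3 H.
Proof.
have -> : omega_bound 3 H = 3%:R + (649%:R / 100%:R) / ln (ln H) by [].
have -> : s_ R 3 = 3%:R * ln 3%:R ^+ 2 by [].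
set s : R := 3%:R * ln 3%:R ^+ 2 => hH.
have [e1 e2] := andP expR1_bounds.
move: e1 e2; set e : R := expR 1 => e1 e2.
have e0 : 0 < e by exact: expR_gt0.
have l2 : ln (2%:R : R) <= 694%:R / 1000%:R by ln_num.
have l2' : 693%:R / 1000%:R <= ln (2%:R : R) by ln_num.
have l3 : 769%:R / 700%:R <= ln (3%:R : R) by ln_num.
have l4 : ln (4%:R : R) <= 1387%:R / 1000%:R by ln_num.
have l4' : 1386%:R / 1000%:R <= ln (4%:R : R) by ln_num.
have l39 : ln (39%:R : R) <= 3664%:R / 1000%:R by ln_num.
have l39' : 3663%:R / 1000%:R <= ln (39%:R : R) by ln_num.
have l40 : ln (40%:R : R) <= 3689%:R / 1000%:R by ln_num.
have l40' : 3688%:R / 1000%:R <= ln (40%:R : R) by ln_num.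
have l41 : ln (40%:R + 1 : R) <= 3714%:R / 1000%:R by rewrite natr1; ln_num.
have l163 : ln (163%:R : R) <= 2547%:R / 500%:R by ln_num.
have l169 : ln (169%:R : R) <= 513%:R / 100%:R by ln_num.
have l79 : ln (79%:R : R) <= 4370%:R / 1000%:R by ln_num.
have l134 : ln (134%:R : R) <= 4898%:R / 1000%:R by ln_num.
have l50 : ln (50%:R : R) <= 3913%:R / 1000%:R by ln_num.
have l181 : 2599%:R / 500%:R <= ln (181%:R : R) by ln_num.
have s1 : 181 / 50 <= s by rewrite /s; move: l3; clear; nra.
move: (s) s1 hH => {}s s1 hH.
have s0 : 0 < s by move: s1; clear; lra.
have ls : 1285 / 1000 <= ln s.
  have : ln (181%:R / 50%:R) <= ln s by rewrite ler_ln ?posrE// divr_gt0// ltr0n.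
  by rewrite (ln_natV 181 50 isT isT); move: l50 l181; clear; lra.
have h0 : 0 < ln H by apply: lt_le_trans hH; rewrite mulr_gt0 ?expR_gt0.
have L1 : 4905 / 1000 <= ln (ln H).
  have : ln (s * expR s) <= ln (ln H) by rewrite ler_ln ?posrE ?mulr_gt0 ?expR_gt0.
  by rewrite lnM ?posrE ?expR_gt0// expRK; move: s1 ls; clear; lra.
have hH134 : 134%:R <= ln H.
  by apply: (ge_of_lnln 134 _ (4905 / 1000) isT _ L1 h0); move: l134; clear; lra.
have rc : rem_const R 3 = e + e ^+ 2 + e ^+ 3 - 3.
  by rewrite !rem_constS rem_const0 expr1 -/e; ring.
have rc2 := rem_const_ge2 R 3 isT.
have k0 : ln (2 * rem_const R 3 * 3) <= 513 / 100.
  apply: le_trans l169; rewrite ler_ln ?posrE//; last by move: rc2; clear; lra.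
  have q2 : e ^+ 2 <= (11 / 4) ^+ 2 by rewrite lerXn2r ?nnegrE// ltW.
  have q3 : e ^+ 3 <= (11 / 4) ^+ 3 by rewrite lerXn2r ?nnegrE// ltW.
  by rewrite rc; move: e2 q2 q3; clear; lra.
have lv : ln (79%:R / 25%:R) <= 1152 / 1000 :> R.
  have l25 : 3218%:R / 1000%:R <= ln (25%:R : R) by ln_num.
  by rewrite (ln_natV 79 25 isT isT); move: l79 l25; clear; lra.
have K3 := ksum34 3 isT; have m1 : 0 < 1 :> R by [].
have b1 : 3.+1%:R * ln 3.+1%:R + 3%:R * ln 1 - 3.+1%:R * ksum R 3 + 4 / 3 <= 4112 / 1000 :> R.
  by rewrite K3 ln1; move: l2' l4; clear; lra.
have b1' : 4 <= 3.+1%:R * ln 3.+1%:R + 3%:R * ln 1 - 3.+1%:R * ksum R 3 + 4 / 3 :> R.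
  by rewrite K3 ln1; move: l2 l4'; clear; lra.
(* The gain at $39$ is about $133.6$, just below $134\le\ln H$; the errors are measured at $l=40$,
   and $79/25$ nearly solves $v+\ln v=4.905-a-0.265$. *)
apply: (@omega_le_small 3 39 roots3 H 1 3 1 (649%:R / 100%:R) (265 / 1000) (4 / 3) (79%:R / 25%:R)).
- exact: isT.
- exact: isT.
- by move=> i; rewrite /roots3; case: ifP.
- exact: m1.
- by clear; lra.
- by clear; lra.
- exact: nodes3_norm_le.
- by move=> x k x2 k3; exact: rootpoly3_norm_le.
- by move=> l; exact: kloss34_le.
- by move: hH134; clear; lra.
- by clear; lra.
- by rewrite K3 ln1; move: l39' l2'; clear; lra.
- by rewrite K3 ln1; move: l39 l39' l2 l2' hH134; clear; lra.
- by clear; lra.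
- by rewrite K3 ln1 /err_form !mul1r; move: k0 l40 l40' l163 l2 l41; clear; lra.
- by clear; lra.
- by rewrite K3 ln1 /err_gain !mul1r; move: k0 l40 l41 l2; clear; lra.
- by clear; lra.
- by rewrite K3 ln1; move: lv L1 l2'; clear; lra.
- by move: b1'; clear; lra.
- apply: (@product_condition _ _ _ _ _ (4112 / 1000) (1 - 693 / 1000 + 265 / 1000 + 1152 / 1000)).
  + by move: b1'; clear; lra.
  + exact: b1.
  + by rewrite K3 ln1; move: lv l2'; clear; lra.
  + by clear; lra.
  + by clear; lra.
  + by clear; lra.
- by move: b1; clear; lra.
Qed.

End SmallCases.

(** * The case $m=4$ *)

Section Case4.
Variable R : realType.

Lemma omega_le_bound4 (H : R) : s_ R 4 * expR (s_ R 4) <= ln H -> omega 4 H <= omega_bound 4 H.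
Proof.
have -> : omega_bound 4 H = 4%:R + (157%:R / 10%:R) / ln (ln H) by [].
have -> : s_ R 4 = 4%:R * ln 4%:R ^+ 2 by [].
set s : R := 4%:R * ln 4%:R ^+ 2 => hH.
have [e1 e2] := andP (expR1_bounds R).
move: e1 e2; set e : R := expR 1 => e1 e2.
have e0 : 0 < e by exact: expR_gt0.
have l2 : ln (2%:R : R) <= 694%:R / 1000%:R by ln_num.
have l2' : 693%:R / 1000%:R <= ln (2%:R : R) by ln_num.
have l3 : 1098%:R / 1000%:R <= ln (3%:R : R) by ln_num.
have l4' : 1386%:R / 1000%:R <= ln (4%:R : R) by ln_num.
have l5 : ln (5%:R : R) <= 1610%:R / 1000%:R by ln_num.
have l5' : 1609%:R / 1000%:R <= ln (5%:R : R) by ln_num.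
have l10 : ln (10%:R : R) <= 2303%:R / 1000%:R by ln_num.
have l10' : 2302%:R / 1000%:R <= ln (10%:R : R) by ln_num.
have l37 : ln (37%:R : R) <= 3611%:R / 1000%:R by ln_num.
have l37' : 3610%:R / 1000%:R <= ln (37%:R : R) by ln_num.
have l31 : ln (31%:R : R) <= 3434%:R / 1000%:R by ln_num.
have l169 : ln (169%:R : R) <= 513%:R / 100%:R by ln_num.
have l799 : 658%:R / 100%:R <= ln (799%:R : R).
  apply: (@le_trans _ _ (ln (3%:R ^+ 6))); first by rewrite lnXn//; move: l3; clear; lra.
  by rewrite ler_ln ?posrE ?exprn_gt0 ?ltr0n// -natrX ler_nat.
(* The cutoff $800=2^5\cdot5^2$, and below $4004\le2^{12}$, reduce the logarithms of large integers
   to those of $2$ and $5$. *)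
have l800E : ln (800%:R : R) = 5 * ln 2%:R + 2 * ln 5%:R.
  have -> : 800%:R = 2%:R ^+ 5 * 5%:R ^+ 2 :> R by rewrite -!natrX -natrM.
  by rewrite lnM ?posrE ?exprn_gt0 ?ltr0n// !lnXn ?ltr0n//; clear; lra.
have l799' : ln (799%:R : R) <= ln 800%:R by rewrite ler_ln ?posrE ?ltr0n// ler_nat.
have l801 : ln (800%:R + 1 : R) <= ln 800%:R + 1 / 800 by apply: (ln_natD_le R); rewrite ?ltr0n.
have l4004 : ln ((4.+1 * 800 + 4)%:R : R) <= 12 * ln 2%:R.
  have -> : 12 * ln 2%:R = ln (2%:R ^+ 12) :> R by rewrite lnXn ?ltr0n//; clear; lra.
  by rewrite ler_ln ?posrE ?exprn_gt0 ?ltr0n// -natrX ler_nat.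
have s1 : 768 / 100 <= s by rewrite /s; move: l4'; clear; nra.
move: (s) s1 hH => {}s s1 hH.
have s0 : 0 < s by move: s1; clear; lra.
have ls : 203 / 100 <= ln s.
  have l768 : 664%:R / 100%:R <= ln (768%:R : R) by ln_num.
  have l100 : ln (100%:R : R) <= 4606%:R / 1000%:R by ln_num.
  have : ln (768%:R / 100%:R) <= ln s by rewrite ler_ln ?posrE ?divr_gt0 ?ltr0n.
  by rewrite (ln_natV R 768 100 isT isT); move: l768 l100; clear; lra.
have h0 : 0 < ln H by apply: lt_le_trans hH; rewrite mulr_gt0 ?expR_gt0.
have L1 : 971 / 100 <= ln (ln H).
  have : ln (s * expR s) <= ln (ln H) by rewrite ler_ln ?posrE ?mulr_gt0 ?expR_gt0.
  by rewrite lnM ?posrE ?expR_gt0// expRK; move: s1 ls; clear; lra.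
have hHbig : 2%:R ^+ 13 <= ln H.
  rewrite -ler_ln ?posrE ?exprn_gt0 ?ltr0n// lnXn ?ltr0n//.
  by move: l2 L1; clear; lra.
have rc : rem_const R 4 = e + e ^+ 2 + e ^+ 3 + e ^+ 4 - 4.
  by rewrite !(rem_constS R) (rem_const0 R) expr1 -/e; ring.
have rc2 := rem_const_ge2 R 4 isT.
have k0 : ln (2 * rem_const R 4 * 4%:R ^+ 4) <= 513 / 100 + 8 * ln 2%:R.
  have q2 : e ^+ 2 <= (11 / 4) ^+ 2 by rewrite lerXn2r ?nnegrE// ltW.
  have q3 : e ^+ 3 <= (11 / 4) ^+ 3 by rewrite lerXn2r ?nnegrE// ltW.
  have q4 : e ^+ 4 <= (11 / 4) ^+ 4 by rewrite lerXn2r ?nnegrE// ltW.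
  have p4 : 4%:R ^+ 4 = 2%:R ^+ 8 :> R by rewrite -!natrX.
  have p8 : 0 < 2%:R ^+ 8 :> R by rewrite exprn_gt0 ?ltr0n.
  rewrite p4 lnM ?posrE//; last by move: rc2; clear; lra.
  rewrite lnXn ?ltr0n// (_ : 8 * ln 2%:R = ln 2%:R *+ 8); last by clear; lra.
  rewrite lerD2r; apply: le_trans l169.
  rewrite ler_ln ?posrE ?ltr0n//; last by move: rc2; clear; lra.
  by rewrite rc; move: e2 q2 q3 q4; clear; lra.
have lv : ln (31%:R / 5%:R) <= 1825 / 1000 :> R.
  by rewrite (ln_natV R 31 5 isT isT); move: l31 l5'; clear; lra.
have lmu : ln (37%:R / 10%:R) = ln 37%:R - ln 10%:R :> R by exact: ln_natV.
have K4 := (ksum34 R) 4 isT.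
have b1 : 4.+1%:R * ln 4.+1%:R + 4%:R * ln (37%:R / 10%:R) - 4.+1%:R * ksum R 4 + 155 / 1000 <= 998 / 100 :> R.
  by rewrite K4 lmu; move: l2' l5 l37 l10'; clear; lra.
have b1' : 9 <= 4.+1%:R * ln 4.+1%:R + 4%:R * ln (37%:R / 10%:R) - 4.+1%:R * ksum R 4 + 155 / 1000 :> R.
  by rewrite K4 lmu; move: l2 l5' l37' l10; clear; lra.
apply: (@omega_le_small R 4 799 (fun=> 0%N) H (37%:R / 10%:R) (4%:R ^+ 4) 1 (157%:R / 10%:R) (27 / 1000)
  (155 / 1000) (31%:R / 5%:R)).
- exact: isT.
- exact: isT.
- exact: (fun=> isT).
- by clear; lra.
- by rewrite exprn_ege1// ler1n.
- by clear; lra.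
- exact: nodes4_norm_le.
- by move=> x k x2 k4; exact: (rootpoly_norm_le R 4).
- by move=> l; exact: (kloss34_le R).
- by move: hHbig; clear; lra.
- by clear; lra.
- by rewrite K4 lmu; move: l799 l37 l10' l2'; clear; lra.
- by rewrite K4 lmu; move: l799' l800E l37' l10 l2 l5 l2' hHbig; clear; lra.
- by clear; lra.
- by rewrite K4 lmu /err_form !mul1r; move: k0 l800E l4004 l801 l37' l10 l2 l2' l5 l5'; clear; lra.
- by clear; lra.
- by rewrite K4 lmu /err_gain !mul1r; move: k0 l800E l801 l2 l5 l37' l10; clear; lra.
- by clear; lra.
- by rewrite K4 lmu; move: lv L1 l2' l37 l10'; clear; lra.
- by move: b1'; clear; lra.
- apply: (@product_condition R _ _ _ _ _ (998 / 100) (3472 / 1000)).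
  + by move: b1'; clear; lra.
  + exact: b1.
  + by rewrite K4 lmu; move: lv l2' l37 l10'; clear; lra.
  + by clear; lra.
  + by clear; lra.
  + by clear; lra.
- by move: b1; clear; lra.
Qed.
End Case4.

(** * Numerical evaluation of kappa *)

Definition ln_terms (n : nat) : nat := if (n < 10)%N then 20%N else if (n < 50)%N then 7%N else 4%N.

Record sums := Sums { sum_ln : Z * Z; sum_L2 : Z * Z; sum_Z2 : Z * Z; sum_L3 : Z * Z; sum_Z3 : Z * Z;
  sum_rest : Z * Z }.

(** Each logarithm comes from its predecessor through the ratio $n/(n-1)$, whose series has argument
    $1/(2n-1)$; hence fewer terms are needed as $n$ grows. *)
Definition sums_step (n : nat) (t : sums) : sums :=
  let N := Z.of_nat n in
  let l := iadd (sum_ln t) (iln_ratio (ln_terms n) N (N - 1)) in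
  Sums l (iadd (sum_L2 t) (idivZ l (N * N))) (iadd (sum_Z2 t) (idivZ (iint 1) (N * N)))
    (iadd (sum_L3 t) (idivZ l (N * N * N))) (iadd (sum_Z3 t) (idivZ (iint 1) (N * N * N)))
    (if prime n then iadd (sum_rest t) (idivZ l (N * (N + 1) * (N * N * N - 1))) else sum_rest t).

(** The index is shifted: [sums_to n] covers the integers up to $n+1$, and the base case is the
    state at $1$. *)
Fixpoint sums_to (n : nat) : sums :=
  if n is n'.+1 then sums_step n.+1 (sums_to n')
  else Sums (iint 0) (iint 0) (iint 1) (iint 0) (iint 1) (iint 0).

Definition iaff (a b c : Z) (l : Z * Z) : Z * Z := idivZ (iadd (imulZ a l) (iint b)) c.

(** The polynomials in [X] are the Euler-Maclaurin correctors and third derivatives at $n$ with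
    denominators cleared: [u] and [l] mark upper and lower bounds, [L] and [Z] the sums of $\ln
    n/n^k$ and $1/n^k$. *)
Definition kappa_check (n : nat) : bool :=
  let t := sums_to n.-1 in let l := sum_ln t in let X := Z.of_nat n in
  let X2 := (X * X)%ZZ in let X3 := (X2 * X)%ZZ in
  let uL2 := iadd (sum_L2 t) (iaff (12 * X2 - 6 * X + 2) (12 * X2 - 1) (12 * X3) l) in
  let lL2 := isub uL2 (iaff 24 (- 26) (384 * (X2 * X3)) l) in
  let uZ2 := iadd (sum_Z2 t) (iaff 0 (12 * X2 - 6 * X + 2) (12 * X3) l) in
  let lZ2 := isub uZ2 (iaff 0 24 (384 * (X2 * X3)) l) in
  let uL3 := iadd (sum_L3 t) (iaff (6 * X2 - 6 * X + 3) (3 * X2 - 1) (12 * (X2 * X2)) l) in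
  let lL3 := isub uL3 (iaff 60 (- 47) (384 * (X3 * X3)) l) in
  let uZ3 := iadd (sum_Z3 t) (iaff 0 (6 * X2 - 6 * X + 3) (12 * (X2 * X2)) l) in
  let lZ3 := isub uZ3 (iaff 0 60 (384 * (X3 * X3)) l) in
  let tail := iaff (12 * X2 - 24 * X + 20) (3 * X2 - 4) (48 * (X3 * X3)) l in
  let lower := iadd (iadd (idiv lL2 uZ2) (idiv lL3 uZ3)) (sum_rest t) in
  let upper := iadd (iadd (idiv uL2 lZ2) (idiv uL3 lZ3)) (iadd (sum_rest t) tail) in
  [&& Z.leb 0 lL2.1, Z.ltb 0 lZ2.1, Z.leb 0 lL3.1, Z.ltb 0 lZ3.1,
      Z.leb 0 uL2.1, Z.ltb 0 uZ2.1, Z.leb 0 uL3.1, Z.ltb 0 uZ3.1, Z.leb (2 * scale) l.1,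
      Z.leb (75536661083 * scale) (lower.1 * 100000000000) &
      Z.ltb (upper.2 * 100000000000) (75536661084 * scale)].

Section KappaCheck.
#[local] Arguments Z.mul : simpl never.
#[local] Arguments Z.add : simpl never.
#[local] Arguments Z.sub : simpl never.
#[local] Arguments Z.div : simpl never.
#[local] Arguments Z.of_nat : simpl never.
Variable R : realType.
Local Notation ZR := (@ZR R).
Local Notation encl := (@encl R).

Definition sums_ok (n : nat) (t : sums) : Prop :=
  [/\ encl (sum_ln t) (ln n%:R),
      encl (sum_L2 t) (lnpow_sum R (1, 0) 2 n) /\ encl (sum_Z2 t) (lnpow_sum R (0, 1) 2 n),
      encl (sum_L3 t) (lnpow_sum R (1, 0) 3 n) /\ encl (sum_Z3 t) (lnpow_sum R (0, 1) 3 n) &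
      encl (sum_rest t) (series (rest_term R) n.+1)].

Lemma encl_iaff a b c l (x : R) : (0 <= a)%ZZ -> (0 < c)%ZZ -> encl l x ->
  encl (iaff a b c l) ((ZR a * x + ZR b) / ZR c).
Proof.
move=> a0 c0 lx; apply: encl_divZ => //; apply: encl_add; first exact: encl_mulZ.
exact: encl_int.
Qed.

Lemma sums_ok_step n t : (0 < n)%N -> sums_ok n t -> sums_ok n.+1 (sums_step n.+1 t).
Proof.
move=> n0 [hl [hL2 hZ2] [hL3 hZ3] hB]; set N := Z.of_nat n.+1.
have N0 : (0 < N)%ZZ by rewrite /N; lia.
have NR : ZR N = n.+1%:R by exact: ZR_nat.
have N1 : ZR (N - 1)%ZZ = n%:R by rewrite -(ZR_nat R n); congr (ZR _); rewrite /N; lia.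
have e1 : encl (iint 1) 1 by rewrite -(ZR1 R); exact: encl_int.
have NN : (0 < N * N)%ZZ by exact: Z.mul_pos_pos.
have NNN : (0 < N * N * N)%ZZ by exact: Z.mul_pos_pos.
have P0 : 0 < (n%:R : R) by rewrite ltr0n.
have l1 : encl (sum_ln (sums_step n.+1 t)) (ln n.+1%:R).
  have -> : ln (n.+1%:R : R) = ln n%:R + ln (ZR N / ZR (N - 1)%ZZ).
    by rewrite NR N1 ln_div ?posrE ?ltr0n// addrC subrK.
  by apply: encl_add => //; apply: encl_ln_ratio; rewrite /N; lia.
have pw (x : R) k : x * n.+1%:R^-1 ^+ k = x / n.+1%:R ^+ k by rewrite exprVn.
have m2 : (n.+1%:R ^+ 2 : R) = ZR (N * N)%ZZ by rewrite ZRM NR expr2.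
have m3 : (n.+1%:R ^+ 3 : R) = ZR (N * N * N)%ZZ by rewrite !ZRM NR; ring.
split=> //.
- split; rewrite lnpow_sumS; apply: encl_add => //; rewrite /lnpow /= ?mul1r ?mul0r ?addr0 ?add0r pw m2.
    exact (encl_divZ R _ _ _ NN l1).
  exact (encl_divZ R _ _ _ NN e1).
- split; rewrite lnpow_sumS; apply: encl_add => //; rewrite /lnpow /= ?mul1r ?mul0r ?addr0 ?add0r pw m3.
    exact (encl_divZ R _ _ _ NNN l1).
  exact (encl_divZ R _ _ _ NNN e1).
rewrite seriesSr /sums_step {2}/rest_term /=; case: ifP => pp; last by rewrite addr0.
apply: encl_add => //; rewrite -/N.
have -> : n.+1%:R * (n.+1%:R + 1) * (n.+1%:R ^+ 3 - 1) = ZR (N * (N + 1) * (N * N * N - 1))%ZZ.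
  by rewrite m3 (ZRM R (N * (N + 1))%ZZ) (ZRM R N (N + 1)%ZZ) ZRD ZRB ZR1 NR.
apply: encl_divZ => //; apply: Z.mul_pos_pos; first by apply: Z.mul_pos_pos => //; lia.
have p1 := prime_gt1 pp; have : (2 <= N)%ZZ by rewrite /N; lia.
by move: (N) => q; clear; nia.
Qed.

Lemma sums_toP n : sums_ok n.+1 (sums_to n).
Proof.
elim: n => [|n IH]; last exact: sums_ok_step.
have e0 : encl (iint 0) 0 by rewrite -(ZR0 R); exact: encl_int.
have e1 : encl (iint 1) 1 by rewrite -(ZR1 R); exact: encl_int.
have s0 k : lnpow_sum R (1, 0) k 1 = 0.
  by rewrite /lnpow_sum big_nat1 /lnpow ln1 mulr0 addr0 mul0r.
have s1 k : lnpow_sum R (0, 1) k 1 = 1.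
  by rewrite /lnpow_sum big_nat1 /lnpow mul0r add0r mul1r invr1 expr1n.
rewrite /sums_ok ln1 !s0 !s1; split=> //.
by rewrite seriesEnat /= !big_nat_recl// big_geq// /rest_term /= !addr0.
Qed.

Lemma encl_gt0 i (x : R) : (0 < i.1)%ZZ -> encl i x -> 0 < x.
Proof.
move=> i0 /andP[h _]; have S0 := scale_gt0 R; rewrite -(pmulr_lgt0 _ S0).
exact: lt_le_trans (ZR_gt0 R _ i0) h.
Qed.

Lemma encl_ge_ratio q c i (x : R) : (0 < c)%ZZ -> (q * scale <= i.1 * c)%ZZ -> encl i x ->
  ZR q / ZR c <= x.
Proof.
move=> c0 qi /andP[h _]; have C0 := ZR_gt0 R _ c0; have S0 := scale_gt0 R.
rewrite (ler_pdivrMr _ _ C0) -(ler_pM2r S0) -ZRM; apply: le_trans (ZR_le R _ _ qi) _.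
by rewrite ZRM mulrAC; apply: ler_wpM2r h; exact: ltW.
Qed.

Lemma encl_lt_ratio q c i (x : R) : (0 < c)%ZZ -> (i.2 * c < q * scale)%ZZ -> encl i x ->
  x < ZR q / ZR c.
Proof.
move=> c0 qi /andP[_ h]; have C0 := ZR_gt0 R _ c0; have S0 := scale_gt0 R.
rewrite (ltr_pdivlMr _ _ C0) -(ltr_pM2r S0) -(ZRM R q); apply: le_lt_trans (ZR_lt R _ _ qi).
by rewrite ZRM mulrAC; apply: ler_wpM2r h; exact: ltW.
Qed.

Lemma ZR_pow10_11 : ZR 100000000000 = 10%:R ^+ 11.
Proof.
have -> : ZR 100000000000 = ZR (10 * (10 * (10 * (10 * (10 * (10 * (10 * (10 * (10 * (10 * 10))))))))))%ZZ.
  by congr (ZR _).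
by rewrite !ZRM (ZR_nat R 10); ring.
Qed.

Lemma dec11E a b c d : dec11 R a b c d =
  ZR (((Z.of_nat a * 1000 + Z.of_nat b) * 1000 + Z.of_nat c) * 1000 + Z.of_nat d) / ZR 100000000000.
Proof. by rewrite ZR_pow10_11 /dec11 !(ZRD, ZRM) !ZR_nat (ZR_nat R 1000). Qed.

Lemma kappa_checkP n : (0 < n)%N -> kappa_check n ->
  [/\ 2 <= ln (n%:R : R), 0 < lnpow_lower R (0, 1) 1 n /\ 0 <= lnpow_lower R (1, 0) 1 n,
     0 < lnpow_lower R (0, 1) 2 n /\ 0 <= lnpow_lower R (1, 0) 2 n,
     dec11 R 75 536 661 083 <= lnpow_lower R (1, 0) 1 n / lnpow_upper R (0, 1) 1 n
       + lnpow_lower R (1, 0) 2 n / lnpow_upper R (0, 1) 2 n + series (rest_term R) n.+1 &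
     lnpow_upper R (1, 0) 1 n / lnpow_lower R (0, 1) 1 n
       + lnpow_upper R (1, 0) 2 n / lnpow_lower R (0, 1) 2 n
       + (series (rest_term R) n.+1 - lnpow_em R (1, 0) 4 n%:R) < dec11 R 75 536 661 084].
Proof.
move=> n0; rewrite /kappa_check; have := sums_toP n.-1; rewrite prednK//.
set t := sums_to _; move=> [hl [hL2 hZ2] [hL3 hZ3] hB].
set X := Z.of_nat n; set X2 := (X * X)%ZZ; set X3 := (X2 * X)%ZZ.
have X1 : (1 <= X)%ZZ by rewrite /X; lia.
have Xp : (0 < X)%ZZ by lia.
have X2p : (0 < X2)%ZZ by exact: Z.mul_pos_pos.
have X3p : (0 < X3)%ZZ by exact: Z.mul_pos_pos.
pose x : R := n%:R; have x0 : 0 < x by rewrite ltr0n.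
have XR : ZR X = x by exact: ZR_nat.
have X2R : ZR X2 = x ^+ 2 by rewrite ZRM XR expr2.
have X3R : ZR X3 = x ^+ 3 by rewrite ZRM X2R XR; ring.
have xn : x != 0 by rewrite gt_eqF.
have a1 : (0 <= 12 * X2 - 6 * X + 2)%ZZ by rewrite /X2; move: X1; clear; nia.
have a2 : (0 <= 6 * X2 - 6 * X + 3)%ZZ by rewrite /X2; move: X1; clear; nia.
have a3 : (0 <= 12 * X2 - 24 * X + 20)%ZZ by rewrite /X2; move: X1; clear; nia.
have c1 : (0 < 12 * X3)%ZZ by exact: Z.mul_pos_pos.
have c2 : (0 < 384 * (X2 * X3))%ZZ by do 2 apply: Z.mul_pos_pos => //.
have c3 : (0 < 12 * (X2 * X2))%ZZ by do 2 apply: Z.mul_pos_pos => //.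
have c4 : (0 < 384 * (X3 * X3))%ZZ by do 2 apply: Z.mul_pos_pos => //.
have c5 : (0 < 48 * (X3 * X3))%ZZ by do 2 apply: Z.mul_pos_pos => //.
have z0 : (0 <= 0)%ZZ by [].
have z24 : (0 <= 24)%ZZ by [].
have z60 : (0 <= 60)%ZZ by [].
pose n12 := ZR_nat R 12; pose n6 := ZR_nat R 6; pose n2 := ZR_nat R 2; pose n384 := ZR_nat R 384.
pose n3 := ZR_nat R 3; pose n24 := ZR_nat R 24; pose n60 := ZR_nat R 60; pose n26 := ZR_nat R 26.
pose n47 := ZR_nat R 47; pose n48 := ZR_nat R 48; pose n20 := ZR_nat R 20; pose n4 := ZR_nat R 4.
clearbody X3 X2 X.
have m26 : ZR (- 26) = - 26%:R by rewrite -n26; exact: (ZRN R 26).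
have m47 : ZR (- 47) = - 47%:R by rewrite -n47; exact: (ZRN R 47).
have eL2 : lnpow_upper R (1, 0) 1 n = lnpow_sum R (1, 0) 2 n +
    (ZR (12 * X2 - 6 * X + 2) * ln x + ZR (12 * X2 - 1)) / ZR (12 * X3).
  rewrite ZRD !ZRB !ZRM X2R X3R XR n12 n6 n2 ZR1 /lnpow_upper /lnpow_em /lnpow_prim /lnpow_deriv /lnpow /= -/x.
  by field.
have dL2 : lnpow_lower R (1, 0) 1 n = lnpow_upper R (1, 0) 1 n -
    (ZR 24 * ln x + ZR (- 26)) / ZR (384 * (X2 * X3)).
  rewrite m26 !ZRM X2R X3R n24 n384 /lnpow_lower /lnpow_deriv3 /lnpow_deriv /lnpow /= -/x.
  by field.
have eZ2 : lnpow_upper R (0, 1) 1 n = lnpow_sum R (0, 1) 2 n +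
    (ZR 0 * ln x + ZR (12 * X2 - 6 * X + 2)) / ZR (12 * X3).
  rewrite ZRD !ZRB !ZRM X2R X3R XR n12 n6 n2 ZR0 /lnpow_upper /lnpow_em /lnpow_prim /lnpow_deriv /lnpow /= -/x.
  by field.
have dZ2 : lnpow_lower R (0, 1) 1 n = lnpow_upper R (0, 1) 1 n -
    (ZR 0 * ln x + ZR 24) / ZR (384 * (X2 * X3)).
  rewrite !ZRM X2R X3R n24 ZR0 n384 /lnpow_lower /lnpow_deriv3 /lnpow_deriv /lnpow /= -/x.
  by field.
have eL3 : lnpow_upper R (1, 0) 2 n = lnpow_sum R (1, 0) 3 n +
    (ZR (6 * X2 - 6 * X + 3) * ln x + ZR (3 * X2 - 1)) / ZR (12 * (X2 * X2)).
  rewrite ZRD !ZRB !ZRM X2R XR n12 n6 n3 ZR1 /lnpow_upper /lnpow_em /lnpow_prim /lnpow_deriv /lnpow /= -/x.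
  by field.
have dL3 : lnpow_lower R (1, 0) 2 n = lnpow_upper R (1, 0) 2 n -
    (ZR 60 * ln x + ZR (- 47)) / ZR (384 * (X3 * X3)).
  rewrite m47 !ZRM X3R n60 n384 /lnpow_lower /lnpow_deriv3 /lnpow_deriv /lnpow /= -/x.
  by field.
have eZ3 : lnpow_upper R (0, 1) 2 n = lnpow_sum R (0, 1) 3 n +
    (ZR 0 * ln x + ZR (6 * X2 - 6 * X + 3)) / ZR (12 * (X2 * X2)).
  rewrite ZRD !ZRB !ZRM X2R XR n12 n6 n3 ZR0 /lnpow_upper /lnpow_em /lnpow_prim /lnpow_deriv /lnpow /= -/x.
  by field.
have dZ3 : lnpow_lower R (0, 1) 2 n = lnpow_upper R (0, 1) 2 n -
    (ZR 0 * ln x + ZR 60) / ZR (384 * (X3 * X3)).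
  rewrite !ZRM X3R n60 ZR0 n384 /lnpow_lower /lnpow_deriv3 /lnpow_deriv /lnpow /= -/x.
  by field.
have et : - lnpow_em R (1, 0) 4 n%:R = (ZR (12 * X2 - 24 * X + 20) * ln x + ZR (3 * X2 - 4)) / ZR (48 * (X3 * X3)).
  rewrite ZRD !ZRB !ZRM X2R X3R XR n12 n24 n20 n3 n4 n48 /lnpow_em /lnpow_prim /lnpow_deriv /lnpow /= -/x.
  by field.
set iL := iadd (sum_L2 t) _; set iL' := isub iL _; set iZ := iadd (sum_Z2 t) _; set iZ' := isub iZ _.
set jL := iadd (sum_L3 t) _; set jL' := isub jL _; set jZ := iadd (sum_Z3 t) _; set jZ' := isub jZ _.
set ta := iaff (12 * X2 - 24 * X + 20) _ _ _.
have hL : encl iL (lnpow_upper R (1, 0) 1 n) by rewrite eL2; apply: encl_add => //; exact: encl_iaff.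
have hL' : encl iL' (lnpow_lower R (1, 0) 1 n) by rewrite dL2; apply: encl_sub => //; exact: encl_iaff.
have hZ : encl iZ (lnpow_upper R (0, 1) 1 n) by rewrite eZ2; apply: encl_add => //; exact: encl_iaff.
have hZ' : encl iZ' (lnpow_lower R (0, 1) 1 n) by rewrite dZ2; apply: encl_sub => //; exact: encl_iaff.
have gL : encl jL (lnpow_upper R (1, 0) 2 n) by rewrite eL3; apply: encl_add => //; exact: encl_iaff.
have gL' : encl jL' (lnpow_lower R (1, 0) 2 n) by rewrite dL3; apply: encl_sub => //; exact: encl_iaff.
have gZ : encl jZ (lnpow_upper R (0, 1) 2 n) by rewrite eZ3; apply: encl_add => //; exact: encl_iaff.
have gZ' : encl jZ' (lnpow_lower R (0, 1) 2 n) by rewrite dZ3; apply: encl_sub => //; exact: encl_iaff.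
have hta : encl ta (- lnpow_em R (1, 0) 4 n%:R) by rewrite et; exact: encl_iaff.
case/and5P => /Z.leb_le k1 /Z.ltb_lt k2 /Z.leb_le k3 /Z.ltb_lt k4.
case/and5P => /Z.leb_le k5 /Z.ltb_lt k6 /Z.leb_le k7 /Z.ltb_lt k8.
case/and3P => /Z.leb_le k9 /Z.leb_le k10 /Z.ltb_lt k11.
have q0 : (0 < 100000000000)%ZZ by [].
split.
- have := encl_ge_ratio 2 1 _ _ (erefl _ : (0 < 1)%ZZ) _ hl.
  rewrite ZR1 n2 divr1; apply; rewrite Z.mul_1_r; exact: k9.
- by split; [exact: encl_gt0 hZ'|exact: encl_ge0 hL'].
- by split; [exact: encl_gt0 gZ'|exact: encl_ge0 gL'].
- rewrite dec11E.
  apply: (encl_ge_ratio _ _ _ _ q0 k10).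
  by apply: encl_add => //; apply: encl_add; exact: encl_div.
rewrite dec11E.
apply: (encl_lt_ratio _ _ _ _ q0 k11).
by apply: encl_add; [apply: encl_add; exact: encl_div|exact: encl_add].
Qed.
End KappaCheck.

(** * Existence and digits of kappa, and convergence of $\kappa_m$ *)

Section KappaLimit.
Variable R : realType.
Implicit Types (m n p N : nat).

Lemma kappa_exists : exists kappa : R, [/\ series (kappa_term R) @ \oo --> kappa,
  (forall N, series (kappa_term R) N <= kappa), dec11 R 75 536 661 083 <= kappa &
  kappa < dec11 R 75 536 661 084].
Proof.
(* At $700$ the prime tail, about $\ln n/(4n^4)\approx7\cdot10^{-12}$, is below one unit of the
   eleventh digit. *)
have chk : kappa_check 700 by vm_compute.
have [l2 [z1 l1] [z2 l3] lo up] := kappa_checkP R 700 isT chk.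
have [kappa [ck hk lk uk]] := kappa_bounds R 700 700 isT l2 isT l2 z1 l1 z2 l3.
by exists kappa; split; [exact: ck|exact: hk|exact: le_trans lk|exact: le_lt_trans up].
Qed.

Definition ksum_term p : R := ln (p%:R : R) / (p%:R - 1).

Lemma natr_gt1 p : prime p -> 1 < (p%:R : R).
Proof. by move=> /prime_gt1 p1; rewrite ltr1n. Qed.

Lemma ksum_term_ge0 p : prime p -> 0 <= ksum_term p.
Proof. by move=> pp; rewrite divr_ge0// ltW ?ln_nat_prime ?natr_prime_gt1. Qed.

Lemma ksumE m : ksum R m = \sum_(0 <= p < ((m.+1)./2).+1 | prime p) (minfloor m p)%:R * ksum_term p.
Proof. by rewrite /ksum big_mkord. Qed.

Lemma minfloor_bounds m p : prime p -> (p <= m.+1)%N ->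
  m%:R / p%:R - 2 <= ((minfloor m p)%:R : R) <= m%:R / p%:R.
Proof.
move=> pp pm; have p0 := prime_gt0 pp; have P0 : 0 < (p%:R : R) by rewrite ltr0n.
have d0 : (0 < m.+1 %/ p)%N by rewrite divn_gt0.
rewrite minfloorE// lerBlDr ler_pdivrMr// ler_pdivlMr// -natrD -!natrM !ler_nat.
have := ltn_ceil m.+1 p0; have := leq_trunc_div m.+1 p.
by move: (m.+1 %/ p)%N d0 => d; move: p0; clear; nia.
Qed.

Lemma ksum_le m : ksum R m <= m%:R * series (kappa_term R) ((m.+1)./2).+1.
Proof.
rewrite ksumE seriesEnat /= mulr_sumr big_mkcond /=.
rewrite big_nat_cond [leRHS]big_nat_cond; apply: ler_sum => p /andP[/andP[_ pm] _].
rewrite /kappa_term; case: ifP => pp; last by rewrite mulr0.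
have pm' : (p <= m.+1)%N by move: pm; rewrite ?uphalfE -divn2; lia.
have /andP[_ h] := minfloor_bounds m p pp pm'.
have p1 := natr_gt1 p pp.
have -> : m%:R * (ln p%:R / (p%:R * (p%:R - 1))) = m%:R / p%:R * ksum_term p.
  by rewrite /ksum_term; field; rewrite subr_eq0 (gt_eqF p1) gt_eqF// (lt_trans _ p1).
by rewrite ler_wpM2r ?ksum_term_ge0.
Qed.

Lemma ksum_le_nat m : ksum R m <= m%:R.
Proof.
have [kappa [_ hk _ uk]] := kappa_exists; apply: (le_trans (ksum_le m)).
rewrite ler_piMr//; apply: (le_trans (hk _)); apply: (le_trans (ltW uk)).
rewrite /dec11 ler_pdivrMr ?exprn_gt0 ?ltr0n//; clear; lra.
Qed.

(** Restricted to primes below a fixed $N$, the rounding in [minfloor] costs an amount independent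
    of $m$, negligible after division by $m$. *)
Lemma ksum_ge_trunc m N : (N <= ((m.+1)./2).+1)%N -> (0 < m)%N ->
  m%:R * series (kappa_term R) N - 2 * \sum_(0 <= p < N | prime p) ksum_term p <= ksum R m.
Proof.
move=> Nm m0; rewrite ksumE [leRHS](big_cat_nat _ (n := N))//=.
apply: (@le_trans _ _ (\sum_(0 <= p < N | prime p) (minfloor m p)%:R * ksum_term p)); last first.
  by rewrite lerDl; apply: sumr_ge0 => p pp; rewrite mulr_ge0 ?ksum_term_ge0.
rewrite seriesEnat /= !mulr_sumr big_mkcond /= [X in _ - X]big_mkcond [leRHS]big_mkcond -sumrB /=.
rewrite big_nat_cond [leRHS]big_nat_cond; apply: ler_sum => p /andP[/andP[_ pN] _].
rewrite /kappa_term; case: ifP => pp; last by rewrite mulr0 subr0.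
have pm : (p <= m.+1)%N by move: pN Nm; rewrite ?uphalfE -divn2; lia.
have /andP[h _] := minfloor_bounds m p pp pm; have p1 := natr_gt1 p pp.
have -> : m%:R * (ln p%:R / (p%:R * (p%:R - 1))) - 2 * ksum_term p = (m%:R / p%:R - 2) * ksum_term p.
  by rewrite /ksum_term; field; rewrite subr_eq0 (gt_eqF p1) gt_eqF// (lt_trans _ p1).
by rewrite ler_wpM2r ?ksum_term_ge0.
Qed.

(** Uniform in $p$: since $e^{s}\ge m^2/2$, the two subtracted terms are at most $2/m$ and $8/m$. *)
Lemma w_ge m p : (3 <= m)%N -> prime p -> (p <= m)%N ->
  1 - 10 / m%:R <= w_ p%:R (s_ R m * expR (s_ R m)).
Proof.
move=> m3 pp pm; rewrite /w_; set s := s_ R m.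
have M3 : 3 <= (m%:R : R) by rewrite (ler_nat _ 3).
have M0 : 0 < (m%:R : R) by apply: lt_le_trans M3.
have sm : m%:R <= s.
  rewrite /s /s_ ifF; last by apply/eqP => m2; rewrite m2 in m3.
  rewrite ler_peMr// exprn_ege1//.
  have e3 : 109%:R / 100%:R <= ln (3%:R : R) by ln_num.
  have : ln (3%:R : R) <= ln m%:R by rewrite ler_ln ?posrE.
  by move: e3; clear; lra.
have s0 : 0 < s by apply: lt_le_trans sm.
have s1 : 1 <= s by move: sm M3; clear; lra.
have E0 := expR_gt0 s; have Em : m%:R ^+ 2 / 2 <= expR s.
  have h : expR m%:R <= expR s by rewrite ler_expR.
  have := expR_ge_cubic R _ (ltW M0); have : 0 <= m%:R ^+ 3 / 6 :> R by rewrite divr_ge0 ?exprn_ge0.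
  by move: h M0; clear; lra.
have lx : ln (s * expR s) <= 2 * s.
  by rewrite lnM ?posrE// expRK; have := ln_sublinear s0; clear; lra.
have X0 : 0 < s * expR s by rewrite mulr_gt0.
have P1 := natr_gt1 p pp; have PM : p%:R <= m%:R :> R by rewrite ler_nat.
have l2 : 69%:R / 100%:R <= ln (2%:R : R) by ln_num.
have lp : 1 / 2 <= ln (p%:R : R).
  have : ln (2%:R : R) <= ln p%:R by rewrite ler_ln ?posrE ?ltr0n ?prime_gt0// ler_nat prime_gt1.
  by move: l2; clear; lra.
have lp0 : 0 < ln (p%:R : R) by rewrite ln_nat_prime.
have q1 : p%:R / (s * expR s) <= m%:R / expR s.
  rewrite ler_pdivrMr// mulrAC (mulrA _ s) mulfK ?gt_eqF//.
  by apply: (le_trans PM); rewrite ler_peMr// ltW.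
have q2 : (p%:R - 1) / ln p%:R <= 2 * m%:R :> R.
  apply: (@le_trans _ _ ((p%:R - 1) * 2)); last by move: PM; clear; lra.
  apply: ler_wpM2l; first by rewrite subr_ge0 ltW.
  by rewrite -[leRHS]invrK lef_pV2 ?posrE ?invr_gt0//; move: lp; rewrite div1r.
have q3 : ln (s * expR s) / (s * expR s) <= 2 / expR s.
  rewrite ler_pdivrMr//; have -> : 2 / expR s * (s * expR s) = 2 * s by field; rewrite gt_eqF.
  exact: lx.
have q4 : (p%:R - 1) / ln p%:R * (ln (s * expR s) / (s * expR s)) <= 2 * m%:R * (2 / expR s).
  apply: ler_pM => //; first by rewrite divr_ge0 ?subr_ge0 ?(ltW P1)// ltW.
  rewrite divr_ge0 ?(ltW X0)// ln_ge0//; apply: mulr_ege1 => //.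
  by apply: le_trans (expR_ge1Dx _); rewrite lerDl ltW.
have q5 : m%:R / expR s <= 2 / m%:R.
  rewrite ler_pdivrMr// mulrAC ler_pdivlMr// -expr2; move: Em; clear; lra.
have e5 : 2 * m%:R * (2 / expR s) = 4 * (m%:R / expR s) by ring.
have e10 : 10 / m%:R = 5 * (2 / m%:R) :> R by ring.
by move: q1 q4 q5; rewrite e5 e10; clear; lra.
Qed.

Lemma kappa_ge m : (10 <= m)%N -> (1 - 10 / m%:R) * (ksum R m / m%:R) <= kappa_ R m.
Proof.
move=> m10; have m0 : 0 < (m%:R : R) by rewrite ltr0n (leq_trans _ m10).
rewrite mulrA mulrC /kappa_; apply: ler_wpM2l; first by rewrite invr_ge0 ltW.
rewrite /ksum mulr_sumr; apply: ler_sum => p pp.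
rewrite mulrC; apply: ler_wpM2l; first by rewrite mulr_ge0// -/(ksum_term p) ksum_term_ge0.
apply: w_ge => //; first by rewrite (leq_trans _ m10).
case: p {pp} => p /= pm; move: pm m10; rewrite ?uphalfE -divn2; clear; lia.
Qed.

(** The upper bound $\kappa_m\le\kappa$ holds termwise; the lower bound fixes a truncation [N]
    within [e / 2] of the limit and then takes $m$ large enough for both the rounding and the
    weights. *)
Lemma kappa_cvg (kappa : R) : series (kappa_term R) @ \oo --> kappa ->
  (forall N, series (kappa_term R) N <= kappa) -> kappa_ R @ \oo --> kappa.
Proof.
move=> ck hk; have k0 : 0 <= kappa by apply: le_trans (hk 0%N); rewrite /series /= big_geq.
apply/cvgrPdist_le => e e0.
have [N hN] : exists N, kappa - e / 2 <= series (kappa_term R) N.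
  move/cvgrPdist_le : ck => /(_ (e / 2)); rewrite divr_gt0// => /(_ isT) [N _ /(_ N (leqnn _))] h.
  by exists N; move: (le_trans (ler_norm _) h); clear; lra.
pose C : R := \sum_(0 <= p < N | prime p) ksum_term p.
have C0 : 0 <= C by apply: sumr_ge0 => p; exact: ksum_term_ge0.
near=> m.
have m10 : (10 <= m)%N by near: m; exact: nbhs_infty_ge.
have mN : (2 * N <= m)%N by near: m; exact: nbhs_infty_ge.
have mC : (10 * kappa + 2 * C) / (e / 2) <= m%:R by near: m; exact: nbhs_infty_ger.
have m0 : 0 < (m%:R : R) by rewrite ltr0n (leq_trans _ m10).
have up : kappa_ R m <= kappa.
  apply: (le_trans (kappa_le R m (leq_trans _ m10))) => //.
  rewrite ler_pdivrMr// mulrC; apply: (le_trans (ksum_le m)); rewrite ler_pM2l//; exact: hk.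
have lo := kappa_ge m m10.
have tr : series (kappa_term R) N - 2 * C / m%:R <= ksum R m / m%:R.
  rewrite ler_pdivlMr// mulrBl divfK ?gt_eqF// mulrC; apply: ksum_ge_trunc.
    by move: mN; rewrite ?uphalfE -divn2; lia.
  by rewrite (leq_trans _ m10).
have kk : ksum R m / m%:R <= kappa.
  rewrite ler_pdivrMr// mulrC; apply: (le_trans (ksum_le m)); rewrite ler_pM2l//; exact: hk.
have err : (10 * kappa + 2 * C) / m%:R <= e / 2.
  by rewrite ler_pdivrMr// [leRHS]mulrC -ler_pdivrMr ?divr_gt0.
have b10 : 10 / m%:R * (ksum R m / m%:R) <= 10 / m%:R * kappa.
  by rewrite ler_wpM2l// divr_ge0// ltW.
rewrite ger0_norm ?subr_ge0//.
by move: lo tr err b10 hN; move: (m%:R^-1) => i; clear; lra.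
Unshelve. all: by end_near. Qed.

End KappaLimit.

Theorem theorem1p1 (R : realType) :
  (forall (m : nat) (H : R), (2 <= m)%N ->
     @s_ R m * expR (@s_ R m) <= ln H ->
     @omega R m H <= @omega_bound R m H) /\
  (exists kappa : R,
     series (@kappa_term R) @ \oo --> kappa /\
     (@kappa_ R) @ \oo --> kappa /\
     @dec11 R 75 536 661 083 <= kappa /\
     kappa < @dec11 R 75 536 661 084).
Proof.
split=> [m H m2 hH|]; last first.
  have [kappa [ck hk lo up]] := kappa_exists R.
  by exists kappa; split=> //; split; [exact: kappa_cvg|split].
have [m5|m4] := leqP 5 m; first exact: (omega_le_bound_ge5 R m H m5 (ksum_le_nat R m) hH).
case: m m2 m4 hH => [|[|[|[|[|//]]]]] // _ _ hH.
- exact: omega_le_bound2.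
- exact: omega_le_bound3.
- exact: omega_le_bound4.
Qed.
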